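(* Let $\mathcal{G}$ and $\mathcal{H}$ be hypergraphs. For every $n$, the exterior product $\square$ of simple magnitude chain complexes induces a map on simple magnitude homology which fits into a natural short exact sequence $$0\rightarrow \bigoplus_{p+q=n}\mathrm{MH}_{p,*}(\mathcal{G})\otimes \mathrm{MH}_{q,*}(\mathcal{H})\stackrel{\square}{\longrightarrow}\mathrm{MH}_{n,*}(\mathcal{G}\,\Box\,\mathcal{H})\rightarrow \bigoplus_{p+q=n}\mathrm{Tor}\big(\mathrm{MH}_{p,*}(\mathcal{G}),\mathrm{MH}_{q-1,*}(\mathcal{H})\big)\rightarrow 0 .$$
   Context: A hypergraph $\mathcal{H}=(V,E)$ has vertex set $V$ and a collection $E$ of nonempty finite subsets of $V$ (hyperedges). Coefficients are $\mathbb{Z}$; $\otimes$ and $\mathrm{Tor}$ are over $\mathbb{Z}$. Distance: a path from a hyperedge $\sigma$ to a hyperedge $\tau$ is a sequence of hyperedges $\gamma=\sigma_0\cdots\sigma_k$ ($k\ge0$) with $\sigma_0=\sigma$, $\sigma_k=\tau$, $\sigma_i\cap\sigma_{i+1}\ne\emptyset$. Its length is $\ell(\gamma)=\sum_{i}\ell(\sigma_i,\sigma_{i+1})$, where for $\sigma\cap\tau\neq\emptyset$: $\ell(\sigma,\tau)=0$ if $\sigma=\tau$, $\tfrac12$ if one is strictly contained in the other, $1$ otherwise. The intercrossing distance $d(\sigma,\tau)$ is the infimum of lengths of paths from $\sigma$ to $\tau$ ($\infty$ if there is none). Let $\bar{\mathcal{H}}$ be the hypergraph obtained from $\mathcal{H}$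 by adding all singletons $\{v\}$, $v\in V$, as hyperedges. For $v,w\in V$, $d(v,w)=d_{\mathcal{H}}(v,w)$ is the intercrossing distance from $\{v\}$ to $\{w\}$ on $\bar{\mathcal{H}}$. Simple magnitude homology: for vertices, $\mathcal{L}(v_0,\dots,v_k)=d(v_0,v_1)+\cdots+d(v_{k-1},v_k)$. $\mathrm{MC}_{k,l}(\mathcal{H})$ is the free abelian group on tuples $(v_0,\dots,v_k)$ of vertices with $v_{i-1}\neq v_i$ for $1\le i\le k$ and $\mathcal{L}(v_0,\dots,v_k)=l$. The differential is $\partial_l=\sum_{i=0}^k(-1)^i\partial_{i,l}$ with $\partial_{i,l}(v_0,\dots,v_k)=(v_0,\dots,\widehat{v_i},\dots,v_k)$ if this tuple has length $l$ and $0$ otherwise. $\mathrm{MH}_{k,l}(\mathcal{H})$ is the $k$-th homology of $\mathrm{MC}_{*,l}(\mathcal{H})$. The index $*$ denotes the grading by length: $\mathrm{MH}_{p,*}=\bigoplus_{l\ge0}\mathrm{MH}_{p,l}$, and in length degree $l$ the tensor and Tor terms are the direct sums over $l_1+l_2=l$ of the corresponding terms for $\mathrm{MH}_{p,l_1}(\mathcal{G})$ and $\mathrm{MH}_{q,l_2}(\mathcal{H})$ (respectively $\mathrm{MH}_{q-1,l_2}(\mathcal{H})$). Cartesian product: for $\mathcal{G}=(V_1,E_1)$, $\mathcal{H}=(V_2,E_2)$, the hypergraph $\mathcal{G}\,\Box\,\mathcal{H}$ has vertex set $V_1\times V_2$ and hyperedge set $\{\{x\}\times\tau: x\in V_1,\tau\in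 E_2\}\cup\{\sigma\times\{y\}: y\in V_2,\sigma\in E_1\}$. Exterior product: $\square:\mathrm{MC}_{k_1,l_1}(\mathcal{G})\otimes\mathrm{MC}_{k_2,l_2}(\mathcal{H})\to\mathrm{MC}_{k_1+k_2,l_1+l_2}(\mathcal{G}\,\Box\,\mathcal{H})$ is $$(v_0,\dots,v_{k_1})\,\square\,(w_0,\dots,w_{k_2})=\sum_{(\mu,\nu)}(-1)^{n(\mu,\nu)}\big((v_{\mu(0)},w_{\nu(0)}),\dots,(v_{\mu(k_1+k_2)},w_{\nu(k_1+k_2)})\big),$$ where $(\mu,\nu)$ runs over pairs of integer-valued functions on $\{0,\dots,k_1+k_2\}$ with $\mu(0)=\nu(0)=0$, $\mu(k_1+k_2)=k_1$, $\nu(k_1+k_2)=k_2$, such that for each $0\le i\le k_1+k_2-1$ either $\mu(i+1)=\mu(i)$ and $\nu(i+1)=\nu(i)+1$, or $\mu(i+1)=\mu(i)+1$ and $\nu(i+1)=\nu(i)$. Here $n(\mu,\nu)=\sum_{0\le i<j\le k_1+k_2-1}[\mu(i+1)-\mu(i)][\nu(j+1)-\nu(j)]$. *)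

(* Defs.v *)
From HB Require Import structures.
(* The notations of monalg are not imported: they conflict with the levels
   used by mathcomp-analysis. *)
From mathcomp Require Import -(notations) multinomials.monalg.
From mathcomp Require Import all_boot all_order all_algebra finmap.
From mathcomp Require Import boolp classical_sets functions cardinality.
From mathcomp Require Import reals constructive_ereal ereal interval_inference.
From mathcomp Require Import lra zify.

Set Implicit Arguments.
Unset Strict Implicit.
Unset Printing Implicit Defensive.

Import Order.TTheory GRing.Theory Num.Theory.
Local Open Scope ring_scope.

Definition zero_map (A B : zmodType) : {additive A -> B} := \0.

Definition short_exact (A B C : zmodType) (f : {additive A -> B})
    (g : {additive B -> C}) : Prop :=
  [/\ injective f,
      forall y, g y = 0 <-> exists x, f x = y &
      forall z, exists y, g y = z].

Section Kernel.
Variables (A B : zmodType) (f : {additive A -> B}).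

Definition in_kernel (x : A) : bool := f x == 0.

Lemma in_kernel_closed : zmod_closed in_kernel.
Proof.
split=> [|x y]; rewrite !unfold_in ?raddf0 // => /eqP fx /eqP fy.
by rewrite raddfB fx fy subrr.
Qed.
HB.instance Definition _ := GRing.isZmodClosed.Build A in_kernel in_kernel_closed.

Definition kernel_sub : zmodClosed A := GRing.ZmodClosed.clone A in_kernel _.

Record kernel := Kernel { kval : A; _ : kval \in in_kernel }.
HB.instance Definition _ := [isSub for kval].
HB.instance Definition _ := [Choice of kernel by <:].
HB.instance Definition _ := [SubChoice_isSubZmodule of kernel by <:].

Definition kernel_incl : {additive kernel -> A} := \val.

Lemma kernelP (x : kernel) : f (kval x) = 0.
Proof. by case: x => x /= /eqP. Qed.
End Kernel.

Section KernelMap.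
Variables (A B A' B' : zmodType) (f : {additive A -> B}).
Variables (f' : {additive A' -> B'}) (a : {additive A -> A'}).
Hypothesis fa : forall x, f x = 0 -> f' (a x) = 0.

Lemma kernel_map_subproof (x : kernel f) : a (kval x) \in in_kernel f'.
Proof. by rewrite unfold_in; apply/eqP/fa/kernelP. Qed.

Definition kernel_map_fun (x : kernel f) : kernel f' :=
  Kernel (kernel_map_subproof x).

Lemma kernel_map_is_zmod_morphism : zmod_morphism kernel_map_fun.
Proof. by move=> x y; apply/val_inj; rewrite /= !raddfB. Qed.
HB.instance Definition _ :=
  GRing.isZmodMorphism.Build _ _ kernel_map_fun kernel_map_is_zmod_morphism.

Definition kernel_map : {additive kernel f -> kernel f'} := kernel_map_fun.
End KernelMap.

Section Quotient.
Variables (A : zmodType) (I : zmodClosed A).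
Local Open Scope quotient_scope.

Definition quot_pi : {additive A -> Quotient.quot I} :=
  \pi_(Quotient.quot I).

Lemma quot_pi_eq0 x : quot_pi x = 0 <-> x \in I.
Proof.
rewrite -(raddf0 quot_pi) /quot_pi /=; split=> [/eqP|xI].
  by rewrite -Quotient.idealrBE subr0.
by apply/eqP; rewrite -Quotient.idealrBE subr0.
Qed.

Variables (B : zmodType) (f : {additive A -> B}).
Hypothesis fI : forall x, x \in I -> f x = 0.

Definition quot_lift_fun (q : Quotient.quot I) : B := f (repr q).

Lemma quot_lift_funE x : quot_lift_fun (quot_pi x) = f x.
Proof.
apply/eqP; rewrite -subr_eq0 -raddfB; apply/eqP/fI.
by rewrite Quotient.idealrBE reprK.
Qed.

Lemma quot_lift_is_zmod_morphism : zmod_morphism quot_lift_fun.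
Proof.
move=> x y; rewrite -[x]reprK -[y]reprK.
by rewrite -(raddfB quot_pi) !quot_lift_funE raddfB.
Qed.
HB.instance Definition _ :=
  GRing.isZmodMorphism.Build _ _ quot_lift_fun quot_lift_is_zmod_morphism.

Definition quot_lift : {additive Quotient.quot I -> B} := quot_lift_fun.
End Quotient.

Section Generated.
Variables (A : zmodType) (P : set A).

Definition generated (x : A) : bool :=
  `[< forall S : zmodClosed A, (forall y, P y -> y \in S) -> x \in S >].

Lemma generated_closed : zmod_closed generated.
Proof.
split=> [|x y /asboolP xS /asboolP yS]; apply/asboolP => S PS.
  exact: rpred0.
by rewrite rpredB ?xS ?yS.
Qed.
HB.instance Definition _ := GRing.isZmodClosed.Build A generated generated_closed.

Definition generated_sub : zmodClosed A := GRing.ZmodClosed.clone A generated _.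

Lemma generated_incl x : P x -> x \in generated.
Proof. by move=> Px; apply/asboolP => S; apply. Qed.

Lemma generated_ker (B : zmodType) (f : {additive A -> B}) :
  (forall x, P x -> f x = 0) -> forall x, x \in generated -> f x = 0.
Proof.
move=> fP x /asboolP xS.
suff: x \in kernel_sub f by rewrite unfold_in => /eqP.
by apply: xS => y /fP fy; rewrite unfold_in; apply/eqP.
Qed.
End Generated.

Definition free_ab (K : choiceType) : zmodType := malg K int.
Definition fgen (K : choiceType) (k : K) : free_ab K := mkmalgU k 1.

Section FreeLift.
Variables (K : choiceType) (M : zmodType) (f : K -> M).

Definition free_lift_fun (x : free_ab K) : M :=
  \sum_(k <- msupp x) f k *~ mcoeff k x.

Lemma free_lift_widen (D : {fset K}) (x : free_ab K) : (msupp x `<=` D)%fset ->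
  free_lift_fun x = \sum_(k <- D) f k *~ mcoeff k x.
Proof.
move=> xD; rewrite /free_lift_fun (big_fset_incl _ xD) // => k _.
by move=> /mcoeff_outdom ->; rewrite mulr0z.
Qed.

Lemma free_lift_is_zmod_morphism : zmod_morphism free_lift_fun.
Proof.
move=> x y; pose D := (msupp x `|` msupp y `|` msupp (x - y))%fset.
have xD : (msupp x `<=` D)%fset by rewrite /D -fsetUA fsubsetUl.
have yD : (msupp y `<=` D)%fset by rewrite /D fsetUAC fsubsetUr.
have xyD : (msupp (x - y) `<=` D)%fset by rewrite /D fsubsetUr.
rewrite (free_lift_widen xD) (free_lift_widen yD) (free_lift_widen xyD).
rewrite -sumrB; apply: eq_bigr => k _.
by rewrite mcoeffB mulrzBr.
Qed.
HB.instance Definition _ :=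
  GRing.isZmodMorphism.Build _ _ free_lift_fun free_lift_is_zmod_morphism.

Definition free_lift : {additive free_ab K -> M} := free_lift_fun.

Lemma free_lift_gen k : free_lift (fgen k) = f k.
Proof.
rewrite /= (@free_lift_widen [fset k]%fset) ?msuppU_le //.
by rewrite big_seq_fset1 /fgen mcoeffUU.
Qed.
End FreeLift.

Lemma free_ext (K : choiceType) (M : zmodType) (f g : {additive free_ab K -> M}) :
  (forall k, f (fgen k) = g (fgen k)) -> f =1 g.
Proof.
move=> fg x.
have gU k (c : int) : mkmalgU k c = fgen k *~ c :> free_ab K.
  have -> : c = 1 *~ c by rewrite intz.
  by rewrite raddfMz /= intz.
rewrite (monalgE x) !raddf_sum; apply: eq_bigr => k _.
by rewrite gU !raddfMz fg.
Qed.

Section Tensor.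
Variables A B : zmodType.
Local Notation F := (free_ab (A * B)%type).

Definition bilinear_relations : set F := [set r |
  (exists a a' b, r = fgen (a + a', b) - fgen (a, b) - fgen (a', b)) \/
  (exists a b b', r = fgen (a, b + b') - fgen (a, b) - fgen (a, b'))].

Definition tensor : zmodType := Quotient.quot (generated_sub bilinear_relations).

Definition tens (a : A) (b : B) : tensor :=
  quot_pi (generated_sub bilinear_relations) (fgen (a, b)).

Lemma tensDl a a' b : tens (a + a') b = tens a b + tens a' b.
Proof.
apply/eqP; rewrite -subr_eq0 opprD addrA -!raddfB; apply/eqP/quot_pi_eq0.
by apply: generated_incl; left; exists a, a', b.
Qed.

Lemma tensDr a b b' : tens a (b + b') = tens a b + tens a b'.
Proof.
apply/eqP; rewrite -subr_eq0 opprD addrA -!raddfB; apply/eqP/quot_pi_eq0.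
by apply: generated_incl; right; exists a, b, b'.
Qed.
End Tensor.

Section TensorLift.
Variables (A B M : zmodType) (f : A -> B -> M).
Hypothesis fDl : forall a a' b, f (a + a') b = f a b + f a' b.
Hypothesis fDr : forall a b b', f a (b + b') = f a b + f a b'.

Lemma tens_lift_subproof x : x \in generated (@bilinear_relations A B) ->
  free_lift (fun p => f p.1 p.2) x = 0.
Proof.
apply: generated_ker => {}x [] [a] [b] [c] ->; rewrite !raddfB !free_lift_gen /=.
  by rewrite fDl -addrA -opprD subrr.
by rewrite fDr -addrA -opprD subrr.
Qed.

Definition tens_lift : {additive tensor A B -> M} := quot_lift tens_lift_subproof.

Lemma tens_liftE a b : tens_lift (tens a b) = f a b.
Proof. by rewrite [LHS](quot_lift_funE tens_lift_subproof) free_lift_gen. Qed.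
End TensorLift.

Lemma tens_ext (A B M : zmodType) (f g : {additive tensor A B -> M}) :
  (forall a b, f (tens a b) = g (tens a b)) -> f =1 g.
Proof.
move=> fg x; rewrite -[x](@reprK _ (tensor A B)).
pose q := quot_pi (generated_sub (@bilinear_relations A B)).
by apply: (free_ext (f := f \o q) (g := g \o q)) => -[a b]; apply: fg.
Qed.

Section TensorMap.
Variables (A B A' B' : zmodType) (f : {additive A -> A'}) (g : {additive B -> B'}).

Lemma tens_map_subproofl a a' b :
  tens (f (a + a')) (g b) = tens (f a) (g b) + tens (f a') (g b).
Proof. by rewrite raddfD tensDl. Qed.

Lemma tens_map_subproofr a b b' :
  tens (f a) (g (b + b')) = tens (f a) (g b) + tens (f a) (g b').
Proof. by rewrite raddfD tensDr. Qed.

Definition tens_map : {additive tensor A B -> tensor A' B'} :=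
  tens_lift tens_map_subproofl tens_map_subproofr.

Lemma tens_mapE a b : tens_map (tens a b) = tens (f a) (g b).
Proof. exact: tens_liftE. Qed.
End TensorMap.

(* [free_res A -> free_ab A -> A] is the canonical free resolution of [A]:
   [free_res A] is free, being a subgroup of a free abelian group.  Hence
   [Tor A B] is the kernel of [free_res A (x) B -> free_ab A (x) B]. *)
Definition free_aug (A : zmodType) : {additive free_ab A -> A} := free_lift id.

Definition free_res (A : zmodType) : zmodType := kernel (free_aug A).

Definition tor_map0 (A B : zmodType) :
    {additive tensor (free_res A) B -> tensor (free_ab A) B} :=
  tens_map (kernel_incl (free_aug A)) idfun.

Definition tor (A B : zmodType) : zmodType := kernel (tor_map0 A B).

Definition free_ab_map (A A' : zmodType) (f : A -> A') :
    {additive free_ab A -> free_ab A'} :=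
  free_lift (fun a => fgen (f a)).

Section TorMap.
Variables (A B A' B' : zmodType) (f : {additive A -> A'}) (g : {additive B -> B'}).

Lemma free_aug_natural x : free_aug A' (free_ab_map f x) = f (free_aug A x).
Proof.
apply: (free_ext (f := free_aug A' \o free_ab_map f) (g := f \o free_aug A)).
move=> a; rewrite -[LHS]/(free_aug A' (free_ab_map f (fgen a))).
by rewrite -[RHS]/(f (free_aug A (fgen a))) !free_lift_gen.
Qed.

Lemma free_res_map_subproof x : free_aug A x = 0 -> free_aug A' (free_ab_map f x) = 0.
Proof. by rewrite free_aug_natural => ->; rewrite raddf0. Qed.

Definition free_res_map : {additive free_res A -> free_res A'} :=
  kernel_map free_res_map_subproof.

Lemma tor_map0_natural x :
  tor_map0 A' B' (tens_map free_res_map g x) =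
  tens_map (free_ab_map f) g (tor_map0 A B x).
Proof.
apply: (tens_ext (f := tor_map0 A' B' \o tens_map free_res_map g)
                 (g := tens_map (free_ab_map f) g \o tor_map0 A B)).
move=> a b; rewrite -[LHS]/(tor_map0 A' B' (tens_map free_res_map g (tens a b))).
rewrite -[RHS]/(tens_map (free_ab_map f) g (tor_map0 A B (tens a b))).
by rewrite !tens_mapE.
Qed.

Lemma tor_map_subproof x :
  tor_map0 A B x = 0 -> tor_map0 A' B' (tens_map free_res_map g x) = 0.
Proof. by rewrite tor_map0_natural => ->; rewrite raddf0. Qed.

Definition tor_map : {additive tor A B -> tor A' B'} := kernel_map tor_map_subproof.
End TorMap.

Section DirectSum.
Variables (I : choiceType) (A : I -> zmodType).

Definition dprod := forall i, A i.
HB.instance Definition _ := Choice.on dprod.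

Definition dprod_add (f g : dprod) : dprod := fun i => f i + g i.
Definition dprod_opp (f : dprod) : dprod := fun i => - f i.
Definition dprod_zero : dprod := fun=> 0.

Lemma dprod_addA : associative dprod_add.
Proof. by move=> f g h; apply: functional_extensionality_dep => i; apply: addrA. Qed.
Lemma dprod_addC : commutative dprod_add.
Proof. by move=> f g; apply: functional_extensionality_dep => i; apply: addrC. Qed.
Lemma dprod_add0 : left_id dprod_zero dprod_add.
Proof. by move=> f; apply: functional_extensionality_dep => i; apply: add0r. Qed.
Lemma dprod_addN : left_inverse dprod_zero dprod_opp dprod_add.
Proof. by move=> f; apply: functional_extensionality_dep => i; apply: addNr. Qed.
HB.instance Definition _ :=
  GRing.isZmodule.Build dprod dprod_addA dprod_addC dprod_add0 dprod_addN.

Definition finite_support : pred dprod := fun f =>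
  `[< finite_set [set i | f i != 0]%classic >].

Lemma finite_support_closed : zmod_closed finite_support.
Proof.
split=> [|f g /asboolP ff /asboolP fg]; apply/asboolP.
  by rewrite (_ : [set _ | _]%classic = set0) //; apply/seteqP; split=> // i /=; rewrite eqxx.
apply: (@sub_finite_set _ _ ([set i | f i != 0] `|` [set i | g i != 0])%classic).
  move=> i /=; apply: contra_neqP => /not_orP[/negP/negPn/eqP fi /negP/negPn/eqP gi].
  by rewrite [LHS](_ : _ = f i - g i) // fi gi subrr.
by rewrite finite_setU.
Qed.
HB.instance Definition _ :=
  GRing.isZmodClosed.Build dprod finite_support finite_support_closed.

Record dsum := DSum { dsval : dprod; _ : dsval \in finite_support }.
HB.instance Definition _ := [isSub for dsval].
HB.instance Definition _ := [Choice of dsum by <:].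
HB.instance Definition _ := [SubChoice_isSubZmodule of dsum by <:].

Lemma dsum_in_subproof i (a : A i) :
  (@dfwith I A (fun=> 0) i a : dprod) \in finite_support.
Proof.
apply/asboolP; apply: (@sub_finite_set _ _ [set i]%classic) => // j /=.
by case: dfwithP => // k _; rewrite eqxx.
Qed.

Definition dsum_in_fun i (a : A i) : dsum := DSum (dsum_in_subproof a).

Lemma dsum_in_is_zmod_morphism i : zmod_morphism (@dsum_in_fun i).
Proof.
move=> a b; apply/val_inj/functional_extensionality_dep => j /=.
rewrite [RHS](_ : _ = @dfwith I A (fun=> 0) i a j - @dfwith I A (fun=> 0) i b j) //.
have [ij|/eqP ij] := pselect (i = j); first by case: j / ij; rewrite !dfwith_in.
by rewrite !dfwith_out // subr0.
Qed.
HB.instance Definition _ i := GRing.isZmodMorphism.Build _ _ (@dsum_in_fun i)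
  (@dsum_in_is_zmod_morphism i).

Definition dsum_in i : {additive A i -> dsum} := @dsum_in_fun i.
End DirectSum.

Section DirectSumMap.
Variables (I : choiceType) (A B : I -> zmodType).
Variable f : forall i, {additive A i -> B i}.

Lemma dsum_map_subproof (x : dsum A) :
  (fun i => f i (dsval x i) : B i) \in @finite_support I B.
Proof.
case: x => x /= /asboolP xf; apply/asboolP; apply: sub_finite_set xf => i /=.
by apply: contra_neq => ->; rewrite raddf0.
Qed.

Definition dsum_map_fun (x : dsum A) : dsum B := DSum (dsum_map_subproof x).

Lemma dsum_map_is_zmod_morphism : zmod_morphism dsum_map_fun.
Proof.
move=> x y; apply/val_inj/functional_extensionality_dep => i /=.
exact: (raddfB (f i)).
Qed.
HB.instance Definition _ :=
  GRing.isZmodMorphism.Build _ _ dsum_map_fun dsum_map_is_zmod_morphism.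

Definition dsum_map : {additive dsum A -> dsum B} := dsum_map_fun.
End DirectSumMap.

Record chain_complex := ChainComplex {
  chain :> nat -> zmodType;
  bd : forall k, {additive chain k.+1 -> chain k};
  bd_bd : forall k (x : chain k.+2), bd k (bd k.+1 x) = 0 }.

Section Homology.
Variables (C : chain_complex) (k : nat).

Definition bd_out : {additive C k -> C k.-1} :=
  match k with 0 => zero_map _ _ | k'.+1 => bd C k' end.

Definition cycles : zmodType := kernel bd_out.

Definition in_boundary (z : cycles) : bool :=
  `[< exists c : C k.+1, bd C k c = kval z >].

Lemma in_boundary_closed : zmod_closed in_boundary.
Proof.
split=> [|x y /asboolP[c cx] /asboolP[d dy]]; apply/asboolP.
  by exists 0; rewrite raddf0.
by exists (c - d); rewrite raddfB cx dy.
Qed.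
HB.instance Definition _ :=
  GRing.isZmodClosed.Build cycles in_boundary in_boundary_closed.

Definition boundary_sub : zmodClosed cycles :=
  GRing.ZmodClosed.clone cycles in_boundary _.

Definition homology : zmodType := Quotient.quot boundary_sub.

Definition hclass : {additive cycles -> homology} := quot_pi boundary_sub.
End Homology.

Record chain_map (C D : chain_complex) := ChainMap {
  chain_fun :> forall k, {additive C k -> D k};
  chain_funP : forall k x, bd D k (chain_fun k.+1 x) = chain_fun k (bd C k x) }.

Section HomologyMap.
Variables (C D : chain_complex) (f : chain_map C D) (k : nat).

Lemma cycles_map_subproof x : bd_out C k x = 0 -> bd_out D k (f k x) = 0.
Proof. by case: k x => [|k'] x //= bx; rewrite chain_funP bx raddf0. Qed.

Definition cycles_map : {additive cycles C k -> cycles D k} :=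
  kernel_map cycles_map_subproof.

Lemma homology_map_subproof z :
  z \in boundary_sub C k -> (hclass D k \o cycles_map) z = 0.
Proof.
move=> /asboolP[c cz]; apply/quot_pi_eq0/asboolP.
by exists (f k.+1 c); rewrite chain_funP cz.
Qed.

Definition homology_map : {additive homology C k -> homology D k} :=
  quot_lift homology_map_subproof.

Lemma homology_mapE z : homology_map (hclass C k z) = hclass D k (cycles_map z).
Proof. exact: (quot_lift_funE homology_map_subproof). Qed.
End HomologyMap.

(* Homology in degree [q - 1], which vanishes for [q = 0]. *)
Definition homology_pred (C : chain_complex) (q : nat) : zmodType :=
  if q is q'.+1 then homology C q' else 'I_1.

Definition homology_pred_map (C D : chain_complex) (f : chain_map C D) (q : nat) :
    {additive homology_pred C q -> homology_pred D q} :=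
  match q with 0 => zero_map _ _ | q'.+1 => homology_map f q' end.

Record hypergraph := Hypergraph {
  vertex :> choiceType;
  hedge : set {fset vertex};
  hedge_neq0 : forall e, hedge e -> e != fset0 }.
Arguments hedge : clear implicits.

Record hmorphism (G H : hypergraph) := HMorphism {
  hmor_fun :> G -> H;
  hmorP : forall e, hedge G e -> hedge H [fset hmor_fun x | x in e]%fset }.

Lemma imfset_fset1 (T U : choiceType) (f : T -> U) x :
  [fset f y | y in [fset x]]%fset = [fset f x]%fset.
Proof.
apply/fsetP => z; rewrite inE; apply/imfsetP/eqP => [[y /=]|->].
  by rewrite inE => /eqP ->.
by exists x; rewrite ?inE.
Qed.

Section Closure.
Variable H : hypergraph.

Definition hbar_edge : set {fset H} :=
  (hedge H `|` [set [fset v]%fset | v in [set: H]])%classic.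

Lemma hbar_edge_neq0 e : hbar_edge e -> e != fset0.
Proof.
case=> [/hedge_neq0 //|[v _ <-]].
by apply/fset0Pn; exists v; rewrite inE.
Qed.

Definition hbar : hypergraph := Hypergraph hbar_edge_neq0.
End Closure.

Definition succ_pairs (T : Type) (s : seq T) : seq (T * T) := zip s (behead s).

Section Distance.
Variable R : realType.

Definition step_len (T : choiceType) (s t : {fset T}) : R :=
  if s == t then 0 else if (s `<` t)%fset || (t `<` s)%fset then 2^-1 else 1.

Definition meets (T : choiceType) (s t : {fset T}) : bool := (s `&` t)%fset != fset0.

(* The path is [s :: p]. *)
Definition is_hpath (H : hypergraph) (s t : {fset H}) (p : seq {fset H}) : Prop :=
  [/\ forall e, e \in s :: p -> hedge H e, path (@meets H) s p & last s p = t].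

Definition hpath_len (T : choiceType) (s : {fset T}) (p : seq {fset T}) : R :=
  \sum_(e <- succ_pairs (s :: p)) step_len e.1 e.2.

Definition icdist (H : hypergraph) (s t : {fset H}) : \bar R :=
  ereal_inf [set (hpath_len s p)%:E | p in is_hpath s t]%classic.

Definition hdist (H : hypergraph) (v w : H) : \bar R :=
  icdist (H := hbar H) [fset v]%fset [fset w]%fset.

Lemma step_len_ge0 (T : choiceType) (s t : {fset T}) : 0 <= step_len s t.
Proof. by rewrite /step_len; case: ifP => // _; case: ifP. Qed.

Lemma step_len_ge_half (T : choiceType) (s t : {fset T}) :
  s != t -> 2^-1 <= step_len s t.
Proof.
rewrite /step_len => /negPf ->; case: ifP => // _.
by rewrite invf_le1 // ler1n.
Qed.

Lemma step_len_le1 (T : choiceType) (s t : {fset T}) : step_len s t <= 1.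
Proof.
rewrite /step_len; case: ifP => // _; case: ifP => // _.
by rewrite invf_le1 // ler1n.
Qed.

Lemma hpath_len_cons (T : choiceType) (s t : {fset T}) p :
  hpath_len s (t :: p) = step_len s t + hpath_len t p.
Proof. by rewrite /hpath_len /succ_pairs /= big_cons. Qed.

Lemma hpath_len_nil (T : choiceType) (s : {fset T}) : hpath_len s [::] = 0.
Proof. by rewrite /hpath_len big_nil. Qed.

Lemma hpath_len_ge0 (T : choiceType) (s : {fset T}) p : 0 <= hpath_len s p.
Proof. by apply: sumr_ge0 => e _; apply: step_len_ge0. Qed.

Lemma hpath_len_cat (T : choiceType) (s : {fset T}) p q :
  hpath_len s (p ++ q) = hpath_len s p + hpath_len (last s p) q.
Proof.
elim: p s => [|t p IH] s /=; first by rewrite hpath_len_nil add0r.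
by rewrite !hpath_len_cons IH addrA.
Qed.

Lemma hpath_len_ge_half (T : choiceType) (s : {fset T}) p :
  s != last s p -> 2^-1 <= hpath_len s p.
Proof.
elim: p s => [|t p IH] s /=; first by rewrite eqxx.
rewrite hpath_len_cons; have [->|st] := eqVneq s t; first last.
  by move=> _; rewrite ler_wpDr ?hpath_len_ge0 ?step_len_ge_half.
by move=> /IH tp; rewrite ler_wpDl ?step_len_ge0.
Qed.

Lemma is_hpath_cat (H : hypergraph) (s t u : {fset H}) p q :
  is_hpath s t p -> is_hpath t u q -> is_hpath s u (p ++ q).
Proof.
move=> [pE pP pl] [qE qP ql]; split.
- move=> e; rewrite -cat_cons mem_cat => /orP[/pE //|eq].
  by apply: qE; rewrite inE eq orbT.
- by rewrite cat_path pP pl.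
- by rewrite last_cat pl.
Qed.

Local Open Scope ereal_scope.

Lemma icdist_ge0 (H : hypergraph) (s t : {fset H}) : 0 <= icdist s t.
Proof. by apply/ereal_infP => _ [p _ <-]; rewrite lee_fin hpath_len_ge0. Qed.

Lemma icdist_le (H : hypergraph) (s t : {fset H}) p :
  is_hpath s t p -> icdist s t <= (hpath_len s p)%:E.
Proof. by move=> pP; apply: ereal_inf_lbound; exists p. Qed.

Lemma icdist_triangle (H : hypergraph) (s t u : {fset H}) :
  icdist s u <= icdist s t + icdist t u.
Proof.
have [->|tu] := eqVneq (icdist t u) +oo.
  by rewrite addey ?leey // -ltNye (lt_le_trans _ (icdist_ge0 _ _)).
have tu_fin : icdist t u \is a fin_num.
  by rewrite ge0_fin_numE ?icdist_ge0 // ltey.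
rewrite -leeBlDr //; apply/ereal_infP => _ [p pP <-].
rewrite leeBlDr // addeC -leeBlDr //; apply/ereal_infP => _ [q qP <-].
rewrite leeBlDr // -EFinD addrC; case: (pP) => _ _ <-.
by rewrite -hpath_len_cat; apply/icdist_le/is_hpath_cat/qP.
Qed.

Lemma hdist_ge0 (H : hypergraph) (v w : H) : 0 <= hdist v w.
Proof. exact: icdist_ge0. Qed.

Lemma hdistxx (H : hypergraph) (v : H) : hdist v v = 0.
Proof.
apply/eqP; rewrite eq_le hdist_ge0 andbT.
rewrite -[leRHS](congr1 EFin (hpath_len_nil [fset v]%fset)).
apply: icdist_le; split=> // e; rewrite inE => /eqP ->.
by right; exists v.
Qed.

Lemma hdist_triangle (H : hypergraph) (u v w : H) :
  hdist u w <= hdist u v + hdist v w.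
Proof. exact: icdist_triangle. Qed.

Lemma hdist_gt0 (H : hypergraph) (v w : H) : v != w -> 0 < hdist v w.
Proof.
move=> vw; apply: (@lt_le_trans _ _ (2^-1)%:E); first by rewrite lte_fin invr_gt0.
apply/ereal_infP => _ [p [_ _ pl] <-]; rewrite lee_fin hpath_len_ge_half // pl.
by apply: contra_neq vw => /fset1_inj.
Qed.

Section NonExpansive.
Variables (G H : hypergraph) (f : G -> H).
Hypothesis fE : forall e : {fset G}, hedge (hbar G) e ->
  hedge (hbar H) [fset f x | x in e]%fset.

Let F (e : {fset G}) : {fset H} := [fset f x | x in e]%fset.

Lemma step_len_imfset s t : (step_len (F s) (F t) <= step_len s t)%R.
Proof.
have sub a b : (a `<` b)%fset -> (F a == F b) || (F a `<` F b)%fset.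
  move=> /fproper_sub ab; rewrite fproperEneq; case: eqP => //= _.
  apply/fsubsetP => _ /imfsetP[x /= xa ->].
  by rewrite in_imfset // (fsubsetP ab).
rewrite {2}/step_len; case: (eqVneq s t) => [->|st].
  by rewrite /step_len eqxx.
case: ifP => [|_]; last exact: step_len_le1.
rewrite /step_len; case/orP => /sub; first by case/orP => ->; [|case: ifP].
rewrite eq_sym; case/orP => ->; first by [].
by rewrite orbT; case: ifP.
Qed.

Lemma meets_imfset s t : meets s t -> meets (F s) (F t).
Proof.
move=> /fset0Pn[x]; rewrite inE => /andP[xs xt].
by apply/fset0Pn; exists (f x); rewrite inE !in_imfset.
Qed.

Lemma hpath_imfset s p : 
  (path (@meets G) s p -> path (@meets H) (F s) (map F p)) /\
  (hpath_len (F s) (map F p) <= hpath_len s p)%R.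
Proof.
elim: p s => [|t p IH] s /=; first by rewrite !hpath_len_nil.
have [IH1 IH2] := IH t; split.
  by move=> /andP[/meets_imfset -> /IH1].
by rewrite !hpath_len_cons lerD ?step_len_imfset.
Qed.

Lemma hdist_nonexp v w : hdist (f v) (f w) <= hdist v w.
Proof.
apply/ereal_infP => _ [p [pE pP pl] <-].
have F1 x : F [fset x]%fset = [fset f x]%fset by rewrite /F imfset_fset1.
have [pP' pL] := hpath_imfset [fset v]%fset p.
apply: (@le_trans _ _ (hpath_len (F [fset v]%fset) (map F p))%:E); last by rewrite lee_fin.
rewrite F1; apply: icdist_le; split.
- move=> e; rewrite -F1 -map_cons => /mapP[e' /pE e'E ->]; exact: fE.
- by rewrite -F1; apply: pP'.
- by rewrite -F1 last_map pl F1.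
Qed.
End NonExpansive.

Lemma hmor_nonexp (G H : hypergraph) (f : hmorphism G H) v w :
  hdist (f v) (f w) <= hdist v w.
Proof.
apply: hdist_nonexp => e [eG|[x _ <-]]; first by left; apply: hmorP.
by right; exists (f x) => //; rewrite imfset_fset1.
Qed.

End Distance.

Section TupleLength.
Variables (R : realType) (H : hypergraph).
Local Open Scope ereal_scope.

Definition tuple_len (s : seq H) : \bar R :=
  \sum_(e <- succ_pairs s) hdist R e.1 e.2.

Lemma tuple_len_cons x y s :
  tuple_len [:: x, y & s] = hdist R x y + tuple_len (y :: s).
Proof. by rewrite /tuple_len /succ_pairs /= big_cons. Qed.

Lemma tuple_len1 x : tuple_len [:: x] = 0.
Proof. by rewrite /tuple_len big_nil. Qed.

Lemma tuple_len_ge0 s : 0 <= tuple_len s.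
Proof. by apply: sume_ge0 => e _; apply: hdist_ge0. Qed.

Lemma tuple_len_del s1 x s2 : tuple_len (s1 ++ s2) <= tuple_len (s1 ++ x :: s2).
Proof.
elim: s1 => [|a [|b s1] IH] /=.
- case: s2 => [|b s2]; last by rewrite tuple_len_cons leeDr ?hdist_ge0.
  by rewrite tuple_len1 /tuple_len big_nil.
- case: s2 {IH} => [|b s2]; rewrite !tuple_len_cons ?tuple_len1.
    by rewrite adde0 hdist_ge0.
  by rewrite addeA leeD2r // hdist_triangle.
- by rewrite !tuple_len_cons leeD2l.
Qed.

Definition adj_neq (s : seq H) : bool := sorted (fun x y => x != y) s.

Lemma adj_neq_del s1 x s2 : adj_neq (s1 ++ x :: s2) ->
  tuple_len (s1 ++ s2) = tuple_len (s1 ++ x :: s2) ->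
  tuple_len (s1 ++ s2) \is a fin_num -> adj_neq (s1 ++ s2).
Proof.
rewrite /adj_neq; elim: s1 => [|a [|b s1] IH] /=.
- by move=> + _ _; apply: path_sorted.
- case: s2 {IH} => [//|b s2] /= /and3P[ax xb ->].
  rewrite !tuple_len_cons andbT addeA => e; rewrite fin_numD => /andP[dab sf].
  have {e} : hdist R a b = hdist R a x + hdist R x b.
    by move/(congr1 (fun z => z - tuple_len (b :: s2))): e; rewrite !addeK.
  move=> dab'; apply/eqP => ab; move: dab' xb; rewrite -ab hdistxx => /eqP + xa.
  by rewrite lt_eqF // adde_gt0 // hdist_gt0.
- rewrite !tuple_len_cons => /andP[-> /=] ss e; rewrite fin_numD => /andP[fab sf].
  apply: IH => //; move: e; rewrite ![hdist R a b + _]addeC.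
  by move/(congr1 (fun z => z - hdist R a b)); rewrite !addeK.
Qed.
End TupleLength.

Section TupleMap.
Variables (R : realType) (G H : hypergraph) (f : hmorphism G H).
Local Open Scope ereal_scope.

Lemma tuple_len_map s : tuple_len R (map f s) <= tuple_len R s.
Proof.
elim: s => [|a [|b s] IH] /=; first by rewrite /tuple_len !big_nil.
  by rewrite !tuple_len1.
by rewrite !tuple_len_cons leeD ?hmor_nonexp.
Qed.

Lemma adj_neq_map s : adj_neq s -> tuple_len R (map f s) = tuple_len R s ->
  tuple_len R s \is a fin_num -> adj_neq (map f s).
Proof.
rewrite /adj_neq; elim: s => [|a [|b s] IH] //= /andP[ab bs].
rewrite !tuple_len_cons => e; rewrite fin_numD => /andP[dab sf].
have fab := hmor_nonexp R f a b.
have fs := tuple_len_map (b :: s).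
have fdab : hdist R (f a) (f b) \is a fin_num.
  by rewrite ge0_fin_numE ?hdist_ge0 // (le_lt_trans fab) // ltey_eq dab.
have fsf : tuple_len R (map f (b :: s)) \is a fin_num.
  by rewrite ge0_fin_numE ?tuple_len_ge0 // (le_lt_trans fs) // ltey_eq sf.
have {e} [eab es] : hdist R (f a) (f b) = hdist R a b /\
    tuple_len R (map f (b :: s)) = tuple_len R (b :: s).
  move: e fab fs => /=.
  move: (hdist R a b) (hdist R (f a) (f b)) dab fdab => [u| |] // [v| |] // _ _.
  move: (tuple_len R (b :: s)) (tuple_len R (f b :: map f s)) sf fsf.
  move=> [u'| |] // [v'| |] // _ _; rewrite -!EFinD !lee_fin => -[e] h1 h2.
  by split; congr _%:E; lra.
have /= -> := IH bs es sf; rewrite andbT.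
by apply/eqP => fe; have := hdist_gt0 R ab; rewrite -eab fe hdistxx ltxx.
Qed.
End TupleMap.

Section MagnitudeChains.
Variables (R : realType) (H : hypergraph).

Definition is_mgen (k : nat) (l : R) (t : k.+1.-tuple H) : bool :=
  adj_neq t && (tuple_len R t == l%:E).

Record mgen (k : nat) (l : R) := MGen {
  mgen_tuple :> k.+1.-tuple H;
  _ : is_mgen l mgen_tuple }.
HB.instance Definition _ k l := [isSub for @mgen_tuple k l].
HB.instance Definition _ k l := [Choice of mgen k l by <:].

Definition mc_group (k : nat) (l : R) : zmodType := free_ab (mgen k l).

(* On a face of a generator this only tests the length: see [is_mgen_face]. *)
Definition mc_of_tuple (k : nat) (l : R) (t : k.+1.-tuple H) : mc_group k l :=
  if insub t is Some g then fgen (g : mgen k l) else 0.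

Definition face (k : nat) (i : 'I_k.+2) (t : k.+2.-tuple H) : k.+1.-tuple H :=
  [tuple tnth t (lift i j) | j < k.+1].

Definition mc_bd (k : nat) (l : R) : {additive mc_group k.+1 l -> mc_group k l} :=
  free_lift (fun g : mgen k.+1 l =>
    \sum_(i < k.+2) mc_of_tuple l (face i g) *~ (-1) ^+ i).

Lemma mc_of_tuple0 k l (t : k.+1.-tuple H) : ~~ is_mgen l t -> mc_of_tuple l t = 0.
Proof. by move=> tg; rewrite /mc_of_tuple insubN. Qed.

Lemma mc_of_tupleT k l (t : k.+1.-tuple H) (tg : is_mgen l t) :
  mc_of_tuple l t = fgen (MGen tg).
Proof. by rewrite /mc_of_tuple insubT. Qed.

Lemma face_val k (i : 'I_k.+2) (t : k.+2.-tuple H) :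
  face i t = take i t ++ drop i.+1 t :> seq H.
Proof.
have x0 := thead t.
have sz : size (take i t ++ drop i.+1 t) = k.+1.
  by rewrite size_cat size_take size_drop size_tuple ltn_ord; have := ltn_ord i; lia.
apply: (@eq_from_nth _ x0) => [|j]; first by rewrite sz size_tuple.
rewrite size_tuple => jk.
rewrite -[j]/(val (Ordinal jk)) -tnth_nth tnth_mktuple (tnth_nth x0) /=.
rewrite nth_cat size_take size_tuple ltn_ord /bump leqNgt.
case: ltnP => ij /=; first by rewrite nth_take.
by rewrite nth_drop; congr nth; lia.
Qed.

Lemma face_split k (i : 'I_k.+2) (t : k.+2.-tuple H) : exists s1 x s2,
  t = s1 ++ x :: s2 :> seq H /\ face i t = s1 ++ s2 :> seq H.
Proof.
exists (take i t), (tnth t i), (drop i.+1 t); split; last exact: face_val.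
by rewrite (tnth_nth (thead t)) -drop_nth ?cat_take_drop // size_tuple.
Qed.

Lemma face_is_mgen k l (i : 'I_k.+2) (t : k.+2.-tuple H) :
  (tuple_len R t <= l%:E)%E -> is_mgen l (face i t) -> tuple_len R t = l%:E.
Proof.
have [s1 [x [s2 [te fe]]]] := face_split i t.
move=> tl /andP[_ /eqP fl]; apply/eqP; rewrite eq_le tl -fl fe te.
exact: tuple_len_del.
Qed.

Lemma len_face_le k l (i : 'I_k.+2) (t : k.+2.-tuple H) :
  is_mgen l t -> (tuple_len R (face i t) <= l%:E)%E.
Proof.
have [s1 [x [s2 [te fe]]]] := face_split i t.
by move=> /andP[_ /eqP <-]; rewrite te fe tuple_len_del.
Qed.

Lemma is_mgen_face k l (i : 'I_k.+2) (t : k.+2.-tuple H) :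
  is_mgen l t -> tuple_len R (face i t) = l%:E -> is_mgen l (face i t).
Proof.
move=> /andP[tn /eqP tl] fl; rewrite /is_mgen fl eqxx andbT.
have [s1 [x [s2 [te fe]]]] := face_split i t.
rewrite fe; apply: (@adj_neq_del R _ _ x); rewrite -?fe -?te ?fl //.
Qed.

Lemma mc_bd_tuple k l (t : k.+2.-tuple H) :
  (forall i, is_mgen l (face i t) -> is_mgen l t) ->
  mc_bd k l (mc_of_tuple l t) =
  \sum_(i < k.+2) mc_of_tuple l (face i t) *~ (-1) ^+ i.
Proof.
have [tg _|tg ft] := boolP (is_mgen l t).
  by rewrite (mc_of_tupleT tg) [LHS]free_lift_gen.
rewrite (mc_of_tuple0 tg) raddf0 big1 // => i _.
by rewrite mc_of_tuple0 ?mul0rz //; apply: contra tg => /ft.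
Qed.

Lemma face_face k (i : 'I_k.+3) (j : 'I_k.+2) (t : k.+3.-tuple H) :
  face j (face i t) = face (inord (unbump j i)) (face (lift i j) t).
Proof.
have lt_ji : (unbump j i < k.+2)%N.
  by have := ltn_ord i; have := ltn_ord j; rewrite /unbump; lia.
have eq_lift m : lift i (lift j m) = lift (lift i j) (lift (inord (unbump j i)) m).
  apply/val_inj; rewrite [LHS]bumpC; congr (bump _ (bump _ _)).
  by rewrite inordK.
by apply: eq_from_tnth => m; rewrite !tnth_mktuple eq_lift.
Qed.

Lemma mc_bd_bd k l (x : mc_group k.+2 l) : mc_bd k l (mc_bd k.+1 l x) = 0.
Proof.
have -> : 0 = zero_map (mc_group k.+2 l) (mc_group k l) x by [].
apply: (free_ext (f := mc_bd k l \o mc_bd k.+1 l)) => g.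
rewrite -[LHS]/(mc_bd k l (mc_bd k.+1 l (fgen g))) -[RHS]/0.
rewrite free_lift_gen raddf_sum.
pose F (p : 'I_k.+3 * 'I_k.+2) : mc_group k l :=
  mc_of_tuple l (face p.2 (face p.1 g)) *~ (-1) ^+ (p.1 + p.2).
pose h (p : 'I_k.+3 * 'I_k.+2) : 'I_k.+3 * 'I_k.+2 :=
  (lift p.1 p.2, inord (unbump p.2 p.1)).
have lt_unbump (i : 'I_k.+3) (j : 'I_k.+2) : (unbump j i < k.+2)%N.
  by have := ltn_ord i; have := ltn_ord j; rewrite /unbump; lia.
have hK : involutive h.
  move=> [i j]; rewrite /h /=; congr pair; apply/val_inj => /=.
    rewrite inordK // /bump /unbump; have := ltn_ord i; have := ltn_ord j; lia.
  rewrite inordK /=; last first.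
    by have := ltn_ord i; have := ltn_ord j; rewrite inordK // /bump /unbump; lia.
  by rewrite inordK // /bump /unbump; lia.
have Fh p : F (h p) = - F p.
  case: p => i j; rewrite /F /= -face_face inordK // -mulrNz; congr (_ *~ _).
  have [ij|ji] := leqP i j.
    rewrite (_ : bump i j + unbump j i = (i + j).+1)%N ?exprS ?mulN1r //.
    by rewrite /bump /unbump; lia.
  rewrite (_ : i + j = (bump i j + unbump j i).+1)%N ?exprS ?mulN1r ?opprK //.
  by rewrite /bump /unbump; lia.
transitivity (\sum_p F p).
  rewrite -(pair_bigA _ (fun i j => F (i, j))) /=; apply: eq_bigr => i _.
  rewrite raddfMz mc_bd_tuple; last first.
    move=> j jg; apply: (is_mgen_face (valP g)).
    exact: face_is_mgen (len_face_le i (valP g)) jg.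
  rewrite mulrz_suml; apply: eq_bigr => j _.
  by rewrite -mulrzA /F /= exprD mulrC.
have SN : \sum_p F p = - \sum_p F p.
  rewrite {1}(reindex_inj (inv_inj hK)) -sumrN; apply: eq_bigr => p _.
  exact: Fh.
apply/malgP => c; move: (congr1 (mcoeff c) SN).
rewrite mcoeffN mcoeff0; lia.
Qed.

End MagnitudeChains.

Definition magnitude_complex (R : realType) (H : hypergraph) (l : R) : chain_complex :=
  ChainComplex (fun k => @mc_bd_bd R H k l).

Definition magnitude_homology (R : realType) (H : hypergraph) (k : nat) (l : R) :
  zmodType := homology (magnitude_complex H l) k.

Section MagnitudeMap.
Variables (R : realType) (G H : hypergraph) (f : hmorphism G H).

Definition mc_map_fun (k : nat) (l : R) : {additive mc_group G k l -> mc_group H k l} :=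
  free_lift (fun g : mgen G k l => mc_of_tuple l (map_tuple f g)).

Lemma face_map_tuple k (i : 'I_k.+2) (t : k.+2.-tuple G) :
  face i (map_tuple f t) = map_tuple f (face i t).
Proof. by apply: eq_from_tnth => j; rewrite !(tnth_mktuple, tnth_map). Qed.

Lemma is_mgen_map k l (t : k.+1.-tuple G) :
  is_mgen l t -> tuple_len R (map f t) = l%:E -> is_mgen l (map_tuple f t).
Proof.
move=> /andP[tn /eqP tl] fl; rewrite /is_mgen fl eqxx andbT.
by apply: (adj_neq_map (R := R)) => //; rewrite ?fl tl.
Qed.

Lemma mc_map_tuple k l (t : k.+1.-tuple G) :
  (is_mgen l (map_tuple f t) -> is_mgen l t) ->
  mc_map_fun k l (mc_of_tuple l t) = mc_of_tuple l (map_tuple f t).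
Proof.
have [tg _|tg ft] := boolP (is_mgen l t).
  by rewrite (mc_of_tupleT tg) [LHS]free_lift_gen.
by rewrite (mc_of_tuple0 tg) raddf0 mc_of_tuple0 //; apply/negP => /ft.
Qed.

Lemma mc_map_bd k l (x : mc_group G k.+1 l) :
  mc_bd H k l (mc_map_fun k.+1 l x) = mc_map_fun k l (mc_bd G k l x).
Proof.
apply: (free_ext (f := mc_bd H k l \o mc_map_fun k.+1 l)
                 (g := mc_map_fun k l \o mc_bd G k l)) => g.
rewrite -[LHS]/(mc_bd H k l (mc_map_fun k.+1 l (fgen g))).
rewrite -[RHS]/(mc_map_fun k l (mc_bd G k l (fgen g))) !free_lift_gen raddf_sum.
have /andP[_ /eqP gl] := valP g.
rewrite mc_bd_tuple; last first.
  move=> i ig; apply: (is_mgen_map (valP g)); apply: face_is_mgen ig.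
  by rewrite -gl tuple_len_map.
apply: eq_bigr => i _; rewrite raddfMz face_map_tuple mc_map_tuple // => /andP[_ /eqP fl].
apply: (is_mgen_face (valP g)); apply/eqP.
by rewrite eq_le (len_face_le _ (valP g)) -fl tuple_len_map.
Qed.

Definition magnitude_map (l : R) :
    chain_map (magnitude_complex G l) (magnitude_complex H l) :=
  @ChainMap (magnitude_complex G l) (magnitude_complex H l)
    (fun k => mc_map_fun k l) (fun k => @mc_map_bd k l).
End MagnitudeMap.

Section CartesianProduct.
Variables G H : hypergraph.

Definition cart_edge : set {fset (G * H)} := [set e : {fset (G * H)} |
  (exists x t, hedge H t /\ e = ([fset x] `*` t)%fset) \/
  (exists y s, hedge G s /\ e = (s `*` [fset y])%fset)]%classic.

Lemma cart_edge_neq0 e : cart_edge e -> e != fset0.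
Proof.
case=> [[x [t [/hedge_neq0/fset0Pn[y yt] ->]]]|[y [s [/hedge_neq0/fset0Pn[x xs] ->]]]];
  by apply/fset0Pn; exists (x, y); rewrite !inE /= ?eqxx ?xs ?yt.
Qed.

Definition cart_prod : hypergraph := Hypergraph cart_edge_neq0.
End CartesianProduct.

Section CartesianMap.
Variables (G G' H H' : hypergraph) (f : hmorphism G G') (g : hmorphism H H').

Definition cart_map_fun (p : cart_prod G H) : cart_prod G' H' := (f p.1, g p.2).

Lemma imfset_fsetM (s : {fset G}) (t : {fset H}) :
  [fset cart_map_fun p | p in (s `*` t)]%fset =
  ([fset f x | x in s] `*` [fset g y | y in t])%fset.
Proof.
apply/fsetP => -[x' y']; rewrite !inE /=; apply/imfsetP/andP.
  by move=> [[x y]] /=; rewrite inE /= => /andP[xs yt] [-> ->]; rewrite !in_imfset.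
move=> [/imfsetP[x /= xs ->] /imfsetP[y /= yt ->]].
by exists (x, y) => //=; rewrite inE /= xs yt.
Qed.

Lemma cart_map_subproof e : hedge (cart_prod G H) e ->
  hedge (cart_prod G' H') [fset cart_map_fun p | p in e]%fset.
Proof.
case=> [[x [t [tE ->]]]|[y [s [sE ->]]]]; rewrite imfset_fsetM imfset_fset1.
  by left; exists (f x), [fset g y | y in t]%fset; split=> //; apply: hmorP.
by right; exists (g y), [fset f x | x in s]%fset; split=> //; apply: hmorP.
Qed.

Definition cart_map : hmorphism (cart_prod G H) (cart_prod G' H') :=
  HMorphism cart_map_subproof.
End CartesianMap.

Section CartesianDistance.
Variables (R : realType) (G H : hypergraph).
Local Notation P := (cart_prod G H).

Lemma hdist_cart2 (x : G) (y y' : H) :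
  hdist R ((x, y) : P) ((x, y') : P) = hdist R y y'.
Proof.
apply/eqP; rewrite eq_le; apply/andP; split.
  apply: (@hdist_nonexp R H P (fun z => (x, z))) => e.
  have -> : [fset ((x, z) : P) | z in e]%fset = ([fset x] `*` e)%fset.
    apply/fsetP => -[a b]; rewrite !inE /=; apply/imfsetP/andP => /=.
      by move=> [z ze [-> ->]].
    by move=> [/eqP -> be]; exists b.
  case=> [eH|[z _ <-]]; first by left; left; exists x, e.
  right; exists (x, z) => //; apply/fsetP => -[a b].
  by rewrite !inE /= xpair_eqE.
apply: (@hdist_nonexp R P H snd _ (x, y) (x, y')) => e.
case=> [|[[a b] _ <-]]; last by right; exists b => //; rewrite imfset_fset1.
case=> [[a [t [tH ->]]]|[b [s [/hedge_neq0/fset0Pn[a as_] ->]]]].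
  left; rewrite (_ : [fset _ | _ in _]%fset = t) //.
  apply/fsetP => b; apply/imfsetP/idP => [[[a' b']] /=|bt].
    by rewrite inE /= => /andP[_ +] ->.
  by exists (a, b) => //=; rewrite !inE /= eqxx.
right; exists b => //; apply/fsetP => c; rewrite inE; apply/eqP/imfsetP => [->|].
  by exists (a, b) => //=; rewrite !inE /= as_ eqxx.
by move=> [[a' b']] /=; rewrite !inE /= => /andP[_ /eqP ->].
Qed.

Lemma hdist_cart1 (x x' : G) (y : H) :
  hdist R ((x, y) : P) ((x', y) : P) = hdist R x x'.
Proof.
apply/eqP; rewrite eq_le; apply/andP; split.
  apply: (@hdist_nonexp R G P (fun z => (z, y))) => e.
  have -> : [fset ((z, y) : P) | z in e]%fset = (e `*` [fset y])%fset.
    apply/fsetP => -[a b]; rewrite !inE /=; apply/imfsetP/andP => /=.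
      by move=> [z ze [-> ->]].
    by move=> [ae /eqP ->]; exists a.
  case=> [eG|[z _ <-]]; first by left; right; exists y, e.
  right; exists (z, y) => //; apply/fsetP => -[a b].
  by rewrite !inE /= xpair_eqE.
apply: (@hdist_nonexp R P G fst _ (x, y) (x', y)) => e.
case=> [|[[a b] _ <-]]; last by right; exists a => //; rewrite imfset_fset1.
case=> [[a [t [/hedge_neq0/fset0Pn[b bt] ->]]]|[b [s [sG ->]]]]; last first.
  left; rewrite (_ : [fset _ | _ in _]%fset = s) //.
  apply/fsetP => a; apply/imfsetP/idP => [[[a' b']] /=|as_].
    by rewrite inE /= => /andP[+ _] ->.
  by exists (a, b) => //=; rewrite !inE /= as_ eqxx.
right; exists a => //; apply/fsetP => c; rewrite inE; apply/eqP/imfsetP => [->|].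
  by exists (a, b) => //=; rewrite !inE /= bt eqxx.
by move=> [[a' b']] /=; rewrite !inE /= => /andP[/eqP -> _].
Qed.
End CartesianDistance.

Section Shuffles.
Variables p q : nat.

Definition osrc (n : nat) (i : 'I_n) : 'I_n.+1 := widen_ord (leqnSn n) i.
Definition otgt (n : nat) (i : 'I_n) : 'I_n.+1 := lift ord0 i.

Definition lattice_pair : finType :=
  ({ffun 'I_(p + q).+1 -> 'I_p.+1} * {ffun 'I_(p + q).+1 -> 'I_q.+1})%type.

Definition is_shuffle (mn : lattice_pair) : bool :=
  let: (mu, nu) := mn in
  [&& (mu ord0 == 0 :> nat) && (nu ord0 == 0 :> nat),
      (mu ord_max == p :> nat) && (nu ord_max == q :> nat) &
      [forall i : 'I_(p + q),
        ((mu (otgt i) == mu (osrc i)) && (nu (otgt i) == (nu (osrc i)).+1 :> nat)) ||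
        ((mu (otgt i) == (mu (osrc i)).+1 :> nat) && (nu (otgt i) == nu (osrc i)))]].

Definition shuffle : finType := {mn : lattice_pair | is_shuffle mn}.

(* Truncated subtraction is harmless here: [mu] and [nu] are nondecreasing. *)
Definition shuffle_inv (s : shuffle) : nat :=
  let: (mu, nu) := val s in
  \sum_(i < p + q) \sum_(j < p + q | i < j)
    (mu (otgt i) - mu (osrc i)) * (nu (otgt j) - nu (osrc j)).
End Shuffles.

Section ExteriorProduct.
Variables (R : realType) (G H : hypergraph).

Definition shuffle_tuple (p q : nat) (s : shuffle p q)
    (v : p.+1.-tuple G) (w : q.+1.-tuple H) : (p + q).+1.-tuple (cart_prod G H) :=
  let: (mu, nu) := val s in [tuple (tnth v (mu i), tnth w (nu i)) | i < (p + q).+1].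

Lemma tuple_len_nth (K : hypergraph) (x0 : K) (s : seq K) :
  tuple_len R s =
  (\sum_(j < (size s).-1) hdist R (nth x0 s j) (nth x0 s j.+1))%E.
Proof.
elim: s => [|x [|y s] IH]; first by rewrite /tuple_len big_nil big_ord0.
  by rewrite tuple_len1 big_ord0.
by rewrite tuple_len_cons [RHS]big_ord_recl IH.
Qed.

Section ShuffleTuple.
Variables (p q : nat) (s : shuffle p q) (v : p.+1.-tuple G) (w : q.+1.-tuple H).
Let x0 := thead v.
Let y0 := thead w.
Let z0 : cart_prod G H := (x0, y0).
Let mu (m : nat) : nat := (val s).1 (inord m).
Let nu (m : nat) : nat := (val s).2 (inord m).

Lemma shuffle_start : mu 0 = 0%N /\ nu 0 = 0%N.
Proof.
have -> : mu 0 = (val s).1 ord0 by rewrite /mu; congr ((val s).1 _ : nat); apply/val_inj; rewrite /= inordK.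
have -> : nu 0 = (val s).2 ord0 by rewrite /nu; congr ((val s).2 _ : nat); apply/val_inj; rewrite /= inordK.
by case: (s) => -[m n] /= /and3P[/andP[/eqP -> /eqP ->]].
Qed.

Lemma shuffle_end : mu (p + q) = p /\ nu (p + q) = q.
Proof.
have e : inord (p + q) = ord_max :> 'I_(p + q).+1 by apply/val_inj; rewrite /= inordK.
rewrite /mu /nu e.
by case: (s) => -[m n] /= /and3P[_ /andP[/eqP -> /eqP ->]].
Qed.

Lemma shuffle_step m : (m < p + q)%N ->
  (mu m.+1 = mu m /\ nu m.+1 = (nu m).+1) \/
  (mu m.+1 = (mu m).+1 /\ nu m.+1 = nu m).
Proof.
move=> mpq; pose i := Ordinal mpq.
have es : inord m = osrc i by apply/val_inj; rewrite /= inordK // ltnW.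
have et : inord m.+1 = otgt i by apply/val_inj; rewrite /= inordK.
rewrite /mu /nu es et.
case: (s) => -[f g] /= /and3P[_ _ /forallP/(_ i)/orP[]/andP[/eqP h1 /eqP h2]].
  by left; rewrite h1 h2.
by right; rewrite h1 h2.
Qed.

Lemma shuffle_tuple_nth m : (m < (p + q).+1)%N ->
  nth z0 (shuffle_tuple s v w) m = (nth x0 v (mu m), nth y0 w (nu m)).
Proof.
move=> mpq; rewrite -[m]/(val (Ordinal mpq)) -tnth_nth /mu /nu /shuffle_tuple.
have -> : inord (Ordinal mpq) = Ordinal mpq :> 'I_(p + q).+1.
  by apply/val_inj; rewrite /= inordK.
by case: (s) => -[f g] /= _; rewrite tnth_mktuple !(tnth_nth x0) !(tnth_nth y0).
Qed.

Lemma shuffle_tuple_dist m : (m < p + q)%N ->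
  (hdist R (nth z0 (shuffle_tuple s v w) m)
           (nth z0 (shuffle_tuple s v w) m.+1) =
   hdist R (nth x0 v (mu m)) (nth x0 v (mu m.+1)) +
   hdist R (nth y0 w (nu m)) (nth y0 w (nu m.+1)))%E.
Proof.
move=> mpq; rewrite !shuffle_tuple_nth //; last exact: ltnW.
case: (shuffle_step mpq) => -[-> ->].
  by rewrite hdist_cart2 hdistxx add0e.
by rewrite hdist_cart1 hdistxx adde0.
Qed.

Lemma shuffle_tuple_len :
  tuple_len R (shuffle_tuple s v w) = (tuple_len R v + tuple_len R w)%E.
Proof.
rewrite (tuple_len_nth z0) (tuple_len_nth x0) (tuple_len_nth y0) !size_tuple /=.
pose A m := (\sum_(j < m) hdist R (nth x0 v j) (nth x0 v j.+1))%E.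
pose B m := (\sum_(j < m) hdist R (nth y0 w j) (nth y0 w j.+1))%E.
suff AB m : (m <= p + q)%N ->
    (\sum_(j < m) hdist R (nth z0 (shuffle_tuple s v w) j)
       (nth z0 (shuffle_tuple s v w) j.+1) = A (mu m) + B (nu m))%E.
  by rewrite AB //; have [-> ->] := shuffle_end.
elim: m => [_|m IH mpq].
  by have [-> ->] := shuffle_start; rewrite /A /B !big_ord0 add0e.
rewrite big_ord_recr IH 1?ltnW //= shuffle_tuple_dist //.
case: (shuffle_step mpq) => -[-> ->]; rewrite hdistxx.
  by rewrite add0e -addeA /B big_ord_recr.
by rewrite adde0 addeAC /A big_ord_recr.
Qed.

Lemma shuffle_tuple_adj : adj_neq v -> adj_neq w -> adj_neq (shuffle_tuple s v w).
Proof.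
move=> /(sortedP x0) va /(sortedP y0) wa; apply/(sortedP z0) => m.
rewrite size_tuple ltnS => mpq.
rewrite !shuffle_tuple_nth //; last exact: ltnW.
have ltmu : (mu m.+1 < p.+1)%N by exact: ltn_ord.
have ltnu : (nu m.+1 < q.+1)%N by exact: ltn_ord.
case: (shuffle_step mpq) => -[e1 e2]; rewrite e1 e2 xpair_eqE negb_and.
  by rewrite wa ?orbT // size_tuple -e2.
by rewrite va // size_tuple -e1.
Qed.
End ShuffleTuple.

Lemma shuffle_is_mgen p q (s : shuffle p q) (l1 l2 : R)
    (v : mgen G p l1) (w : mgen H q l2) : is_mgen (l1 + l2) (shuffle_tuple s v w).
Proof.
have /andP[vn /eqP vl] := valP v; have /andP[wn /eqP wl] := valP w.
rewrite /is_mgen shuffle_tuple_adj //= shuffle_tuple_len vl wl.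
by rewrite EFinD eqxx.
Qed.

Definition ext_gen (p q : nat) (l1 l2 : R) (v : mgen G p l1) (w : mgen H q l2) :
    mc_group (cart_prod G H) (p + q) (l1 + l2) :=
  \sum_(s : shuffle p q) fgen (MGen (shuffle_is_mgen s v w)) *~ (-1) ^+ shuffle_inv s.

Definition ext_fun (p q : nat) (l1 l2 : R) (x : mc_group G p l1) (y : mc_group H q l2) :
    mc_group (cart_prod G H) (p + q) (l1 + l2) :=
  free_lift (fun v => free_lift (fun w => ext_gen v w) y) x.

Lemma ext_funDl p q l1 l2 (x x' : mc_group G p l1) (y : mc_group H q l2) :
  ext_fun (x + x') y = ext_fun x y + ext_fun x' y.
Proof. exact: raddfD. Qed.

Lemma ext_funDr p q l1 l2 (x : mc_group G p l1) (y y' : mc_group H q l2) :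
  ext_fun x (y + y') = ext_fun x y + ext_fun x y'.
Proof.
rewrite /ext_fun -[RHS]big_split /=; apply: eq_bigr => v _.
by rewrite -mulrzDl raddfD.
Qed.

Definition ext_prod (p q : nat) (l1 l2 : R) :
    {additive tensor (mc_group G p l1) (mc_group H q l2) ->
              mc_group (cart_prod G H) (p + q) (l1 + l2)} :=
  tens_lift (@ext_funDl p q l1 l2) (@ext_funDr p q l1 l2).
End ExteriorProduct.

Section Kunneth.
Variable R : realType.

Definition bidegree (n : nat) (l : R) : choiceType :=
  {i : (nat * {nonneg R}%R) * (nat * {nonneg R}%R) |
    (i.1.1 + i.2.1 == n)%N && (i.1.2%:num + i.2.2%:num == l)}.

Lemma bidegree_subproof (p q : nat) (l1 l2 : {nonneg R}%R) :
  (p + q == p + q)%N && (l1%:num + l2%:num == l1%:num + l2%:num).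
Proof. by rewrite !eqxx. Qed.

Definition bideg (p q : nat) (l1 l2 : {nonneg R}%R) :
    bidegree (p + q) (l1%:num + l2%:num) :=
  exist _ ((p, l1), (q, l2)) (bidegree_subproof p q l1 l2).

Section Summands.
Variables (n : nat) (l : R) (i : bidegree n l).

Definition deg1 : nat := (val i).1.1.
Definition len1 : R := (val i).1.2%:num.
Definition deg2 : nat := (val i).2.1.
Definition len2 : R := (val i).2.2%:num.
End Summands.

Section KunnethTerms.
Variables (G H : hypergraph) (n : nat) (l : R).

Definition tensor_term (i : bidegree n l) : zmodType :=
  tensor (magnitude_homology G (deg1 i) (len1 i))
         (magnitude_homology H (deg2 i) (len2 i)).

Definition tor_term (i : bidegree n l) : zmodType :=
  tor (magnitude_homology G (deg1 i) (len1 i))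
      (homology_pred (magnitude_complex H (len2 i)) (deg2 i)).

Definition kunneth_tensor : zmodType := dsum tensor_term.

Definition kunneth_tor : zmodType := dsum tor_term.
End KunnethTerms.

Section KunnethMaps.
Variables (G G' H H' : hypergraph) (f : hmorphism G G') (g : hmorphism H H').
Variables (n : nat) (l : R).

Definition kunneth_tensor_map :
    {additive kunneth_tensor G H n l -> kunneth_tensor G' H' n l} :=
  dsum_map (fun i : bidegree n l =>
    tens_map (homology_map (magnitude_map f (len1 i)) (deg1 i))
             (homology_map (magnitude_map g (len2 i)) (deg2 i))).

Definition kunneth_tor_map :
    {additive kunneth_tor G H n l -> kunneth_tor G' H' n l} :=
  dsum_map (fun i : bidegree n l =>
    tor_map (homology_map (magnitude_map f (len1 i)) (deg1 i))
            (homology_pred_map (magnitude_map g (len2 i)) (deg2 i))).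

Definition magnitude_cart_map :
    {additive magnitude_homology (cart_prod G H) n l ->
              magnitude_homology (cart_prod G' H') n l} :=
  homology_map (magnitude_map (cart_map f g) l) n.
End KunnethMaps.

Section InducedByExteriorProduct.
Variables (G H : hypergraph) (p q : nat) (l1 l2 : {nonneg R}%R).

Definition kunneth_in :
    {additive tensor (magnitude_homology G p l1%:num)
                     (magnitude_homology H q l2%:num) ->
              kunneth_tensor G H (p + q) (l1%:num + l2%:num)} :=
  dsum_in (tensor_term G H (l := l1%:num + l2%:num)) (bideg p q l1 l2).

(* [phi] sends [[z] (x) [w]] to [[z [] w]]; in particular the exterior product
   of two cycles is a cycle. *)
Definition induced_by_ext_prod
    (phi : {additive kunneth_tensor G H (p + q) (l1%:num + l2%:num) ->
              magnitude_homology (cart_prod G H) (p + q) (l1%:num + l2%:num)}) : Prop :=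
  forall (z : cycles (magnitude_complex G l1%:num) p)
         (w : cycles (magnitude_complex H l2%:num) q),
  exists c : cycles (magnitude_complex (cart_prod G H) (l1%:num + l2%:num)) (p + q),
    kval c = ext_prod G H p q l1%:num l2%:num (tens (kval z) (kval w)) /\
    phi (kunneth_in (tens (hclass _ p z) (hclass _ q w))) = hclass _ (p + q) c.
End InducedByExteriorProduct.

End Kunneth.

(* Main.v *)
(* On generators of the chain complex of the product the distance is the sum of
   the two distances, and a tuple is read as a word in the letters X, Y, D
   according to the coordinates that change at each step. The tuples whose word
   is Y...YX...X are the only ones seen by the Alexander-Whitney map taken with
   the second factor in front, which is a left inverse of the exterior product.
   All other tuples are cancelled by a discrete Morse matching that exchanges the
   first diagonal step D with a corner XY. The matching shows that a chain
   without Alexander-Whitney components vanishes as soon as neither it nor its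
   boundary contains a tuple of diagonal type; this uniqueness principle makes
   the exterior product a chain map, because a shuffle sum contains no diagonal
   tuple and swapping the two steps of a corner cancels the diagonal faces. The
   matching also shows that a cycle without Alexander-Whitney components is a
   boundary.

   The exact sequence is then extracted from the Alexander-Whitney components of
   cycles: since subgroups of free abelian groups are free, cycles are a direct
   summand of the chains, and the class map extends to all chains. The map to Tor
   applies, to the component in bidegree (p+1,q), the boundary followed by the
   lift to the free group on the homology of the first factor, and the extended
   class map on the second factor. *)
From HB Require Import structures.
From mathcomp Require Import -(notations) multinomials.monalg.
From mathcomp Require Import all_boot all_order all_algebra finmap.
From mathcomp Require Import boolp classical_sets cardinality wochoice.
From mathcomp Require Import reals ereal interval_inference.
From mathcomp Require Import lra zify.
Require Import Defs.
Set Implicit Arguments.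
Unset Strict Implicit.
Unset Printing Implicit Defensive.
Import Order.TTheory GRing.Theory Num.Theory.
Local Open Scope ring_scope.

(** * Subgroups of free abelian groups *)

(** The distance on the product is additive because of the value $1/2$: a step between $\{a\}\times
    t$ and $s\times\{b\}$, with $a\in s$, $b\in t$ and both inclusions proper, costs $1$ and
    projects to two proper inclusions of cost $1/2$ each.

    The second factor stands in front because the sign of a shuffle counts X steps before Y steps,
    so that Y...YX...X is the shuffle with sign $+1$; the price is a sign $(-1)^q$ on the boundary
    of the first factor.

    No tensor product complex is formed, and no homotopy between the identity and the exterior
    product of the components. Everything happens in separate bidegrees: if $a_{p,q}$ are the
    components of a cycle, the relation $(-1)^q(\partial\otimes
    1)a_{p+1,q}+(1\otimes\partial)a_{p,q+1}=0$ is the only link between them.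

    Vertex sets are arbitrary, so splitting off the cycles takes a well-ordering of the generators,
    and the retractions are not natural. The connecting map is natural all the same: a change of
    choices in the first factor passes through the boundary, and such a term vanishes on a cycle
    once the second factor is read in homology. *)

Section AdditiveOf.
Variables (A B : zmodType) (f : A -> B) (fB : zmod_morphism f).
Definition additive_fun (_ : zmod_morphism f) : A -> B := f.
HB.instance Definition _ :=
  GRing.isZmodMorphism.Build A B (additive_fun fB) fB.
Definition additive_of : {additive A -> B} := additive_fun fB.
Lemma additive_ofE x : additive_of x = f x. Proof. by []. Qed.
End AdditiveOf.

(** * Well-orders and leading terms *)

Section WellOrder.
Variables (K : choiceType) (R : rel K).
Hypothesis Rwo : well_order R.

Let Rwo_chain : wo_chain R predT. Proof. by move=> A _; apply: Rwo. Qed.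

Lemma wo_total : total R.
Proof. by move=> x y; apply: (wo_chainW Rwo_chain). Qed.

Lemma wo_refl : reflexive R.
Proof. by move=> x; apply: (wo_chain_reflexive Rwo_chain). Qed.

Lemma wo_anti x y : R x y -> R y x -> x = y.
Proof.
by move=> xy yx; apply: (wo_chain_antisymmetric Rwo_chain); rewrite ?xy ?yx.
Qed.

(** [well_order] only speaks of minima of nonempty sets; transitivity is read off the minimum of the
    three elements. *)
Lemma wo_trans : transitive R.
Proof.
move=> y x z xy yz; have [t [[tin tmin] _]] : exists! t, minimum_of R (pred3 x y z) t.
  by apply: Rwo; exists x; rewrite inE eqxx.
have tx := tmin x; have ty := tmin y; have tz := tmin z.
move: tin tx ty tz; rewrite !inE !eqxx !orbT /=.
move=> /or3P[]/eqP -> /(_ isT) tx /(_ isT) ty /(_ isT) tz //.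
- by rewrite (wo_anti xy tx).
- by rewrite -(wo_anti yz ty).
Qed.

Lemma wo_ind (Q : K -> Prop) :
  (forall k, (forall j, R j k -> j != k -> Q j) -> Q k) -> forall k, Q k.
Proof.
move=> IH k; apply: contrapT => Qk.
have [z [[/asboolP nQz zmin] _]] :
    exists! z, minimum_of R [pred z | `[< ~ Q z >]] z.
  by apply: Rwo; exists k; apply/asboolP.
apply: nQz; apply: IH => j jz jNz; apply: contrapT => nQj.
case/eqP: jNz; apply: wo_anti => //; apply: zmin.
exact/asboolP.
Qed.

Lemma wo_max (D : seq K) : D != [::] ->
  exists2 k, k \in D & {in D, forall j, R j k}.
Proof.
elim: D => // a [|b D] IH _.
  exists a; rewrite ?mem_head // => j; rewrite inE => /eqP ->; exact: wo_refl.
have [//|k kD kmax] := IH.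
case/orP: (wo_total a k) => ak.
  exists k; first by rewrite inE kD orbT.
  by move=> j; rewrite inE => /orP[/eqP ->|/kmax].
exists a; first exact: mem_head.
move=> j; rewrite inE => /orP[/eqP ->|/kmax jk]; first exact: wo_refl.
exact: wo_trans ak.
Qed.
End WellOrder.

(** The generator is the least positive element, or 0 if there is none; the remainder of a division
    by it stays in the subgroup and is smaller. *)
Lemma int_subgroup_principal (P : int -> Prop) :
  P 0 -> (forall a b, P a -> P b -> P (a - b)) ->
  exists2 d, P d & forall a, P a -> exists z, a = d *~ z.
Proof.
move=> P0 PB.
have PN a : P a -> P (- a) by move=> Pa; rewrite -[- a]add0r; apply: PB.
have PM a z : P a -> P (a *~ z).
  move=> Pa; have PMn n : P (a *+ n).
    elim: n => [|n IH]; first by rewrite mulr0n.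
    have -> : a *+ n.+1 = a *+ n - (- a) by rewrite opprK mulrSr.
    by apply: PB => //; apply: PN.
  by case: z => n; [exact: PMn | rewrite NegzE mulrNz; apply/PN/PMn].
pose Q n := `[< (0 < n)%N /\ P n%:Z >].
have [exQ|nQ] := pselect (exists n, Q n); last first.
  exists 0 => // a Pa; exists 0; rewrite mulr0z; apply/eqP; apply: contrapT => /negP a0.
  apply: nQ; exists `|a|%N; apply/asboolP; split; first by rewrite absz_gt0.
  case: (a) Pa => n // Pn; rewrite NegzE abszN; have := PN _ Pn.
  by rewrite NegzE opprK.
have [d /asboolP[d0 Pd] dmin] := ex_minnP exQ.
exists d%:Z => // a Pa; exists (a %/ d%:Z)%Z.
have Pr : P (a %% d%:Z)%Z.
  have -> : (a %% d%:Z)%Z = a - d%:Z *~ (a %/ d%:Z)%Z.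
    by rewrite /modz -mulrzr intz mulrC.
  by apply: PB => //; apply: PM.
have r0 : (a %% d%:Z)%Z = 0.
  apply/eqP; apply: contrapT => /negP rN0.
  have rge : 0 <= (a %% d%:Z)%Z by rewrite modz_ge0 // eqz_nat -lt0n.
  have rlt : ((a %% d%:Z)%Z < d%:Z) by rewrite ltz_pmod // ltz_nat.
  move: Pr rN0 rge rlt; case: (a %% d%:Z)%Z => // n Pn nN0 _ nd.
  have : Q n by apply/asboolP; split=> //; rewrite lt0n.
  by move=> /dmin; move: nd; rewrite ltz_nat => /ltn_geF ->.
by rewrite {1}(divz_eq a d%:Z) r0 addr0 mulrC -mulrzr intz.
Qed.

Lemma fgenE (K : choiceType) (k j : K) : mcoeff j (fgen k) = (k == j)%:R.
Proof. exact: mcoeffU. Qed.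

Lemma free_lift_ext (K : choiceType) (M : zmodType) (f : K -> M)
    (g : {additive free_ab K -> M}) :
  (forall k, g (fgen k) = f k) -> g =1 free_lift f.
Proof. by move=> gf; apply: free_ext => k; rewrite gf free_lift_gen. Qed.

Lemma free_liftE (K : choiceType) (M : zmodType) (f : K -> M) (x : free_ab K) :
  free_lift f x = \sum_(k <- msupp x) f k *~ mcoeff k x.
Proof. by []. Qed.

Lemma free_expand (K : choiceType) (x : free_ab K) :
  x = \sum_(k <- msupp x) fgen k *~ mcoeff k x.
Proof. by rewrite -free_liftE; apply: (free_lift_ext (g := idfun)). Qed.

Lemma free_supp_nil (K : choiceType) (x : free_ab K) :
  msupp x = [::] :> seq K -> x = 0.
Proof. by move=> x0; rewrite (free_expand x) x0 big_nil. Qed.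

Section Splitting.
Variables (X K : choiceType) (f : {additive free_ab X -> free_ab K}).

Let R : rel K := sval (well_ordering_principle K).
Let Rwo : well_order R := svalP (well_ordering_principle K).

Let bounded (k : K) (x : free_ab X) := {in msupp (f x), forall j, R j k}.

Let boundedB k x y : bounded k x -> bounded k y -> bounded k (x - y).
Proof.
move=> bx bY j; rewrite raddfB => /(fsubsetP (msuppB_le _ _)).
by rewrite inE => /orP[/bx|/bY].
Qed.

Let bounded0 k : bounded k 0.
Proof. by move=> j; rewrite raddf0 msupp0. Qed.

(** The coefficients at [k] of the images bounded by [k] form a subgroup of the integers, and [c]
    realises a generator. The second clause discards the indices at which no image has its leading
    term. *)
Let lead_ex (k : K) : exists c, [/\ bounded k c,
    mcoeff k (f c) = 0 -> c = 0 &
    forall x, bounded k x -> exists z, mcoeff k (f x) = mcoeff k (f c) *~ z].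
Proof.
have [|a b [x bx <-] [y bY <-]|d [c bc cd] dP] :=
    @int_subgroup_principal (fun a => exists2 x, bounded k x & mcoeff k (f x) = a).
- by exists 0; rewrite ?raddf0 ?mcoeff0.
- by exists (x - y); rewrite ?raddfB //; apply: boundedB.
have [d0|dN0] := eqVneq d 0.
  exists 0; split=> // x bx; have [|z] := dP (mcoeff k (f x)); first by exists x.
  by rewrite d0 mul0rz => ->; exists 0; rewrite mulr0z.
exists c; split=> //; first by rewrite cd => /eqP; rewrite (negPf dN0).
move=> x bx; have [|z] := dP (mcoeff k (f x)); first by exists x.
by rewrite cd => ->; exists z.
Qed.

Let c k := sval (cid (lead_ex k)).
Let cb k : bounded k (c k). Proof. by case: (svalP (cid (lead_ex k))). Qed.
Let c0 k : mcoeff k (f (c k)) = 0 -> c k = 0.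
Proof. by case: (svalP (cid (lead_ex k))). Qed.
Let cP k x : bounded k x -> exists z, mcoeff k (f x) = mcoeff k (f (c k)) *~ z.
Proof. by case: (svalP (cid (lead_ex k))) => _ _; apply. Qed.

Let u : {additive free_ab K -> free_ab X} := free_lift c.

(** Subtracting a multiple of [c k] clears the coefficient at [k]; the greatest index left in the
    support is smaller, and well-founded induction applies. *)
Let uf_surj_bounded k : forall x, bounded k x -> exists t, f x = f (u t).
Proof.
elim/(wo_ind Rwo): k => k IH x bx; have [z zE] := cP bx.
pose y := x - c k *~ z.
have by_ : bounded k y.
  apply: boundedB => //.
  move=> j; rewrite raddfMz -mcoeff_neq0 raddfMz /= => h.
  by apply: (cb (k := k)); rewrite -mcoeff_neq0; apply: contra_neq h => ->; rewrite mul0rz.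
have yk : mcoeff k (f y) = 0.
  rewrite /y raddfB raddfMz mcoeffB zE; apply/eqP; rewrite subr_eq0.
  by rewrite (raddfMz (mcoeff k)).
suff [t tE] : exists t, f y = f (u t).
  exists (t + fgen k *~ z); rewrite (raddfD u) (raddfMz u) free_lift_gen raddfD -tE.
  by rewrite -raddfD subrK.
have [fy0|fyN0] := eqVneq (f y) 0; first by exists 0; rewrite !raddf0 fy0.
have [|j jin jmax] := @wo_max _ _ Rwo (msupp (f y)).
  by apply: contra_neq fyN0; apply: free_supp_nil.
apply: (IH j); first exact: by_.
  by apply/eqP => jk; move: jin; rewrite -mcoeff_neq0 jk yk eqxx.
exact: jmax.
Qed.

Let uf_surj x : exists t, f x = f (u t).
Proof.
have [fx0|fxN0] := eqVneq (f x) 0; first by exists 0; rewrite !raddf0.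
have [|j jin jmax] := @wo_max _ _ Rwo (msupp (f x)).
  by apply: contra_neq fxN0; apply: free_supp_nil.
exact: uf_surj_bounded jmax.
Qed.

(** The images of the nonzero [c k] have distinct leading indices, so the greatest one cannot
    cancel. One cannot conclude [t = 0], since some [c k] may be 0. *)
Let uf_inj t : f (u t) = 0 -> u t = 0.
Proof.
pose D := [seq k <- msupp t | c k != 0].
have uE : u t = \sum_(k <- D) c k *~ mcoeff k t.
  rewrite big_filter [LHS]free_liftE [LHS](bigID (fun k => c k != 0)) /=.
  by rewrite [X in _ + X]big1 ?addr0 // => k /negPn/eqP ->; rewrite mul0rz.
have [D0 _|DN0] := eqVneq D [::]; first by rewrite uE D0 big_nil.
have [k kD kmax] := wo_max Rwo DN0.
move=> fu0; have : mcoeff k (f (u t)) = 0 by rewrite fu0 mcoeff0.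
rewrite uE raddf_sum raddf_sum (bigD1_seq k) ?filter_uniq ?fset_uniq //=.
rewrite big1_seq ?addr0 => [|j /andP[jk jD]].
  rewrite raddfMz (raddfMz (mcoeff k)) /= -mulrzr => /eqP.
  move: kD; rewrite mem_filter -mcoeff_neq0 => /andP[ck tk].
  rewrite mulf_eq0 intz (negPf tk) orbF => /eqP/c0 ck0.
  by rewrite ck0 eqxx in ck.
rewrite raddfMz (raddfMz (mcoeff k)) /= [X in X *~ _](_ : _ = 0) ?mul0rz //.
apply: mcoeff_outdom; apply/negP => kin.
by case/eqP: jk; apply: (wo_anti Rwo); [exact: kmax | exact: (cb kin)].
Qed.

(* A subgroup of a free abelian group is free, so that the image of [f] is
   projective and the kernel of [f] a direct summand. *)
Lemma kernel_retract : exists r : {additive free_ab X -> free_ab X},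
  (forall x, f (r x) = 0) /\ (forall x, f x = 0 -> r x = x).
Proof.
pose tt x := sval (cid (uf_surj x)).
have tE x : f x = f (u (tt x)) := svalP (cid (uf_surj x)).
(* The chosen [tt x] is not unique, but [u (tt x)] depends on [f x] only; this makes [r]
   additive. *)
have uniq_ x t : f x = f (u t) -> u (tt x) = u t.
  move=> xt; apply/eqP; rewrite -subr_eq0 -raddfB; apply/eqP/uf_inj.
  by rewrite raddfB raddfB -tE -xt subrr.
pose r x := x - u (tt x).
have rB : zmod_morphism r.
  move=> x y; rewrite /r (uniq_ (x - y) (tt x - tt y)).
    by rewrite (raddfB u) !opprD !opprK addrACA.
  by rewrite (raddfB u) !(raddfB f) -!tE.
exists (additive_of rB); split=> [x|x fx]; rewrite additive_ofE.
  by rewrite /r raddfB -tE subrr.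
have -> : r x = x - u 0 by rewrite /r (uniq_ x 0) // fx !raddf0.
by rewrite raddf0 subr0.
Qed.
End Splitting.

#[local] Opaque tens tens_map tens_lift quot_pi free_lift.

(** * Tensor products and direct sums *)

Lemma additive_compE (A B C : zmodType) (f : {additive A -> B})
  (g : {additive B -> C}) x : (g \o f : {additive A -> C}) x = g (f x).
Proof. by []. Qed.

Section TensorTheory.
Variables A B : zmodType.
Implicit Types (a : A) (b : B).

Lemma tensBl a a' b : tens (a - a') b = tens a b - tens a' b.
Proof. by apply/eqP; rewrite eq_sym subr_eq -tensDl subrK. Qed.
Lemma tensBr a b b' : tens a (b - b') = tens a b - tens a b'.
Proof. by apply/eqP; rewrite eq_sym subr_eq -tensDr subrK. Qed.

Definition tensl b : {additive A -> tensor A B} :=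
  additive_of (fun a a' => tensBl a a' b).
Definition tensr a : {additive B -> tensor A B} := additive_of (tensBr a).

Lemma tens0l b : tens 0 b = 0 :> tensor A B. Proof. exact: (raddf0 (tensl b)). Qed.
Lemma tens0r a : tens a 0 = 0 :> tensor A B. Proof. exact: (raddf0 (tensr a)). Qed.
Lemma tensMzl a b z : tens (a *~ z) b = tens a b *~ z.
Proof. exact: (raddfMz (tensl b)). Qed.
Lemma tensMzr a b z : tens a (b *~ z) = tens a b *~ z.
Proof. exact: (raddfMz (tensr a)). Qed.
Lemma tens_suml (I : Type) (r : seq I) (P : pred I) (F : I -> A) b :
  tens (\sum_(i <- r | P i) F i) b = \sum_(i <- r | P i) tens (F i) b.
Proof. exact: (raddf_sum (tensl b)). Qed.
Lemma tens_sumr (I : Type) (r : seq I) (P : pred I) (F : I -> B) a :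
  tens a (\sum_(i <- r | P i) F i) = \sum_(i <- r | P i) tens a (F i).
Proof. exact: (raddf_sum (tensr a)). Qed.

Lemma tens_expand (x : tensor A B) :
  exists s : seq (A * B), x = \sum_(p <- s) tens p.1 p.2.
Proof.
rewrite -[x](@reprK _ (tensor A B)); move: (repr x) => y.
pose q := quot_pi (generated_sub (@bilinear_relations A B)).
rewrite -[X in exists _, X = _]/(q y) (free_expand y) raddf_sum.
exists [seq (p.1 *~ mcoeff p y, p.2) | p <- msupp y].
rewrite big_map; apply: eq_bigr => -[a b] _.
by rewrite raddfMz tensMzl.
Qed.

Lemma tens_ind (P : tensor A B -> Prop) :
  P 0 -> (forall a b, P (tens a b)) -> (forall x y, P x -> P y -> P (x + y)) ->
  forall x, P x.
Proof.
move=> P0 Pt PD x; have [s ->] := tens_expand x.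
by elim/big_ind: _ => // -[a b] _; apply: Pt.
Qed.
End TensorTheory.

Lemma tens_map_eq (A B A' B' : zmodType) (f f' : {additive A -> A'})
    (g g' : {additive B -> B'}) :
  f =1 f' -> g =1 g' -> tens_map f g =1 tens_map f' g'.
Proof. by move=> ff gg; apply: tens_ext => a b; rewrite !tens_mapE ff gg. Qed.

Lemma tens_map_comp (A B A' B' A'' B'' : zmodType)
    (f : {additive A -> A'}) (g : {additive B -> B'})
    (f' : {additive A' -> A''}) (g' : {additive B' -> B''}) x :
  tens_map f' g' (tens_map f g x) = tens_map (f' \o f) (g' \o g) x.
Proof.
apply: (tens_ext (f := tens_map f' g' \o tens_map f g)) => a b.
by rewrite additive_compE !tens_mapE.
Qed.

Lemma tens_map_id (A B : zmodType) (x : tensor A B) : tens_map idfun idfun x = x.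
Proof. by apply: (tens_ext (g := idfun)) => a b; rewrite tens_mapE. Qed.

Section TensorMapAdd.
Variables A B A' B' : zmodType.

Lemma tens_map0l (f : {additive A -> A'}) (g : {additive B -> B'}) x :
  (forall a, f a = 0) -> tens_map f g x = 0.
Proof.
move=> f0; apply: (tens_ext (g := zero_map _ _)) => a b.
by rewrite tens_mapE f0 tens0l.
Qed.

Lemma tens_map0r (f : {additive A -> A'}) (g : {additive B -> B'}) x :
  (forall b, g b = 0) -> tens_map f g x = 0.
Proof.
move=> g0; apply: (tens_ext (g := zero_map _ _)) => a b.
by rewrite tens_mapE g0 tens0r.
Qed.

Lemma tens_mapDl (f f' h : {additive A -> A'}) (g : {additive B -> B'}) x :
  (forall a, h a = f a + f' a) -> tens_map h g x = tens_map f g x + tens_map f' g x.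
Proof.
move=> hE; apply: (tens_ext (g := tens_map f g \+ tens_map f' g)) => a b.
by rewrite -[RHS]/(tens_map _ _ _ + tens_map _ _ _) !tens_mapE hE tensDl.
Qed.

Lemma tens_mapDr (f : {additive A -> A'}) (g g' h : {additive B -> B'}) x :
  (forall b, h b = g b + g' b) -> tens_map f h x = tens_map f g x + tens_map f g' x.
Proof.
move=> hE; apply: (tens_ext (g := tens_map f g \+ tens_map f g')) => a b.
by rewrite -[RHS]/(tens_map _ _ _ + tens_map _ _ _) !tens_mapE hE tensDr.
Qed.

Lemma tens_map_surj (f : {additive A -> A'}) (g : {additive B -> B'}) :
  (forall a, exists a0, f a0 = a) -> (forall b, exists b0, g b0 = b) ->
  forall x, exists y, tens_map f g y = x.
Proof.
move=> fs gs; apply: tens_ind => [|a b|x y [x' <-] [y' <-]].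
- by exists 0; rewrite raddf0.
- have [a0 <-] := fs a; have [b0 <-] := gs b.
  by exists (tens a0 b0); rewrite tens_mapE.
- by exists (x' + y'); rewrite raddfD.
Qed.
End TensorMapAdd.

Section Image.
Variables (A B : zmodType) (f : {additive A -> B}).

Definition in_image (y : B) : bool := `[< exists x, f x = y >].
Lemma in_image_closed : zmod_closed in_image.
Proof.
split=> [|x y /asboolP[c cx] /asboolP[d dy]]; apply/asboolP.
  by exists 0; rewrite raddf0.
by exists (c - d); rewrite raddfB cx dy.
Qed.
HB.instance Definition _ := GRing.isZmodClosed.Build B in_image in_image_closed.
Definition image_sub : zmodClosed B := GRing.ZmodClosed.clone B in_image _.
End Image.

Section TensorExact.
Variables (N X Y W : zmodType) (f : {additive X -> Y}) (g : {additive Y -> W}).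
Hypothesis g_surj : forall w, exists y, g y = w.
Hypothesis gf : forall y, g y = 0 -> exists x, f x = y.

Let Im := image_sub (tens_map (idfun : {additive N -> N}) f).
Let y w : Y := sval (cid (g_surj w)).
Let yE w : g (y w) = w := svalP (cid (g_surj w)).
Let b (n : N) (w : W) : Quotient.quot Im := quot_pi Im (tens n (y w)).

Let b_eq n y1 y2 : g y1 = g y2 -> quot_pi Im (tens n y1) = quot_pi Im (tens n y2).
Proof.
move=> g12; apply/eqP; rewrite -subr_eq0 -raddfB -tensBr; apply/eqP/quot_pi_eq0.
have [|x <-] := gf (y := y1 - y2); first by rewrite raddfB g12 subrr.
by apply/asboolP; exists (tens n x); rewrite tens_mapE.
Qed.

Let bDl n n' w : b (n + n') w = b n w + b n' w.
Proof. by rewrite /b tensDl raddfD. Qed.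

Let bDr n w w' : b n (w + w') = b n w + b n w'.
Proof. by rewrite /b -raddfD -tensDr; apply: b_eq; rewrite raddfD !yE. Qed.

(** A left inverse of the map induced on the quotient by the image sends $n\otimes w$ to the class
    of $n\otimes y$ for any preimage [y] of [w]; two preimages differ by an image under [f]. *)
Lemma tens_right_exact (t : tensor N Y) :
  tens_map idfun g t = 0 -> exists u : tensor N X, tens_map idfun f u = t.
Proof.
move=> gt0; apply/asboolP; rewrite -[asbool _]/(t \in Im); apply/quot_pi_eq0.
have <- : tens_lift bDl bDr (tens_map idfun g t) = quot_pi Im t.
  apply: (tens_ext (f := tens_lift bDl bDr \o tens_map idfun g)) => n v.
  by rewrite additive_compE tens_mapE tens_liftE; apply: b_eq; rewrite yE.
by rewrite gt0 raddf0.
Qed.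
End TensorExact.

Section TensorSwap.
Variables A B : zmodType.

Definition tens_swap : {additive tensor A B -> tensor B A} :=
  tens_lift (fun a a' b => @tensDr B A b a a') (fun a b b' => @tensDl B A b b' a).

Lemma tens_swapE a b : tens_swap (tens a b) = tens b a.
Proof. exact: tens_liftE. Qed.
End TensorSwap.

Lemma tens_swapK (A B : zmodType) (x : tensor A B) : tens_swap B A (tens_swap A B x) = x.
Proof.
apply: (tens_ext (f := tens_swap B A \o tens_swap A B) (g := idfun)) => a b.
by rewrite additive_compE !tens_swapE.
Qed.

Lemma tens_swap_map (A B A' B' : zmodType) (f : {additive A -> A'})
    (g : {additive B -> B'}) x :
  tens_map g f (tens_swap A B x) = tens_swap A' B' (tens_map f g x).
Proof.
apply: (tens_ext (f := tens_map g f \o tens_swap A B)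
                 (g := tens_swap A' B' \o tens_map f g)) => a b.
rewrite -[LHS]/(tens_map g f (tens_swap A B (tens a b))).
rewrite -[RHS]/(tens_swap A' B' (tens_map f g (tens a b))).
by rewrite tens_swapE 2!tens_mapE tens_swapE.
Qed.

#[local] Opaque tens_swap.

(** * Flatness of free abelian groups *)

Section FreeFlat.
Variable K : choiceType.

Lemma tens_coef_subproofl (Z : zmodType) (k : K) (x x' : Z) (a : free_ab K) :
  (x + x') *~ mcoeff k a = x *~ mcoeff k a + x' *~ mcoeff k a.
Proof. exact: mulrzDl. Qed.
Lemma tens_coef_subproofr (Z : zmodType) (k : K) (x : Z) (a a' : free_ab K) :
  x *~ mcoeff k (a + a') = x *~ mcoeff k a + x *~ mcoeff k a'.
Proof. by rewrite mcoeffD mulrzDr. Qed.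
Definition tens_coef (Z : zmodType) (k : K) : {additive tensor Z (free_ab K) -> Z} :=
  tens_lift (@tens_coef_subproofl Z k) (@tens_coef_subproofr Z k).

Lemma tens_coefE (Z : zmodType) k (x : Z) a :
  tens_coef Z k (tens x a) = x *~ mcoeff k a.
Proof. exact: tens_liftE. Qed.

#[local] Opaque tens_coef.

(** [t] is the sum of its coefficients tensored with the basis elements, over the finite set [D] of
    indices occurring in one expression of [t]. *)
Lemma tens_coef0 (Z : zmodType) (t : tensor Z (free_ab K)) :
  (forall k, tens_coef Z k t = 0) -> t = 0.
Proof.
have [s ->] := tens_expand t => t0.
pose D := (\bigcup_(p <- s) msupp p.2)%fset.
have -> : \sum_(p <- s) tens p.1 p.2 =
    \sum_(k <- D) tens (tens_coef Z k (\sum_(p <- s) tens p.1 p.2)) (fgen k).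
  under [RHS]eq_bigr do rewrite raddf_sum tens_suml.
  rewrite exchange_big; apply: eq_big_seq => -[x a] /= pin.
  under eq_bigr do rewrite tens_coefE tensMzl -tensMzr.
  rewrite -tens_sumr {1}(free_expand a); congr tens.
  rewrite -(big_fset_incl _ (_ : msupp a `<=` D)%fset) //.
    by rewrite /D; exact: (@bigfcup_sup _ _ _ (x, a) xpredT (fun p => msupp p.2)).
  by move=> k _ /mcoeff_outdom ->; rewrite mulr0z.
by rewrite big1 // => k _; rewrite t0 tens0l.
Qed.

Lemma tens_coef_map (X Y : zmodType) (f : {additive X -> Y}) k (t : tensor X (free_ab K)) :
  tens_coef Y k (tens_map f idfun t) = f (tens_coef X k t).
Proof.
apply: (tens_ext (f := tens_coef Y k \o tens_map f idfun)
                 (g := f \o tens_coef X k)) => x a.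
rewrite -[LHS]/(tens_coef Y k (tens_map f idfun (tens x a))).
rewrite -[RHS]/(f (tens_coef X k (tens x a))).
by rewrite tens_mapE !tens_coefE raddfMz.
Qed.

Variables (X Y Y' : zmodType) (f : {additive X -> Y}) (f' : {additive X -> Y'}).
Hypothesis f_inj : forall x, f x = 0 -> f' x = 0 -> x = 0.

(* Free abelian groups are flat; injectivity is tested on a pair of maps. *)
Lemma free_flatl (t : tensor X (free_ab K)) :
  tens_map f idfun t = 0 -> tens_map f' idfun t = 0 -> t = 0.
Proof.
move=> ft ft'; apply: tens_coef0 => k.
by apply: f_inj; rewrite -tens_coef_map ?ft ?ft' raddf0.
Qed.

Lemma free_flatr (t : tensor (free_ab K) X) :
  tens_map idfun f t = 0 -> tens_map idfun f' t = 0 -> t = 0.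
Proof.
move=> ft ft'; rewrite -[t]tens_swapK.
have -> : tens_swap (free_ab K) X t = 0; last by rewrite raddf0.
by apply: free_flatl; rewrite tens_swap_map ?ft ?ft' raddf0.
Qed.
End FreeFlat.

(** * Maps into and out of direct sums *)

Section DirectSumTheory.
Variables (I : choiceType) (A : I -> zmodType).

Lemma dsum_eq (x y : dsum A) : (forall i, dsval x i = dsval y i) -> x = y.
Proof. by move=> xy; apply/val_inj/functional_extensionality_dep. Qed.

Lemma dsvalB i (x y : dsum A) : dsval (x - y) i = dsval x i - dsval y i.
Proof. by []. Qed.

Definition dsum_proj i : {additive dsum A -> A i} := additive_of (dsvalB i).

Lemma dsval_sum (T : Type) (r : seq T) (P : pred T) (F : T -> dsum A) j :
  dsval (\sum_(t <- r | P t) F t) j = \sum_(t <- r | P t) dsval (F t) j.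
Proof. exact: (raddf_sum (dsum_proj j)). Qed.

Lemma dsum_in_eq i a : dsval (dsum_in A i a) i = a.
Proof. exact: dfwith_in. Qed.
Lemma dsum_in_neq i j a : i != j -> dsval (dsum_in A i a) j = 0.
Proof. by move=> ij; apply: dfwith_out. Qed.

Definition dsupp (x : dsum A) : {fset I} := fset_set [set i | dsval x i != 0]%classic.

Lemma dsuppP (x : dsum A) i : (i \in dsupp x) = (dsval x i != 0).
Proof.
rewrite in_fset_set; last by case: x => x /= /asboolP.
by apply/idP/idP => [/set_mem|h] //; apply/mem_set.
Qed.

Lemma dsum_expand (x : dsum A) : x = \sum_(i <- dsupp x) dsum_in A i (dsval x i).
Proof.
apply: dsum_eq => j; rewrite dsval_sum.
have [jx|jx] := boolP (j \in dsupp x).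
  rewrite (bigD1_seq j) // dsum_in_eq big1 => [|i ij]; first exact/esym/addr0.
  exact: dsum_in_neq.
rewrite big1_seq => [|i /andP[_ ix]].
  by move: jx; rewrite dsuppP negbK => /eqP.
by apply: dsum_in_neq; apply: contraNneq jx => <-.
Qed.

Lemma dsum_ind (P : dsum A -> Prop) :
  P 0 -> (forall i a, P (dsum_in A i a)) -> (forall x y, P x -> P y -> P (x + y)) ->
  forall x, P x.
Proof. by move=> P0 Pi PD x; rewrite (dsum_expand x); elim/big_ind: _. Qed.

Lemma dsum_ext (M : zmodType) (f g : {additive dsum A -> M}) :
  (forall i a, f (dsum_in A i a) = g (dsum_in A i a)) -> f =1 g.
Proof.
move=> fg x; rewrite (dsum_expand x) !raddf_sum; apply: eq_bigr => i _.
exact: fg.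
Qed.

Section Lift.
Variables (M : zmodType) (u : forall i, {additive A i -> M}).

Definition dsum_lift_fun (x : dsum A) : M := \sum_(i <- dsupp x) u i (dsval x i).

Lemma dsum_lift_widen (D : {fset I}) x : (dsupp x `<=` D)%fset ->
  dsum_lift_fun x = \sum_(i <- D) u i (dsval x i).
Proof.
move=> xD; rewrite /dsum_lift_fun (big_fset_incl _ xD) // => i _.
by rewrite dsuppP negbK => /eqP ->; rewrite raddf0.
Qed.

Lemma dsum_lift_zmod_morphism : zmod_morphism dsum_lift_fun.
Proof.
move=> x y; pose D := (dsupp x `|` dsupp y `|` dsupp (x - y))%fset.
rewrite (@dsum_lift_widen D x) 1?(@dsum_lift_widen D y) 1?(@dsum_lift_widen D (x - y)).
- by rewrite -sumrB; apply: eq_bigr => i _; rewrite dsvalB raddfB.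
- by rewrite /D fsubsetUr.
- by rewrite /D fsetUAC fsubsetUr.
- by rewrite /D -fsetUA fsubsetUl.
Qed.

Definition dsum_lift : {additive dsum A -> M} := additive_of dsum_lift_zmod_morphism.

Lemma dsum_liftE i a : dsum_lift (dsum_in A i a) = u i a.
Proof.
rewrite additive_ofE (@dsum_lift_widen [fset i]%fset).
  by rewrite big_seq_fset1 dsum_in_eq.
apply/fsubsetP => j; rewrite dsuppP inE; apply: contraNT => ji.
by rewrite dsum_in_neq // eq_sym.
Qed.
End Lift.

Section Family.
Variables (Z : zmodType) (u : forall i, {additive Z -> A i}).
Hypothesis u_fin : forall z, finite_set [set i | u i z != 0]%classic.

Lemma dsum_family_subproof z : (fun i => u i z : A i) \in @finite_support I A.
Proof. exact/asboolP/u_fin. Qed.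

Definition dsum_family_fun z : dsum A := DSum (dsum_family_subproof z).

Lemma dsum_family_zmod_morphism : zmod_morphism dsum_family_fun.
Proof. by move=> x y; apply: dsum_eq => i; rewrite dsvalB /= raddfB. Qed.

Definition dsum_family : {additive Z -> dsum A} := additive_of dsum_family_zmod_morphism.

Lemma dsum_familyE z i : dsval (dsum_family z) i = u i z.
Proof. by []. Qed.
End Family.
End DirectSumTheory.

(** * Distances in the cartesian product *)

Lemma fsetM_proj1 (S T : choiceType) (s : {fset S}) (t : {fset T}) : t != fset0 ->
  [fset p.1 | p in (s `*` t)%fset]%fset = s.
Proof.
case/fset0Pn => y yt; apply/fsetP => x; apply/imfsetP/idP => [[[a b]] /=|xs].
  by rewrite inE /= => /andP[as_ _] ->.
by exists (x, y); rewrite //= inE /= xs.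
Qed.

Lemma fsetM_proj2 (S T : choiceType) (s : {fset S}) (t : {fset T}) : s != fset0 ->
  [fset p.2 | p in (s `*` t)%fset]%fset = t.
Proof.
case/fset0Pn => x xs; apply/fsetP => y; apply/imfsetP/idP => [[[a b]] /=|yt].
  by rewrite inE /= => /andP[_ bt] ->.
by exists (x, y); rewrite //= inE /= xs.
Qed.

Lemma fset11_proper (T : choiceType) (x : T) (s : {fset T}) :
  x \in s -> [fset x]%fset != s -> ([fset x] `<` s)%fset.
Proof. by move=> xs xNs; rewrite fproperEneq xNs fsub1set. Qed.

Lemma fsetM_sub (S T : choiceType) (s s' : {fset S}) (t t' : {fset T}) :
  s != fset0 -> t != fset0 -> (s `*` t `<=` s' `*` t')%fset ->
  (s `<=` s')%fset /\ (t `<=` t')%fset.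
Proof.
move=> /fset0Pn[x xs] /fset0Pn[y yt] /fsubsetP h; split; apply/fsubsetP => z zin.
  by have := h (z, y); rewrite !inE /= zin yt => /(_ isT)/andP[].
by have := h (x, z); rewrite !inE /= zin xs => /(_ isT)/andP[].
Qed.

Section CartesianSum.
Variables (R : realType) (G H : hypergraph).
Local Notation P := (cart_prod G H).

Lemma step_len_sym (T : choiceType) (s t : {fset T}) : step_len R s t = step_len R t s.
Proof. by rewrite /step_len eq_sym orbC. Qed.

Lemma step_len_proper (T : choiceType) (s t : {fset T}) :
  (s `<` t)%fset -> step_len R s t = 2^-1.
Proof.
move=> st; rewrite /step_len st; case: eqP => // e.
by move: st; rewrite e fproperEneq eqxx.
Qed.

Lemma hbar_cartP (e : {fset P}) : hedge (hbar P) e -> exists s t,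
  [/\ e = (s `*` t)%fset, hedge (hbar G) s, hedge (hbar H) t &
      (exists x, s = [fset x]%fset) \/ (exists y, t = [fset y]%fset)].
Proof.
case=> [[[x [t [tE ->]]]|[y [s [sE ->]]]]|[[x y] _ <-]].
- exists [fset x]%fset, t; split=> //; [by right; exists x|by left|by left; exists x].
- exists s, [fset y]%fset; split=> //; [by left|by right; exists y|by right; exists y].
- exists [fset x]%fset, [fset y]%fset; split.
  + by apply/fsetP => -[a b]; rewrite !inE /= xpair_eqE.
  + by right; exists x.
  + by right; exists y.
  + by left; exists x.
Qed.

(** Neither box contains the other, so the step pays the full length 1. *)
Lemma step_len_cross (x : G) (y : H) (s : {fset G}) (t : {fset H}) :
  x \in s -> y \in t -> [fset x]%fset != s -> [fset y]%fset != t ->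
  step_len R ([fset x] `*` t)%fset (s `*` [fset y])%fset = 1.
Proof.
move=> xs yt xNs yNt; have s0 : s != fset0 by apply/fset0Pn; exists x.
have t0 : t != fset0 by apply/fset0Pn; exists y.
have x0 : [fset x]%fset != fset0 by apply/fset0Pn; exists x; rewrite inE.
have y0 : [fset y]%fset != fset0 by apply/fset0Pn; exists y; rewrite inE.
have n1 : ~ ([fset x] `*` t `<=` s `*` [fset y])%fset.
  case/(fsetM_sub x0 t0) => _ ty; case/eqP: yNt; apply/eqP.
  by rewrite eqEfsubset ty fsub1set yt.
have n2 : ~ (s `*` [fset y] `<=` [fset x] `*` t)%fset.
  case/(fsetM_sub s0 y0) => sx _; case/eqP: xNs; apply/eqP.
  by rewrite eqEfsubset sx fsub1set xs.
rewrite /step_len; case: eqP => [e|_]; first by case: n1; rewrite e.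
by case: ifP => // /orP[]/fproper_sub.
Qed.

(** If the boxes share a side, only one projection moves, and an inclusion of boxes projects to an
    inclusion. If both sides differ, the boxes cross at the point [(a, b)] as in [step_len_cross]:
    length 1 is compared with two proper inclusions of length 1/2. *)
Lemma step_len_cart (e e' : {fset P}) : hedge (hbar P) e -> hedge (hbar P) e' ->
  meets e e' ->
  step_len R [fset p.1 | p in e]%fset [fset p.1 | p in e']%fset +
  step_len R [fset p.2 | p in e]%fset [fset p.2 | p in e']%fset <= step_len R e e'.
Proof.
move=> /hbar_cartP[s [t [-> /hbar_edge_neq0 s0 /hbar_edge_neq0 t0 st1]]].
move=> /hbar_cartP[s' [t' [-> /hbar_edge_neq0 s0' /hbar_edge_neq0 t0' st1']]].
case/fset0Pn => -[a b]; rewrite !inE /= => /andP[/andP[as_ bt] /andP[as' bt']].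
rewrite !fsetM_proj1 // !fsetM_proj2 //.
have fM1 (u u' : {fset G}) (v : {fset H}) : v != fset0 -> u != fset0 -> u != u' ->
    (u `*` v `<` u' `*` v)%fset -> (u `<` u')%fset.
  move=> v0 u0 uu /fproper_sub/(fsetM_sub u0 v0)[uu' _].
  by rewrite fproperEneq uu.
have fM2 (u : {fset G}) (v v' : {fset H}) : u != fset0 -> v != fset0 -> v != v' ->
    (u `*` v `<` u `*` v')%fset -> (v `<` v')%fset.
  move=> u0 v0 vv /fproper_sub/(fsetM_sub u0 v0)[_ vv'].
  by rewrite fproperEneq vv.
have [<-|ss] := eqVneq s s'.
  rewrite {1}/step_len eqxx add0r; have [<-|tt] := eqVneq t t'.
    by rewrite /step_len eqxx step_len_ge0.
  rewrite [leRHS]/step_len; case: eqP => [ee|_].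
    by case/eqP: tt; rewrite -(fsetM_proj2 t s0) ee fsetM_proj2.
  case: ifP => [/orP[]|_]; last exact: step_len_le1.
    by move/(fM2 _ _ _ s0 t0 tt)/step_len_proper ->.
  rewrite eq_sym in tt.
  by rewrite step_len_sym => /(fM2 _ _ _ s0 t0' tt)/step_len_proper ->.
have [<-|tt] := eqVneq t t'.
  rewrite {2}/step_len eqxx addr0.
  rewrite [leRHS]/step_len; case: eqP => [ee|_].
    by case/eqP: ss; rewrite -(fsetM_proj1 s t0) ee fsetM_proj1.
  case: ifP => [/orP[]|_]; last exact: step_len_le1.
    by move/(fM1 _ _ _ t0 s0 ss)/step_len_proper ->.
  rewrite eq_sym in ss.
  by rewrite step_len_sym => /(fM1 _ _ _ t0 s0' ss)/step_len_proper ->.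
have halves : 2^-1 + 2^-1 = 1 :> R by lra.
case: st1 => [[x sx]|[y ty]].
  have xa : x = a by move: as_; rewrite sx inE => /eqP.
  case: st1' => [[x' sx']|[y' ty']].
    by case/eqP: ss; move: as'; rewrite sx sx' xa inE => /eqP ->.
  have yb : y' = b by move: bt'; rewrite ty' inE => /eqP.
  rewrite sx ty' xa yb in ss tt *.
  rewrite eq_sym in tt.
  rewrite step_len_cross // (step_len_sym t) !step_len_proper ?halves //.
    exact: fset11_proper.
  exact: fset11_proper.
have yb : y = b by move: bt; rewrite ty inE => /eqP.
case: st1' => [[x' sx']|[y' ty']]; last first.
  by case/eqP: tt; move: bt'; rewrite ty ty' yb inE => /eqP ->.
have xa : x' = a by move: as'; rewrite sx' inE => /eqP.
rewrite ty sx' xa yb in ss tt *.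
rewrite eq_sym in ss.
rewrite (step_len_sym (s `*` _)%fset) step_len_cross //.
rewrite (step_len_sym s) !step_len_proper ?halves //.
  exact: fset11_proper.
exact: fset11_proper.
Qed.

Lemma meets_imfset_fun (S T : choiceType) (f : S -> T) (s t : {fset S}) :
  meets s t -> meets [fset f x | x in s]%fset [fset f x | x in t]%fset.
Proof.
move=> /fset0Pn[x]; rewrite inE => /andP[xs xt].
by apply/fset0Pn; exists (f x); rewrite inE !in_imfset.
Qed.

Lemma hpath_cart (s : {fset P}) p :
  (forall e, e \in s :: p -> hedge (hbar P) e) -> path (@meets P) s p ->
  hpath_len R [fset z.1 | z in s]%fset [seq [fset z.1 | z in e]%fset | e : {fset P} <- p] +
  hpath_len R [fset z.2 | z in s]%fset [seq [fset z.2 | z in e]%fset | e : {fset P} <- p]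
  <= hpath_len R s p.
Proof.
elim: p s => [|t p IH] s pE /=; first by rewrite !hpath_len_nil addr0.
move=> /andP[st tp]; rewrite !hpath_len_cons addrACA lerD ?IH //.
  by apply: step_len_cart => //; apply: pE; rewrite !inE eqxx ?orbT.
by move=> e et; apply: pE; rewrite inE et orbT.
Qed.

(** One inequality passes through the corner [(b.1, a.2)]; the other projects a path to both
    factors. *)
Lemma hdist_cart (a b : P) : hdist R a b = (hdist R a.1 b.1 + hdist R a.2 b.2)%E.
Proof.
apply/eqP; rewrite eq_le; apply/andP; split.
  apply: le_trans (hdist_triangle R _ ((b.1, a.2) : P) _) _.
  rewrite -(hdist_cart1 R a.1 b.1 a.2) -(hdist_cart2 R b.1 a.2 b.2).
  by case: a b => [? ?] [? ?].
apply/ereal_infP => _ [p [pE pP pl] <-].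
have pcart := hpath_cart pE pP.
apply: (@le_trans _ _ (hpath_len R [fset z.1 | z in [fset a]]%fset
   [seq [fset z.1 | z in e]%fset | e : {fset P} <- p] +
  hpath_len R [fset z.2 | z in [fset a]]%fset
    [seq [fset z.2 | z in e]%fset | e : {fset P} <- p])%:E); last by rewrite lee_fin.
rewrite EFinD; apply: leeD.
  rewrite imfset_fset1; apply: icdist_le; split.
  - move=> e; rewrite -(imfset_fset1 fst) -map_cons => /mapP[e' /pE/hbar_cartP[s [t [-> sE tE _]]] ->].
    by rewrite fsetM_proj1 ?(hbar_edge_neq0 tE).
  - rewrite -(imfset_fset1 fst); apply: homo_path pP.
    by move=> s t; apply: meets_imfset_fun.
  - by rewrite -(imfset_fset1 fst) last_map pl imfset_fset1.
rewrite imfset_fset1; apply: icdist_le; split.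
- move=> e; rewrite -(imfset_fset1 snd) -map_cons => /mapP[e' /pE/hbar_cartP[s [t [-> sE tE _]]] ->].
  by rewrite fsetM_proj2 ?(hbar_edge_neq0 sE).
- rewrite -(imfset_fset1 snd); apply: homo_path pP.
  by move=> s t; apply: meets_imfset_fun.
- by rewrite -(imfset_fset1 snd) last_map pl imfset_fset1.
Qed.
End CartesianSum.

(** * The Alexander-Whitney map *)

Section Sequences.
Local Open Scope nat_scope.
Variable (T : Type).
Implicit Types (s : seq T) (i q : nat).

Definition dele i s := take i s ++ drop i.+1 s.

Lemma dele_catl i s1 s2 : i < size s1 -> dele i (s1 ++ s2) = dele i s1 ++ s2.
Proof.
move=> is1; rewrite /dele takel_cat ?(ltnW is1) // drop_cat.
case: ltnP => [_|si]; first by rewrite catA.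
have e : i.+1 = size s1 by apply/eqP; rewrite eqn_leq is1.
by rewrite e subnn drop0 drop_size cats0.
Qed.

Lemma dele_catr i s1 s2 : dele (size s1 + i) (s1 ++ s2) = s1 ++ dele i s2.
Proof.
rewrite /dele take_cat drop_cat.
case: ltnP => [|_]; first by lia.
case: ltnP => [|_]; first by lia.
by rewrite addKn -addnS addKn catA.
Qed.

Lemma dele_cat s1 x s2 : dele (size s1) (s1 ++ x :: s2) = s1 ++ s2.
Proof. by rewrite -[size s1]addn0 dele_catr /dele take0 /= drop0. Qed.

Lemma size_dele i s : i < size s -> size (dele i s) = (size s).-1.
Proof. by move=> iS; rewrite size_cat size_take size_drop iS; lia. Qed.

Lemma drop_dele_lt q i s : i <= q -> q < size s -> drop q (dele i s) = drop q.+1 s.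
Proof.
move=> iq qs; rewrite /dele drop_cat size_take.
have -> : i < size s by lia.
by rewrite ltnNge iq /= drop_drop; congr drop; lia.
Qed.

Lemma drop_dele_ge q i s : q <= i -> drop q (dele i s) = dele (i - q) (drop q s).
Proof.
move=> qi; have [sq|qs] := leqP (size s) q.
  by rewrite !drop_oversize //; rewrite /dele size_cat size_take size_drop; case: ltnP; lia.
have -> : dele i s = dele (size (take q s) + (i - q)) (take q s ++ drop q s).
  by rewrite cat_take_drop size_take qs subnKC.
by rewrite dele_catr drop_size_cat // size_take qs.
Qed.

Lemma take_dele_le q i s : i <= q -> q < size s -> take q (dele i s) = dele i (take q.+1 s).
Proof.
move=> iq qs; rewrite -{1}(cat_take_drop q.+1 s) dele_catl; last first.
  by rewrite size_take; case: (ltnP q.+1) => ?; lia.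
by rewrite take_size_cat // size_dele size_take; case: (ltnP q.+1); lia.
Qed.

Lemma take_dele_gt q i s : q <= i -> take q (dele i s) = take q s.
Proof.
move=> qi; rewrite /dele take_cat size_take; have [is_|si] := ltnP i (size s).
  have [q_i|iq] := ltnP q i; first by rewrite take_takel ?(ltnW q_i).
  have -> : q = i by apply/eqP; rewrite eqn_leq qi.
  by rewrite subnn take0 cats0.
case: (ltnP q (size s)) => [_|sq]; first by rewrite take_takel.
by rewrite (take_oversize si) (drop_oversize (leqW si)) cats0 take_oversize.
Qed.

Lemma dele_last q s : size s = q.+1 -> dele q s = take q s.
Proof. by move=> sq; rewrite /dele drop_oversize ?cats0 ?sq. Qed.
End Sequences.

Lemma map_dele (S T : Type) (f : S -> T) i s : map f (dele i s) = dele i (map f s).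
Proof. by rewrite /dele map_cat map_take map_drop. Qed.

Section TupleLen.
Variables (R : realType) (K : hypergraph).
Implicit Types (s : seq K) (x y : K) (l : R).
Local Notation len := (tuple_len R).

Lemma tuple_len_nil : len ([::] : seq K) = 0%E.
Proof. by rewrite /tuple_len big_nil. Qed.

Lemma tuple_len_cat s1 x s2 :
  len (s1 ++ x :: s2) = (len (rcons s1 x) + len (x :: s2))%E.
Proof.
elim: s1 => [|a [|b s1] IH]; first by rewrite /= tuple_len1 add0e.
  by rewrite /= !tuple_len_cons tuple_len1 adde0.
by rewrite /= !tuple_len_cons -addeA -IH.
Qed.

Lemma tuple_len_dele i s : (len (dele i s) <= len s)%E.
Proof.
have [is_|si] := ltnP i (size s).
  case: s is_ => // x0 s is_.
  by rewrite -{2}(cat_take_drop i (x0 :: s)) (drop_nth x0 is_) tuple_len_del.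
by rewrite /dele take_oversize // drop_oversize ?cats0 // ltnW.
Qed.

Lemma tuple_len_split q s :
  (len (take q.+1 s) + len (drop q s) = len s)%E.
Proof.
have [qs|sq] := ltnP q (size s); last first.
  by rewrite take_oversize ?drop_oversize ?tuple_len_nil ?adde0 // ltnW.
case: s qs => // x0 s qs.
by rewrite (take_nth x0) // (drop_nth x0 qs) -tuple_len_cat -drop_nth // cat_take_drop.
Qed.

Lemma tuple_len_take q s : (len (take q s) <= len s)%E.
Proof.
case: q => [|q]; first by rewrite take0 tuple_len_nil tuple_len_ge0.
by rewrite -[leRHS](tuple_len_split q) leeDl ?tuple_len_ge0.
Qed.

Lemma tuple_len_drop q s : (len (drop q s) <= len s)%E.
Proof. by rewrite -[leRHS](tuple_len_split q) leeDr ?tuple_len_ge0. Qed.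

Lemma tuple_len0_const x s : len (x :: s) = 0%E -> s = nseq (size s) x.
Proof.
elim: s x => // y s IH x; rewrite tuple_len_cons => /eqP.
rewrite padde_eq0 ?hdist_ge0 ?tuple_len_ge0 // => /andP[/eqP xy /eqP /IH sy].
have [exy|xNy] := eqVneq x y; last by have := hdist_gt0 R xNy; rewrite xy ltxx.
by rewrite /= {1}sy exy.
Qed.

Definition mseq k l s := [&& size s == k.+1, adj_neq s & len s == l%:E].

(* The generator of a sequence, or 0 if the sequence is not a generator. *)
Definition mcs k l s : mc_group K k l :=
  if insub s is Some t then mc_of_tuple l (t : k.+1.-tuple K) else 0.

Lemma mcs_tuple k l (t : k.+1.-tuple K) : mcs k l t = mc_of_tuple l t.
Proof. by rewrite /mcs insubT ?size_tuple // => h; congr mc_of_tuple; apply/val_inj. Qed.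

Lemma mcs_gen k l (g : mgen K k l) : mcs k l g = fgen g.
Proof.
rewrite mcs_tuple (mc_of_tupleT (valP g)); congr fgen; exact/val_inj.
Qed.

Lemma mseq_gen k l (g : mgen K k l) : mseq k l g.
Proof. by rewrite /mseq size_tuple eqxx; exact: (valP g). Qed.

Lemma mseqP k l s : reflect (exists g : mgen K k l, s = g) (mseq k l s).
Proof.
apply: (iffP idP) => [/and3P[sz an ln]|[g ->]]; last exact: mseq_gen.
by exists (@MGen R K k l (Tuple sz) (introT andP (conj an ln))).
Qed.

Lemma mgen_inj k l (g g' : mgen K k l) : g = g' :> seq K -> g = g'.
Proof. by move=> e; do 2 apply/val_inj. Qed.

Lemma mcs0 k l s : ~~ mseq k l s -> mcs k l s = 0.
Proof.
rewrite /mcs; case: insubP => // t sz tE; rewrite /mseq -tE size_tuple eqxx /= => h.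
exact: mc_of_tuple0.
Qed.

Lemma adj_neq_rep s1 x s2 : adj_neq (s1 ++ x :: x :: s2) = false.
Proof.
rewrite /adj_neq; case: s1 => [|a s1] /=; first by rewrite eqxx.
by rewrite cat_path /= eqxx !andbF.
Qed.

Lemma adj_neqPn s : ~~ adj_neq s -> exists s1 x s2, s = s1 ++ x :: x :: s2.
Proof.
elim: s => // x [|y s] IH //; rewrite /adj_neq /= negb_and negbK.
have [->|_ /=] := eqVneq x y; first by exists [::], y, s.
by move=> /IH[s1 [z [s2 ->]]]; exists (x :: s1), z, s2.
Qed.

(** The formula remains true for sequences that are not generators. If [s] is too short, so are its
    faces. If it repeats a vertex, the deletions of the two copies cancel and every other face still
    repeats it. *)
Lemma mc_bd_mcs k l s : size s = k.+2 -> (len s <= l%:E)%E ->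
  mc_bd K k l (mcs k.+1 l s) = \sum_(i < k.+2) mcs k l (dele i s) *~ (-1) ^+ i.
Proof.
move=> sz ls; have [/mseqP[g sE]|ns] := boolP (mseq k.+1 l s).
  rewrite sE mcs_gen [LHS]free_lift_gen; apply: eq_bigr => i _.
  by rewrite -mcs_tuple face_val.
rewrite mcs0 // raddf0; apply/esym.
have [eqls|ltls] := eqVneq (len s) l%:E; last first.
  rewrite big1 // => i _; rewrite mcs0 ?mul0rz //; apply/negP => /and3P[_ _ /eqP ln].
  by case/eqP: ltls; apply/eqP; rewrite eq_le ls -ln tuple_len_dele.
have [s1 [x [s2 sE]]] : exists s1 x s2, s = s1 ++ x :: x :: s2.
  by apply: adj_neqPn; move: ns; rewrite /mseq sz eqls !eqxx andbT.
have sz1 : size s = (size s1 + (size s2).+2)%N by rewrite sE size_cat.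
have j1P : (size s1 < k.+2)%N by lia.
have j2P : ((size s1).+1 < k.+2)%N by lia.
rewrite (bigD1 (Ordinal j1P)) // (bigD1 (Ordinal j2P)) /=; last first.
  by rewrite -val_eqE /= neq_ltn ltnSn orbT.
rewrite big1 => [|i]; last first.
  rewrite -!val_eqE /= => /andP[i1 i2]; rewrite mcs0 ?mul0rz //.
  apply/negP => /and3P[_ + _]; apply/negP.
  have [il|ig] := ltnP i (size s1); first by rewrite sE dele_catl // adj_neq_rep.
  have -> : i = (size s1 + (i - size s1 - 2).+2)%N :> nat by lia.
  rewrite sE dele_catr.
  have -> : dele (i - size s1 - 2).+2 (x :: x :: s2) = x :: x :: dele (i - size s1 - 2) s2 by [].
  by rewrite adj_neq_rep.
have e1 : dele (size s1) s = s1 ++ x :: s2 by rewrite sE dele_cat.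
have e2 : dele (size s1).+1 s = s1 ++ x :: s2.
  by rewrite sE -addn1 dele_catr /dele /= drop0.
by rewrite e1 e2 addr0 exprS mulN1r mulrNz subrr.
Qed.
End TupleLen.

Section AlexanderWhitney.
Variables (R : realType) (G H : hypergraph).
Local Notation P := (cart_prod G H).
Implicit Types (t : seq P) (p q n : nat) (l : R).

Lemma tuple_len_cart t :
  tuple_len R t = (tuple_len R (unzip1 t) + tuple_len R (unzip2 t))%E.
Proof.
elim: t => [|a [|b t] IH]; first by rewrite !tuple_len_nil adde0.
  by rewrite !tuple_len1 adde0.
by rewrite /= !tuple_len_cons IH hdist_cart addeACA.
Qed.

(* The Alexander-Whitney map, with the second factor in front. *)
Definition aw p q l1 l2 t : tensor (mc_group G p l1) (mc_group H q l2) :=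
  tens (mcs p l1 (drop q (unzip1 t))) (mcs q l2 (take q.+1 (unzip2 t))).

Definition awm p q l1 l2 n l :
    {additive mc_group P n l -> tensor (mc_group G p l1) (mc_group H q l2)} :=
  free_lift (fun g : mgen P n l => aw p q l1 l2 g).

Lemma aw_len p q l1 l2 t : aw p q l1 l2 t != 0 ->
  [/\ mseq p l1 (drop q (unzip1 t)), mseq q l2 (take q.+1 (unzip2 t)) &
      ((l1 + l2)%:E <= tuple_len R t)%E].
Proof.
rewrite /aw; have [m1|/mcs0 ->] := boolP (mseq p l1 (drop q (unzip1 t))); last first.
  by rewrite tens0l eqxx.
have [m2|/mcs0 ->] := boolP (mseq q l2 (take q.+1 (unzip2 t))); last first.
  by rewrite tens0r eqxx.
move=> _; split=> //; have /and3P[_ _ /eqP e1] := m1; have /and3P[_ _ /eqP e2] := m2.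
by rewrite EFinD -e1 -e2 tuple_len_cart leeD ?tuple_len_drop ?tuple_len_take.
Qed.

(** Only the total length is bounded: if the other factor is nonzero its length is exactly [l2],
    which bounds [xs] by [l1]; otherwise both sides vanish. *)
Lemma tens_bd_mcsl p q l1 l2 (xs : seq G) (ys : seq H) : size xs = p.+2 ->
  (tuple_len R xs + tuple_len R ys <= (l1 + l2)%:E)%E ->
  tens (mc_bd G p l1 (mcs p.+1 l1 xs)) (mcs q l2 ys) =
  \sum_(i < p.+2) tens (mcs p l1 (dele i xs)) (mcs q l2 ys) *~ (-1) ^+ i.
Proof.
move=> sz ln; have [|/mcs0 ->] := boolP (mseq q l2 ys); last first.
  by rewrite tens0r big1 // => i _; rewrite tens0r mul0rz.
move=> /and3P[_ _ /eqP e2]; rewrite mc_bd_mcs //; last first.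
  by move: ln; rewrite e2 EFinD leeD2rE.
by rewrite tens_suml; apply: eq_bigr => i _; rewrite tensMzl.
Qed.

Lemma tens_bd_mcsr p q l1 l2 (xs : seq G) (ys : seq H) : size ys = q.+2 ->
  (tuple_len R xs + tuple_len R ys <= (l1 + l2)%:E)%E ->
  tens (mcs p l1 xs) (mc_bd H q l2 (mcs q.+1 l2 ys)) =
  \sum_(i < q.+2) tens (mcs p l1 xs) (mcs q l2 (dele i ys)) *~ (-1) ^+ i.
Proof.
move=> sz ln; have [|/mcs0 ->] := boolP (mseq p l1 xs); last first.
  by rewrite tens0l big1 // => i _; rewrite tens0l mul0rz.
move=> /and3P[_ _ /eqP e2]; rewrite mc_bd_mcs //; last first.
  by move: ln; rewrite e2 EFinD leeD2lE.
by rewrite tens_sumr; apply: eq_bigr => i _; rewrite tensMzr.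
Qed.

(** Faces $i\le q$ of a tuple shorten the front piece and the others the back piece. The two faces
    of pieces left over, the last of the front and the first of the back, give the same tensor with
    opposite signs. A deletion in the back piece has its index raised by $q$ in the tuple, whence
    $(-1)^q$. *)
Lemma awm_bd p q l1 l2 n l (c : mc_group P n.+1 l) :
  (p + q)%N = n -> l1 + l2 = l ->
  awm p q l1 l2 n l (mc_bd P n l c) =
  tens_map (mc_bd G p l1) idfun (awm p.+1 q l1 l2 n.+1 l c) *~ (-1) ^+ q +
  tens_map idfun (mc_bd H q l2) (awm p q.+1 l1 l2 n.+1 l c).
Proof.
move=> en el.
pose rhs1 : {additive _ -> _} := tens_map (mc_bd G p l1) idfun \o awm p.+1 q l1 l2 n.+1 l.
pose rhs2 : {additive _ -> _} := tens_map idfun (mc_bd H q l2) \o awm p q.+1 l1 l2 n.+1 l.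
have rhsB : zmod_morphism (fun c => rhs1 c *~ (-1) ^+ q + rhs2 c).
  by move=> x y; rewrite (raddfB rhs1) (raddfB rhs2) mulrzBl opprD addrACA.
apply: (free_ext (f := awm p q l1 l2 n l \o mc_bd P n l) (g := additive_of rhsB)) => g.
rewrite -[LHS]/(awm p q l1 l2 n l (mc_bd P n l (fgen g))).
rewrite -[RHS]/(tens_map (mc_bd G p l1) idfun (awm p.+1 q l1 l2 n.+1 l (fgen g)) *~ (-1) ^+ q +
  tens_map idfun (mc_bd H q l2) (awm p q.+1 l1 l2 n.+1 l (fgen g))).
rewrite /awm !free_lift_gen /aw !tens_mapE.
have /and3P[/eqP gsz gadj /eqP glen] := mseq_gen g.
set t : seq P := g in gsz gadj glen *; set xs := unzip1 t; set ys := unzip2 t.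
have szx : size xs = n.+2 by rewrite size_map.
have szy : size ys = n.+2 by rewrite size_map.
have lxy : (tuple_len R xs + tuple_len R ys = (l1 + l2)%:E)%E.
  by rewrite -tuple_len_cart el.
rewrite tens_bd_mcsl; last 2 first.
- by rewrite size_drop szx; lia.
- by rewrite -lxy leeD ?tuple_len_drop ?tuple_len_take.
rewrite tens_bd_mcsr; last 2 first.
- by rewrite size_take szy; case: ltnP; lia.
- by rewrite -lxy leeD ?tuple_len_drop ?tuple_len_take.
(* Faces dropped from the boundary may be kept here: a nonzero [aw] forces length at least
   [l1 + l2], hence a face that is a generator. *)
transitivity (\sum_(i < n.+2) aw p q l1 l2 (dele i t) *~ (-1) ^+ i).
  rewrite raddf_sum; apply: eq_bigr => i _; rewrite raddfMz; congr (_ *~ _).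
  rewrite -mcs_tuple face_val -/t -/(dele i t).
  have [/mseqP[g' ->]|nm] := boolP (mseq n l (dele i t)).
    by rewrite mcs_gen free_lift_gen.
  rewrite mcs0 // raddf0; apply/eqP; rewrite eq_sym; apply: contraNT nm => /aw_len[_ _].
  rewrite el -glen => ln.
  have fln : tuple_len R (dele i t) = l%:E.
    by apply/eqP; rewrite eq_le -glen ln tuple_len_dele.
  have fv : face i g = dele i t :> seq P by rewrite face_val.
  rewrite /mseq size_dele ?gsz // eqxx fln eqxx andbT /=.
  have /andP[+ _] := is_mgen_face (valP g : is_mgen l g) (i := i) (etrans (congr1 _ fv) fln).
  by rewrite fv.
pose F i := tens (mcs p l1 (drop q.+1 xs)) (mcs q l2 (dele i (take q.+2 ys))) *~ (-1) ^+ i.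
pose F' i := tens (mcs p l1 (dele i (drop q xs))) (mcs q l2 (take q.+1 ys)) *~ (-1) ^+ (q + i).
have -> : n.+2 = (q.+1 + p.+1)%N by lia.
rewrite big_split_ord /=.
rewrite (eq_bigr (fun i : 'I_q.+1 => F i)) => [|i _]; last first.
  rewrite /aw /F /= /unzip1 /unzip2 !map_dele -/xs -/ys.
  have iq := ltn_ord i.
  by rewrite drop_dele_lt ?take_dele_le ?szx ?szy //; lia.
rewrite [X in _ + X](eq_bigr (fun i : 'I_p.+1 => F' i.+1)) => [|i _]; last first.
  rewrite /aw /F' /= /unzip1 /unzip2 !map_dele -/xs -/ys.
  rewrite take_dele_gt; last by lia.
  rewrite drop_dele_ge; last by lia.
  have -> : (q.+1 + i - q)%N = i.+1 by lia.
  by congr (_ *~ _ ^+ _); lia.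
have -> : (\sum_(i < p.+2) tens (mcs p l1 (dele i (drop q xs)))
    (mcs q l2 (take q.+1 ys)) *~ (-1) ^+ i) *~ (-1) ^+ q = \sum_(i < p.+2) F' i.
  by rewrite mulrz_suml; apply: eq_bigr => i _; rewrite /F' -mulrzA exprD mulrC.
rewrite [X in _ = _ + X](eq_bigr (fun i : 'I_q.+2 => F i)) //.
rewrite [X in _ = X + _]big_ord_recl [X in _ = _ + X]big_ord_recr.
have FF : F q.+1 = - F' 0%N.
  have e1 : dele q.+1 (take q.+2 ys) = take q.+1 ys.
    rewrite dele_last; last by rewrite size_take szy; case: (ltnP q.+2); lia.
    by rewrite take_takel.
  have e2 : dele 0 (drop q xs) = drop q.+1 xs.
    by rewrite /dele take0 cat0s drop_drop add1n.
  by rewrite /F /F' e1 e2 addn0 exprS mulN1r mulrNz.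
rewrite [F _](FF : F (ord_max : 'I_q.+2) = _).
have cancel (V : zmodType) (a b x : V) : a + b = (x + b) + (a - x).
  by rewrite [x + b]addrC -addrA [x + _]addrC subrK addrC.
exact: cancel.
Qed.
End AlexanderWhitney.

(** * The Morse matching *)

Notation stepX := (true, false).
Notation stepY := (false, true).
Notation stepD := (true, true).

(** * Words of steps and the measure that decreases *)

Section Words.
Local Open Scope nat_scope.
Implicit Types (x y : bool * bool) (w : seq (bool * bool)) (s : bool).

(* A letter records which coordinates change in a step. [cls false w] is 0 if
   [w] is of the form Y...YX...X; otherwise it is 1 or 2 according to whether
   D or XY occurs first. The flag tells whether an X has been read. *)
Fixpoint cls s w : nat :=
  match w with
  | [::] => 0
  | stepD :: _ => 1
  | stepX :: w' => cls true w'
  | stepY :: w' => if s then 2 else cls false w'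
  | (false, false) :: _ => 3
  end.

Definition merge x y : bool * bool := (x.1 || y.1, x.2 || y.2).

(* The number of pairs of a step moving in the second coordinate and a later
   step moving in the first one: it does not increase when steps are merged. *)
Fixpoint meas w : nat :=
  if w is x :: w' then x.2 * count fst w' + meas w' else 0.

Lemma meas_cat w1 w2 :
  meas (w1 ++ w2) = meas w1 + meas w2 + count snd w1 * count fst w2.
Proof.
elim: w1 => [|x w1 IH] /=; first by rewrite !add0n mul0n addn0.
by rewrite IH count_cat mulnDr mulnDl; lia.
Qed.

(** A merge can only lose pairs, and it loses the pair formed by [x] and [y] themselves. *)
Lemma meas_merge w1 x y w2 :
  meas (w1 ++ merge x y :: w2) + (x.2 && y.1) <= meas (w1 ++ x :: y :: w2).
Proof.
rewrite !meas_cat /=; case: x y => [x1 x2] [y1 y2] /=.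
by case: x1 x2 y1 y2 => [] [] [] [] /=; nia.
Qed.

(** Neither X followed by Y nor a single D contributes a pair of its own, so matched tuples have
    equal measure. *)
Lemma meas_XY w1 w2 : meas (w1 ++ stepX :: stepY :: w2) = meas (w1 ++ stepD :: w2).
Proof. by rewrite !meas_cat /=; nia. Qed.

(** This dichotomy makes the matching acyclic: a merge from class 2 to class 1 either strictly
    lowers [meas] or undoes the first corner XY. *)
Lemma cls_merge s w1 x y w2 : cls s (w1 ++ x :: y :: w2) = 2 ->
  cls s (w1 ++ merge x y :: w2) = 1 ->
  (x.2 && y.1) || [&& x == stepX, y == stepY & cls s w1 == 0].
Proof.
elim: w1 s => [|z w1 IH] s /=.
  by case: x y => [[] []] [[] []]; case: s => //= h; rewrite ?h.
by case: z => [[] []] //=; try (exact: IH); case: s => // ; exact: IH.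
Qed.

Lemma cls_D s w1 w2 : cls s w1 = 0 -> cls s (w1 ++ stepD :: w2) = 1.
Proof.
elim: w1 s => [|[[] []] w1 IH] s //=; first exact: IH.
by case: s => //; apply: IH.
Qed.

Lemma cls_XY s w1 w2 : cls s w1 = 0 -> cls s (w1 ++ stepX :: stepY :: w2) = 2.
Proof.
elim: w1 s => [|[[] []] w1 IH] s //=; first exact: IH.
by case: s => //; apply: IH.
Qed.

Lemma cls1P s w : cls s w = 1 ->
  exists w1 w2, w = w1 ++ stepD :: w2 /\ cls s w1 = 0.
Proof.
elim: w s => [|[[] []] w IH] s //=.
- by exists [::], w.
- by move=> /IH[w1 [w2 [-> c]]]; exists (stepX :: w1), w2.
- by case: s => // /IH[w1 [w2 [-> c]]]; exists (stepY :: w1), w2.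
Qed.

Lemma cls2P s w : cls s w = 2 ->
  (exists w1 w2, w = w1 ++ stepX :: stepY :: w2 /\ cls s w1 = 0) \/
  (s /\ exists w2, w = stepY :: w2).
Proof.
elim: w s => [|[[] []] w IH] s //=.
  move=> /IH[[w1 [w2 [-> c]]]|[_ [w2 ->]]]; left.
    by exists (stepX :: w1), w2.
  by exists [::], w2.
case: s => [_|/IH[[w1 [w2 [-> c]]]|[]//]]; first by right; split=> //; exists w.
by left; exists (stepY :: w1), w2.
Qed.

Lemma cls0P s w : cls s w = 0 ->
  exists a b, w = nseq a stepY ++ nseq b stepX /\ (s -> a = 0).
Proof.
elim: w s => [|[[] []] w IH] s //=; first by exists 0, 0.
  move=> /IH[a [b [-> a0]]]; exists 0, b.+1; split=> //.
  by rewrite a0.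
by case: s => // /IH[a [b [-> _]]]; exists a.+1, b.
Qed.

Lemma cls_nseq a b : cls false (nseq a stepY ++ nseq b stepX) = 0.
Proof.
elim: a => [|a IH] //=.
by have clsX s : cls s (nseq b stepX) = 0 by elim: b s => //=.
Qed.

(** The position of the first event is determined by the word, for D here and for XY below; hence a
    tuple has a single partner. *)
Lemma cls_D_uniq s w1 w2 w1' w2' : cls s w1 = 0 -> cls s w1' = 0 ->
  w1 ++ stepD :: w2 = w1' ++ stepD :: w2' -> size w1 = size w1'.
Proof.
elim: w1 w1' s => [|x w1 IH] [|x' w1'] s //=.
- by move=> _ + [e1 _]; rewrite -e1.
- by move=> + _ [e1 _]; rewrite e1.
move=> c c' [e1 e2]; congr _.+1; rewrite -e1 in c'; move: c c'.
case: x {e1} => [[] []] //=; first by move=> c c'; exact: IH c c' e2.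
by case: s => // c c'; exact: IH c c' e2.
Qed.

Lemma cls_XY_uniq s w1 w2 w1' w2' : cls s w1 = 0 -> cls s w1' = 0 ->
  w1 ++ stepX :: stepY :: w2 = w1' ++ stepX :: stepY :: w2' -> size w1 = size w1'.
Proof.
elim: w1 w1' s => [|x w1 IH] [|x' w1'] s //=.
- move=> _ + [e1 e2]; rewrite -e1 /=.
  by case: w1' e2 => [|y w1'] //= [e2 _]; rewrite -e2.
- move=> + _ [e1 e2]; rewrite e1 /=.
  by case: w1 e2 {IH} => [|y w1] //= [e2 _]; rewrite e2.
move=> c c' [e1 e2]; congr _.+1; rewrite -e1 in c'; move: c c'.
case: x {e1} => [[] []] //=; first by move=> c c'; exact: IH c c' e2.
by case: s => // c c'; exact: IH c c' e2.
Qed.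
End Words.

Section Changes.
Variable (T : eqType).
Implicit Types s : seq T.

Definition neqs s : seq bool :=
  if s is x :: s' then pairmap (fun a b => a != b) x s' else [::].

Lemma size_neqs s : size (neqs s) = (size s).-1.
Proof. by case: s => //= x s; rewrite size_pairmap. Qed.

Lemma neqs_cat s1 x s2 : neqs (s1 ++ x :: s2) = neqs (rcons s1 x) ++ neqs (x :: s2).
Proof.
case: s1 => [|a s1] //=.
by rewrite pairmap_cat /= -cats1 pairmap_cat /= -catA.
Qed.

Lemma neqs_drop q s : neqs (drop q s) = drop q (neqs s).
Proof.
elim: q s => [|q IH] [|x s] //; first by rewrite !drop0.
by rewrite [LHS]/= IH; case: s => [|y s].
Qed.

Lemma neqs_take q s : neqs (take q.+1 s) = take q (neqs s).
Proof.
elim: q s => [|q IH] [|x s] //; first by case: s.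
by case: s => [|y s] //; have := IH (y :: s) => /= ->.
Qed.

End Changes.

Lemma neqs_adj (K : hypergraph) (s : seq K) : adj_neq s = all id (neqs s).
Proof. by case: s => //= x s; elim: s x => //= y s IH x; rewrite IH. Qed.

Lemma neqs_len0 (R : realType) (K : hypergraph) (s : seq K) :
  (tuple_len R s == 0%E) = all negb (neqs s).
Proof.
case: s => [|x s]; first by rewrite tuple_len_nil eqxx.
elim: s x => [|y s IH] x; first by rewrite tuple_len1 eqxx.
rewrite tuple_len_cons padde_eq0 ?hdist_ge0 ?tuple_len_ge0 // IH /= negbK.
have [->|xy] := eqVneq x y; first by rewrite hdistxx eqxx.
by have := hdist_gt0 R xy; rewrite lt_neqAle eq_sym => /andP[/negPf ->].
Qed.

Lemma const_drop_inj (R : realType) (K : hypergraph) q (s s' : seq K) :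
  (q < size s)%N -> (q < size s')%N -> drop q s = drop q s' ->
  tuple_len R (take q.+1 s) = 0%E -> tuple_len R (take q.+1 s') = 0%E -> s = s'.
Proof.
move=> qs qs' ds; suff key (u : seq K) : (q < size u)%N ->
    tuple_len R (take q.+1 u) = 0%E -> forall x0, take q u = nseq q (head x0 (drop q u)).
  case: s qs ds => // x0 s qs ds ts ts'.
  by rewrite -(cat_take_drop q s') -(cat_take_drop q (x0 :: s)) (key _ qs ts x0) (key _ qs' ts' x0) ds.
move=> {s s' qs qs' ds} qu; case: u qu => [|y0 u] // qu.
rewrite (take_nth y0) // (drop_nth y0 qu) => + x0 /=.
move: (nth _ _ _) => z; have : size (take q (y0 :: u)) = q by rewrite size_take qu.
move: (take q _) => v; move: (q) => {qu} m <-.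
elim: v => [|a v IH] //=; case: v IH => [_|b v IH].
  rewrite /= tuple_len_cons tuple_len1 adde0 => d0; congr cons.
  by apply/eqP/negPn/negP => /(hdist_gt0 R); rewrite d0 ltxx.
rewrite /= tuple_len_cons => /eqP; rewrite padde_eq0 ?hdist_ge0 ?tuple_len_ge0 //.
move=> /andP[/eqP d0 /eqP l0]; have bz := IH l0.
have ab : a = b by apply/eqP/negPn/negP => /(hdist_gt0 R); rewrite d0 ltxx.
by rewrite bz ab; case: bz => ->.
Qed.

Lemma mcoeff_mcs (R : realType) (K : hypergraph) k (l : R) (s : seq K) (g : mgen K k l) :
  mcoeff g (mcs k l s) = (s == g :> seq K)%:R.
Proof.
have [/mseqP[h ->]|ns] := boolP (mseq k l s).
  rewrite mcs_gen fgenE; congr (nat_of_bool _)%:R; apply/eqP/eqP => [->|] //.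
rewrite mcs0 // mcoeff0; case: eqP => // e.
by case/negP: ns; rewrite e mseq_gen.
Qed.

Lemma mc_bd_gen (R : realType) (K : hypergraph) k (l : R) (g : mgen K k.+1 l) :
  mc_bd K k l (fgen g) = \sum_(i < k.+2) mcs k l (dele i g) *~ (-1) ^+ i.
Proof.
rewrite -mcs_gen mc_bd_mcs ?size_tuple //.
by have /and3P[_ _ /eqP ->] := mseq_gen g.
Qed.

(** * Generators of the product read as words *)

Section Steps.
Variables (R : realType) (G H : hypergraph).
Local Notation P := (cart_prod G H).
Local Notation len := (tuple_len R).
Implicit Types (a b c : P) (t : seq P) (l : R).

Definition step a b : bool * bool := (a.1 != b.1, a.2 != b.2).

Definition steps t : seq (bool * bool) :=
  zip (neqs (unzip1 t)) (neqs (unzip2 t)).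

Lemma steps_cat t1 a t2 : steps (t1 ++ a :: t2) = steps (rcons t1 a) ++ steps (a :: t2).
Proof.
rewrite /steps /unzip1 /unzip2 !map_cat !map_rcons /= !neqs_cat zip_cat //.
by rewrite !size_neqs !size_rcons !size_map.
Qed.

Lemma steps_cons a b t : steps [:: a, b & t] = step a b :: steps (b :: t).
Proof. by []. Qed.

Lemma size_steps t : size (steps t) = (size t).-1.
Proof. by rewrite size_zip !size_neqs !size_map minnn. Qed.

Lemma fst_steps t : map fst (steps t) = neqs (unzip1 t).
Proof. by rewrite /steps -/(unzip1 _) unzip1_zip // !size_neqs !size_map. Qed.

Lemma snd_steps t : map snd (steps t) = neqs (unzip2 t).
Proof. by rewrite /steps -/(unzip2 _) unzip2_zip // !size_neqs !size_map. Qed.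

(** Since the distance is the sum over the coordinates, equality in the triangle inequality holds in
    each of them; there, equal end points force the middle point to agree with them. *)
Lemma step_merge a b c : hdist R a c \is a fin_num ->
  (hdist R a c = hdist R a b + hdist R b c)%E ->
  step a c = merge (step a b) (step b c).
Proof.
have pos (K : hypergraph) (x y z : K) : (hdist R x z = hdist R x y + hdist R y z)%E ->
    (x != z) = (x != y) || (y != z).
  have [->|xy] /= := eqVneq x y; first by [].
  move=> e; apply: contraTneq (hdist_gt0 R xy) => xz.
  move/eqP: e; rewrite xz hdistxx eq_sym padde_eq0 ?hdist_ge0 // => /andP[/eqP -> _].
  by rewrite ltxx.
rewrite !hdist_cart fin_numD => /andP[f1 f2].
have t1 := hdist_triangle R a.1 b.1 c.1; have t2 := hdist_triangle R a.2 b.2 c.2.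
rewrite addeACA => e.
suff [e1 e2] : (hdist R a.1 c.1 = hdist R a.1 b.1 + hdist R b.1 c.1)%E /\
    (hdist R a.2 c.2 = hdist R a.2 b.2 + hdist R b.2 c.2)%E.
  by rewrite /step /merge /= (pos _ _ _ _ e1) (pos _ _ _ _ e2).
move: e t1 t2 f1 f2.
have nn1 : (0 <= hdist R a.1 b.1 + hdist R b.1 c.1)%E by rewrite adde_ge0 ?hdist_ge0.
have nn2 : (0 <= hdist R a.2 b.2 + hdist R b.2 c.2)%E by rewrite adde_ge0 ?hdist_ge0.
move: nn1 nn2.
move: (hdist R a.1 b.1 + _)%E (hdist R a.2 b.2 + _)%E (hdist R a.1 c.1) (hdist R a.2 c.2).
move=> [u| |] // [v| |] // [u'| |] // [v'| |] // _ _.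
rewrite -!EFinD !lee_fin => -[e] h1 h2 _ _.
by split; congr _%:E; lra.
Qed.

(** Dropping an end vertex strictly shortens the tuple, so a face of full length is interior and the
    removed vertex is on a geodesic between its neighbours. *)
Lemma valid_face n l (t : seq P) i : mseq n.+1 l t -> (i < n.+2)%N ->
  mseq n l (dele i t) ->
  exists t1 a b c t2, [/\ t = t1 ++ [:: a, b, c & t2], i = (size t1).+1,
    dele i t = t1 ++ [:: a, c & t2] & step a c = merge (step a b) (step b c)].
Proof.
move=> /and3P[/eqP sz adj /eqP ln] iN /and3P[_ _ /eqP ln'].
have nlt x y t2 : tuple_len R (x :: y :: t2) = l%:E -> adj_neq [:: x, y & t2] ->
    tuple_len R (y :: t2) <> l%:E.
  rewrite /adj_neq /= tuple_len_cons => e /andP[xy _] e'.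
  have := @hdist_gt0 R P _ _ xy; move: e; rewrite e'.
  case: (hdist R x y) => [r| |] // [e]; rewrite lte_fin => r0.
  by move: r0; rewrite (_ : r = 0) ?ltxx //; lra.
case: i iN ln' => [|i] iN.
  move: t sz adj ln => [|x [|y t]] // _ adj ln /=.
  by rewrite /dele /= => /(nlt _ _ _ ln adj).
have x0 : P by case: (t) sz.
pose t1 := take i t; pose a := nth x0 t i; pose b := nth x0 t i.+1.
have tE : t = t1 ++ [:: a, b & drop i.+2 t].
  by rewrite -{1}(cat_take_drop i t) (drop_nth x0) ?(drop_nth x0 (n := i.+1)) ?sz //; lia.
have szt1 : size t1 = i by rewrite size_take sz; case: (ltnP i); lia.
have dE : dele i.+1 t = t1 ++ a :: drop i.+2 t.
  by rewrite {1}tE -{1}szt1 -addn1 dele_catr /dele /= drop0.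
case e : (drop i.+2 t) => [|c t2].
  rewrite dE e => ln'; exfalso; move: ln adj; rewrite tE e neqs_adj neqs_cat all_cat.
  rewrite tuple_len_cat tuple_len_cons tuple_len1 adde0 -cats1 ln' => + /andP[_ /=].
  rewrite andbT => + /(@hdist_gt0 R P); case: (hdist R a b) => [r| |] // [].
  by rewrite lte_fin => h r0; clear -h r0; lra.
rewrite dE e => ln'; exists t1, a, b, c, t2; split=> //; first by rewrite tE e.
  by rewrite szt1.
have fin : len (t1 ++ [:: a, c & t2]) \is a fin_num by rewrite ln'.
move: ln fin ln'; rewrite {1}tE e !(tuple_len_cat _ _ a) !tuple_len_cons.
move=> <-; rewrite !fin_numD => /and3P[f1 fac f2].
move=> h; apply: step_merge => //.
move: h f1 f2 fac; rewrite addeA.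
have nnab := hdist_ge0 R a b; have nnbc := hdist_ge0 R b c; move: nnab nnbc.
move: (len (rcons t1 a)) (len (c :: t2)) (hdist R a c) (hdist R a b) (hdist R b c).
move=> [u| |] // [v| |] // [r| |] // [r1| |] // [r2| |] // _ _ [h] _ _ _.
by congr _%:E; clear -h; lra.
Qed.

Lemma steps_split t w1 x w2 : steps t = w1 ++ x :: w2 ->
  exists t1 a b t2, [/\ t = t1 ++ [:: a, b & t2], steps (rcons t1 a) = w1,
    x = step a b & w2 = steps (b :: t2)].
Proof.
elim: w1 t => [|y w1 IH] [|a [|b t]] //=.
  by rewrite steps_cons => -[<- <-]; exists [::], a, b, t.
rewrite steps_cons => -[<- /IH[t1 [a' [b' [t2 [e1 e2 e3 e4]]]]]].
exists (a :: t1), a', b', t2; split=> //; first by rewrite e1.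
by case: t1 e1 e2 => [|? t1] /= [-> _] <-.
Qed.

Lemma steps_adj t : adj_neq t -> all (fun x => x.1 || x.2) (steps t).
Proof.
elim: t => // a [|b t] IH //; rewrite steps_cons /adj_neq /= => /andP[ab /IH ->].
by rewrite andbT -negb_and -xpair_eqE.
Qed.

Lemma steps_cat2 t1 a b t2 :
  steps (t1 ++ [:: a, b & t2]) = steps (rcons t1 a) ++ step a b :: steps (b :: t2).
Proof. by rewrite steps_cat steps_cons. Qed.

Lemma steps_cat3 t1 a b c t2 : steps (t1 ++ [:: a, b, c & t2]) =
  steps (rcons t1 a) ++ [:: step a b, step b c & steps (c :: t2)].
Proof. by rewrite steps_cat2 steps_cons. Qed.

Lemma hdist_corner a b : (hdist R a b = hdist R a ((b.1, a.2) : P) + hdist R ((b.1, a.2) : P) b)%E.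
Proof. by rewrite !(@hdist_cart R G H) /= !hdistxx adde0 add0e. Qed.

Lemma corner_eq a b c : step a c = stepX -> step c b = stepY -> c = (b.1, a.2).
Proof.
case: a b c => [a1 a2] [b1 b2] [c1 c2] [_ /negbFE/eqP e1] [/negbFE/eqP e2 _] /=.
by rewrite e2 e1.
Qed.

Lemma step_corner a b : step a b = stepD ->
  step a (b.1, a.2) = stepX /\ step (b.1, a.2) b = stepY.
Proof. by case=> h1 h2; rewrite /step /= h1 h2 !eqxx. Qed.

Lemma corner_step a b : step a (b.1, a.2) = stepX -> step (b.1, a.2) b = stepY ->
  step a b = stepD.
Proof. by case=> h1 _ [_ h2]; rewrite /step /= h1 h2. Qed.

(** The corner is on a geodesic from [a] to [b], so inserting it keeps the length, and both new
    steps move. *)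
Lemma mseq_corner n l t1 a b t2 : step a b = stepD ->
  mseq n.+1 l (t1 ++ [:: a, ((b.1, a.2) : P), b & t2]) = mseq n l (t1 ++ [:: a, b & t2]).
Proof.
move=> D; have [X Y] := step_corner D.
rewrite /mseq !size_cat /= !addnS !eqSS; congr andb.
rewrite !(tuple_len_cat _ _ a) !tuple_len_cons (hdist_corner a b) !addeA.
congr andb; rewrite /adj_neq.
have split2 (u : seq P) (z w : P) v : sorted (fun x y => x != y) (u ++ [:: z, w & v]) =
    [&& sorted (fun x y => x != y) (rcons u z), z != w & sorted (fun x y => x != y) (w :: v)].
  by case: u => [|u0 u] //=; rewrite cat_path rcons_path /= -andbA.
rewrite !split2 /=; congr andb.
have nst (x y : P) : (x != y) = (step x y).1 || (step x y).2.
  by rewrite -negb_and -xpair_eqE; case: (x); case: (y).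
by rewrite !nst X Y D.
Qed.

(** [cls_merge] for tuples: the second alternative is that the face is the Morse partner of [h]. *)
Lemma valid_face_cls n l (h : seq P) i : mseq n.+1 l h -> (i < n.+2)%N ->
  mseq n l (dele i h) -> cls false (steps h) = 2%N -> cls false (steps (dele i h)) = 1%N ->
  (meas (steps (dele i h)) < meas (steps h))%N \/
  exists t1 a b t2, [/\ h = t1 ++ [:: a, ((b.1, a.2) : P), b & t2], i = (size t1).+1,
    dele i h = t1 ++ [:: a, b & t2], step a b = stepD & cls false (steps (rcons t1 a)) = 0%N].
Proof.
move=> hm iN fm; have [t1 [a [c [b [t2 [hE iE fE st]]]]]] := valid_face hm iN fm.
rewrite hE steps_cat3 -hE fE steps_cat2 st => c2 c1.
have := meas_merge (steps (rcons t1 a)) (step a c) (step c b) (steps (b :: t2)).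
have /orP[->|/and3P[/eqP X /eqP Y /eqP c0] _] := cls_merge c2 c1.
  by rewrite addn1; left.
right; exists t1, a, b, t2; rewrite -(corner_eq X Y); split=> //.
by rewrite st X Y.
Qed.

(** The two pieces read by [aw] use up the whole length, so the first coordinate rests up to [q] and
    the second from [q] on. *)
Lemma aw_crit p q n l1 l2 l t : mseq n l t -> l1 + l2 = l -> aw p q l1 l2 t != 0 ->
  [/\ cls false (steps t) = 0%N, len (take q.+1 (unzip1 t)) = 0%E,
      len (drop q (unzip2 t)) = 0%E & (p + q)%N = n].
Proof.
move=> /and3P[/eqP sz _ /eqP ln] el /aw_len[/and3P[/eqP s1 a1 /eqP e1] /and3P[/eqP s2 a2 /eqP e2] _].
have [z1 z2] : len (take q.+1 (unzip1 t)) = 0%E /\ len (drop q (unzip2 t)) = 0%E.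
  move: ln; rewrite tuple_len_cart -(tuple_len_split R q (unzip1 t)) e1.
  rewrite -(tuple_len_split R q (unzip2 t)) e2.
  have := tuple_len_ge0 R (take q.+1 (unzip1 t)).
  have := tuple_len_ge0 R (drop q (unzip2 t)).
  case: (len _) => [u| |] //; case: (len _) => [v| |] //.
  rewrite !lee_fin -!EFinD => u0 v0 [e]; clear -u0 v0 e el.
  by split; congr _%:E; lra.
have pq : (p + q)%N = n.
  by move: s1 s2; rewrite size_drop size_take !size_map sz; case: ltnP; lia.
split=> //; rewrite /steps -(cat_take_drop q (neqs (unzip1 t))).
rewrite -(cat_take_drop q (neqs (unzip2 t))) -!neqs_take -!neqs_drop.
have allnseq (T : eqType) (s : seq T) (f : bool -> bool) e : (forall d, f d -> d = e) ->
    all f (neqs s) -> neqs s = nseq (size s).-1 e.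
  move=> fb /allP h; rewrite -size_neqs; apply/all_pred1P/allP => d /h/fb ->.
  exact: eqxx.
have N1 : neqs (take q.+1 (unzip1 t)) = nseq (size (take q.+1 (unzip1 t))).-1 false.
  by apply: (allnseq _ _ negb) => [[]|] //; rewrite -(neqs_len0 R) z1.
have N2 : neqs (drop q (unzip2 t)) = nseq (size (drop q (unzip2 t))).-1 false.
  by apply: (allnseq _ _ negb) => [[]|] //; rewrite -(neqs_len0 R) z2.
have N3 : neqs (take q.+1 (unzip2 t)) = nseq (size (take q.+1 (unzip2 t))).-1 true.
  by apply: (allnseq _ _ id) => [[]|] //; rewrite -neqs_adj.
have N4 : neqs (drop q (unzip1 t)) = nseq (size (drop q (unzip1 t))).-1 true.
  by apply: (allnseq _ _ id) => [[]|] //; rewrite -neqs_adj.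
rewrite N1 N2 N3 N4.
rewrite zip_cat; last by rewrite !size_nseq !size_take !size_map sz; case: ltnP.
rewrite !size_take !size_drop !size_map sz.
have zn (T U : Type) k (x : T) (y : U) : zip (nseq k x) (nseq k y) = nseq k (x, y).
  by elim: k => //= k ->.
by rewrite !zn cls_nseq.
Qed.

(** The witnesses [q] and [p] count the Y and X steps; [l2] and [l1] are the lengths of the two
    moving pieces. *)
Lemma crit_aw n l t : mseq n l t -> cls false (steps t) = 0%N ->
  exists p q l1 l2, [/\ (p + q)%N = n, l1 + l2 = l, mseq p l1 (drop q (unzip1 t)),
    mseq q l2 (take q.+1 (unzip2 t)) & 0 <= l1 /\ 0 <= l2].
Proof.
move=> /and3P[/eqP sz _ /eqP ln] /cls0P[q [p [w _]]].
have pq : (p + q)%N = n.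
  by move/(congr1 size): w; rewrite size_steps sz size_cat !size_nseq addnC.
have nx : neqs (unzip1 t) = nseq q false ++ nseq p true.
  by rewrite -fst_steps w map_cat !map_nseq.
have ny : neqs (unzip2 t) = nseq q true ++ nseq p false.
  by rewrite -snd_steps w map_cat !map_nseq.
have z1 : len (take q.+1 (unzip1 t)) = 0%E.
  apply/eqP; rewrite neqs_len0 neqs_take nx take_size_cat ?size_nseq //.
  by rewrite all_nseq orbT.
have z2 : len (drop q (unzip2 t)) = 0%E.
  apply/eqP; rewrite neqs_len0 neqs_drop ny drop_size_cat ?size_nseq //.
  by rewrite all_nseq orbT.
move: ln; rewrite tuple_len_cart -(tuple_len_split R q (unzip1 t)) z1 add0e.
rewrite -(tuple_len_split R q (unzip2 t)) z2 adde0.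
have := tuple_len_ge0 R (drop q (unzip1 t)).
have := tuple_len_ge0 R (take q.+1 (unzip2 t)).
case e2 : (len (take _ _)) => [l2| |] //; case e1 : (len (drop _ _)) => [l1| |] //.
rewrite !lee_fin => l20 l10 [el]; exists p, q, l1, l2; split=> //.
  rewrite /mseq size_drop size_map sz e1 eqxx andbT neqs_adj neqs_drop nx.
  rewrite drop_size_cat ?size_nseq // all_nseq orbT andbT; apply/eqP; lia.
rewrite /mseq size_take size_map sz e2 eqxx andbT neqs_adj neqs_take ny.
rewrite take_size_cat ?size_nseq // all_nseq orbT andbT.
by case: ltnP => ?; apply/eqP; lia.
Qed.
End Steps.

Lemma const_take_inj (R : realType) (K : hypergraph) q (s s' : seq K) :
  (q < size s)%N -> size s = size s' -> take q.+1 s = take q.+1 s' ->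
  tuple_len R (drop q s) = 0%E -> tuple_len R (drop q s') = 0%E -> s = s'.
Proof.
case: s => // x0 s; set u := x0 :: s => qs ss ts.
have qs' : (q < size s')%N by rewrite -ss.
rewrite (drop_nth x0 qs) (drop_nth x0 qs') => /tuple_len0_const d /tuple_len0_const d'.
rewrite -(cat_take_drop q.+1 u) -(cat_take_drop q.+1 s') ts d d' !size_drop ss.
by rewrite -(nth_take x0 (ltnSn q) u) -(nth_take x0 (ltnSn q) s') ts.
Qed.

Lemma seq_argmax (T : eqType) (f : T -> nat) (s : seq T) : s != [::] ->
  exists2 x, x \in s & {in s, forall y, (f y <= f x)%N}.
Proof.
elim: s => // a [|b s] IH _.
  by exists a; rewrite ?mem_head // => y; rewrite inE => /eqP ->.
have [//|x xs xmax] := IH; have [ax|xa] := leqP (f a) (f x).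
  exists x; first by rewrite inE xs orbT.
  by move=> y; rewrite inE => /orP[/eqP ->|/xmax].
exists a; first exact: mem_head.
by move=> y; rewrite inE => /orP[/eqP ->|/xmax yx] //; apply: leq_trans yx (ltnW xa).
Qed.

(** * Cancellation along the matching *)

Section Morse.
Variables (R : realType) (G H : hypergraph).
Local Notation P := (cart_prod G H).
Implicit Types (t : seq P) (l : R).

Definition aw_null n l (c : mc_group P n l) :=
  forall p q l1 l2, (p + q)%N = n -> l1 + l2 = l -> awm G H p q l1 l2 n l c = 0.

(* No tuple of the support of [c] has a diagonal step before all corners XY. *)
Definition no_diag n l (c : mc_group P n l) :=
  forall g : mgen P n l, cls false (steps g) = 1%N -> mcoeff g c = 0.

Lemma aw_nullB n l (c d : mc_group P n l) : aw_null c -> aw_null d -> aw_null (c - d).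
Proof. by move=> hc hd p q l1 l2 pq ll; rewrite raddfB hc // hd // subrr. Qed.

Lemma no_diagB n l (c d : mc_group P n l) : no_diag c -> no_diag d -> no_diag (c - d).
Proof. by move=> hc hd g g1; rewrite mcoeffB hc // hd // subrr. Qed.

Lemma aw_null0 n l : aw_null (0 : mc_group P n l).
Proof. by move=> *; rewrite raddf0. Qed.

Lemma no_diag0 n l : no_diag (0 : mc_group P n l).
Proof. by move=> *; rewrite mcoeff0. Qed.

Lemma no_diag_mcs n l t : (mseq n l t -> cls false (steps t) <> 1%N) -> no_diag (mcs n l t).
Proof.
move=> h g g1; rewrite mcoeff_mcs; case: eqP => // e.
by case: h; rewrite e // mseq_gen.
Qed.

Lemma aw_null_gen n l (g : mgen P n l) : cls false (steps g) <> 0%N -> aw_null (fgen g).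
Proof.
move=> gN p q l1 l2 pq ll; rewrite /awm free_lift_gen; apply: contrapT => /eqP aN; apply: gN.
by case: (aw_crit (mseq_gen g) ll aN).
Qed.

(** With [aw_null e], subtracting the boundary of [e] leaves the Alexander-Whitney components of [c]
    unchanged, by [awm_bd]. *)
Definition reducible n l (c : mc_group P n l) : Prop :=
  exists e : mc_group P n.+1 l, aw_null e /\ no_diag (c - mc_bd P n l e).

Lemma reducibleB n l (c d : mc_group P n l) : reducible c -> reducible d -> reducible (c - d).
Proof.
move=> [e [e1 e2]] [f [f1 f2]]; exists (e - f); split; first exact: aw_nullB.
have -> : c - d - mc_bd P n l (e - f) = (c - mc_bd P n l e) - (d - mc_bd P n l f).
  by rewrite raddfB !opprD !opprK addrACA.
exact: no_diagB.
Qed.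

Lemma reducible0 n l : reducible (0 : mc_group P n l).
Proof.
by exists 0; split; [exact: aw_null0 | rewrite raddf0 subr0; exact: no_diag0].
Qed.

Lemma reducibleN n l (c : mc_group P n l) : reducible c -> reducible (- c).
Proof. by move=> ?; rewrite -sub0r; apply: reducibleB => //; apply: reducible0. Qed.

Lemma reducibleD n l (c d : mc_group P n l) : reducible c -> reducible d -> reducible (c + d).
Proof. by move=> ? ?; rewrite -[d]opprK; apply: reducibleB => //; apply: reducibleN. Qed.

Lemma reducibleMz n l (c : mc_group P n l) z : reducible c -> reducible (c *~ z).
Proof.
move=> hc; have nat_ k : reducible (c *+ k).
  by elim: k => [|k IH]; rewrite ?mulr0n ?mulrS; [exact: reducible0 | apply: reducibleD].
by case: z => k; [exact: nat_ | rewrite NegzE mulrNz; apply/reducibleN/nat_].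
Qed.

Lemma no_diag_reducible n l (c : mc_group P n l) : no_diag c -> reducible c.
Proof.
by move=> hc; exists 0; split; [exact: aw_null0 | rewrite raddf0 subr0].
Qed.

(* The Morse matching pairs a tuple whose first event is a diagonal step with
   the tuple where that step is replaced by a corner XY. *)
Lemma reducible_gen n l (g : mgen P n l) : reducible (fgen g).
Proof.
have [m] := ubnP (meas (steps g)); elim: m g => // m IH g gm.
have [c1|/eqP cN] := eqVneq (cls false (steps g)) 1%N; last first.
  by apply: no_diag_reducible; rewrite -mcs_gen; apply: no_diag_mcs.
have [w1 [w2 [wE c0]]] := cls1P c1.
have [t1 [a [b [t2 [gE s1 Dab s2]]]]] := steps_split wE.
pose h := t1 ++ [:: a, ((b.1, a.2) : P), b & t2].
have hm : mseq n.+1 l h by rewrite mseq_corner // -gE mseq_gen.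
have [gh ghE] := mseqP _ _ _ hm.
have [X Y] := step_corner (esym Dab).
have hw : steps h = w1 ++ [:: stepX, stepY & w2] by rewrite steps_cat3 s1 X Y s2.
have ch : cls false (steps h) = 2%N by rewrite hw cls_XY.
have mh : meas (steps h) = meas (steps g) by rewrite hw meas_XY wE.
have iN : ((size t1).+1 < n.+2)%N.
  have := size_tuple g; rewrite gE size_cat /=; lia.
(* A tuple of class 2 has no Alexander-Whitney component, so [gh] itself is a witness. *)
have bdh : reducible (mc_bd P n l (fgen gh)).
  exists (fgen gh); split; last by rewrite subrr; apply: no_diag0.
  by apply: aw_null_gen; rewrite -ghE ch.
have h0 : dele (size t1).+1 h = g.
  by rewrite gE /h -cat_rcons -(size_rcons t1 a) dele_cat cat_rcons.
pose sg : int := (-1) ^+ (size t1).+1.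
have -> : fgen g = (fgen g *~ sg) *~ sg.
  by rewrite -mulrzA /sg -expr2 -exprM mulnC exprM sqrrN expr1n.
apply: reducibleMz; move: bdh; rewrite mc_bd_gen (bigD1 (Ordinal iN)) //= -ghE h0 mcs_gen.
set rest := \sum_(i < _ | _) _ => bdh.
suff hr : reducible rest by rewrite -(addrK rest (_ *~ _)); apply: reducibleB.
rewrite /rest; elim/big_ind: _ => [||i ii]; [exact: reducible0 | by move=> *; apply: reducibleD |].
apply: reducibleMz; have [fm|fm] := boolP (mseq n l (dele i h)); last first.
  by rewrite mcs0 //; apply: reducible0.
have [/eqP fc|/eqP fc] := boolP (cls false (steps (dele i h)) == 1%N); last first.
  by apply: no_diag_reducible; apply: no_diag_mcs.
(* A diagonal face either has smaller [meas], where induction applies, or removes the first corner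
   and so has the index already split off from the sum. *)
have [lt|[t1' [a' [b' [t2' [hE' iE fE D' c0']]]]]] := valid_face_cls hm (ltn_ord i) fm ch fc.
  have [gf gfE] := mseqP _ _ _ fm; rewrite gfE mcs_gen; apply: IH; rewrite -gfE.
  by apply: leq_trans lt _; rewrite mh -ltnS.
case/eqP: ii; apply/val_inj => /=; rewrite iE; congr _.+1.
have [X' Y'] := step_corner D'.
have hw' : steps h = steps (rcons t1' a') ++ [:: stepX, stepY & steps (b' :: t2')].
  by rewrite hE' steps_cat3 X' Y'.
have := cls_XY_uniq c0 c0' (etrans (esym hw) hw').
by rewrite -s1 !size_steps !size_rcons /= => ->.
Qed.

Lemma reducible_all n l (c : mc_group P n l) : reducible c.
Proof.
rewrite (free_expand c); elim/big_ind: _ => [||g _].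
- exact: reducible0.
- by move=> *; apply: reducibleD.
- exact/reducibleMz/reducible_gen.
Qed.

Lemma cls_gen n l (g : mgen P n l) : cls false (steps g) != 3%N.
Proof.
have /and3P[_ /steps_adj + _] := mseq_gen g; move: (steps g) => w.
by elim: w false => // -[[] []] w IH s //= aw; [exact: IH | case: s => //; exact: IH].
Qed.

Lemma cls_le3 s w : (cls s w <= 3)%N.
Proof. by elim: w s => // -[[] []] w IH [] //=. Qed.

(** A critical tuple is determined by its two pieces [v] and [w]; hence the coefficient at [g] is
    the component of [c] followed by the functional [phi] dual to $v\otimes w$. *)
Lemma mcoeff_crit n l (c : mc_group P n l) (g : mgen P n l) : aw_null c ->
  cls false (steps g) = 0%N -> mcoeff g c = 0.
Proof.
move=> cn g0; have [p [q [l1 [l2 [pq ll m1 m2 _]]]]] := crit_aw (mseq_gen g) g0.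
have [v vE] := mseqP _ _ _ m1; have [w wE] := mseqP _ _ _ m2.
pose phi := @tens_lift (mc_group G p l1) (mc_group H q l2) int
  (fun x y => mcoeff v x * mcoeff w y).
have phiDl x x' y : mcoeff v (x + x' : mc_group G p l1) * mcoeff w (y : mc_group H q l2) =
    mcoeff v x * mcoeff w y + mcoeff v x' * mcoeff w y by rewrite mcoeffD mulrDl.
have phiDr x y y' : mcoeff v (x : mc_group G p l1) * mcoeff w (y + y' : mc_group H q l2) =
    mcoeff v x * mcoeff w y + mcoeff v x * mcoeff w y' by rewrite mcoeffD mulrDr.
have phiE g' : phi phiDl phiDr (awm G H p q l1 l2 n l (fgen g')) = (g' == g)%:R.
  rewrite /awm free_lift_gen /aw /phi tens_liftE !mcoeff_mcs -vE -wE.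
  case: eqP => e1; last by rewrite mul0r; case: eqP => // e; case: e1; rewrite e.
  case: eqP => e2; last by rewrite mulr0; case: eqP => // e; case: e2; rewrite e.
  rewrite mulr1; case: eqP => // -[]; apply: mgen_inj.
  have awN (h : mgen P n l) : drop q (unzip1 h) = v -> take q.+1 (unzip2 h) = w ->
      aw p q l1 l2 h != 0.
    move=> ev ew; rewrite /aw ev ew; apply: contra_neq (oner_neq0 int) => a0.
    transitivity (phi phiDl phiDr (tens (mcs p l1 v) (mcs q l2 w))).
      by rewrite /phi tens_liftE !mcoeff_mcs !eqxx mulr1.
    by rewrite a0 raddf0.
  have [_ z1 z2 _] := aw_crit (mseq_gen g) ll (awN g vE wE).
  have [_ z1' z2' _] := aw_crit (mseq_gen g') ll (awN g' (etrans e1 vE) (etrans e2 wE)).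
  have qn : (q < n.+1)%N by lia.
  have szu (h : mgen P n l) : size (unzip1 h) = n.+1 /\ size (unzip2 h) = n.+1.
    by rewrite !size_map size_tuple.
  have E1 : unzip1 g' = unzip1 g.
    by apply: (@const_drop_inj R _ q); rewrite ?(szu _).1.
  have E2 : unzip2 g' = unzip2 g.
    apply: (@const_take_inj R _ q); rewrite ?(szu _).2 //.
  by rewrite -(zip_unzip g') -(zip_unzip g) E1 E2.
transitivity (phi phiDl phiDr (awm G H p q l1 l2 n l c)); last by rewrite cn // raddf0.
apply/esym; apply: (free_ext (f := phi phiDl phiDr \o awm G H p q l1 l2 n l) (g := mcoeff g)) => g'.
exact: etrans (phiE g') (esym (fgenE g' g)).
Qed.

(** Otherwise the support lies in class 2. Let [h] have maximal [meas] in it and let [tau] be [h]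
    without its first corner: no other tuple of the support has the face [tau], so the coefficient
    of [h] survives in the boundary at a diagonal tuple. *)
Lemma no_diag_eq0 n l (c : mc_group P n l) : aw_null c -> no_diag c ->
  no_diag (n := n.-1) (bd_out (magnitude_complex P l) n c) -> c = 0.
Proof.
move=> cn cd bcd; apply: free_supp_nil; apply/eqP/negPn/negP.
move=> /(seq_argmax (fun h : mgen P n l => meas (steps h)))[h hs hmax].
have clsE (g : mgen P n l) : g \in msupp c -> cls false (steps g) = 2%N.
  rewrite -mcoeff_neq0 => gN; have := cls_le3 false (steps g); have := cls_gen g.
  case e : (cls _ _) => [|[|[|[|k]]]] // _ _.
    by rewrite (mcoeff_crit cn e) eqxx in gN.
  by rewrite (cd g e) eqxx in gN.
have ch := clsE h hs; have [[w1 [w2 [wE c0]]]|[]//] := cls2P ch.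
have [t1 [a [d [t' [hE s1 X]]]]] := steps_split wE.
case: t' hE => [|b t2] hE; rewrite ?steps_cons // => e.
have Y : stepY = step d b := congr1 (head stepY) e.
have s2 : w2 = steps (b :: t2) := congr1 behead e.
clear e.
have dE := corner_eq (esym X) (esym Y); rewrite dE in hE X Y.
have Dab := corner_step (esym X) (esym Y).
case: n c h cn cd bcd hs hmax clsE ch wE hE => [|n] c h cn cd bcd hs hmax clsE ch wE hE.
  by have := size_tuple h; rewrite hE size_cat /= => ?; lia.
have tm : mseq n l (t1 ++ [:: a, b & t2]).
  by rewrite -(mseq_corner n l t1 t2 Dab) -hE mseq_gen.
have [tau tauE] := mseqP _ _ _ tm.
have tw : steps tau = w1 ++ stepD :: w2 by rewrite -tauE steps_cat2 s1 Dab s2.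
have ct : cls false (steps tau) = 1%N by rewrite tw cls_D.
have mt : meas (steps tau) = meas (steps h) by rewrite tw wE meas_XY.
have iN : ((size t1).+1 < n.+2)%N.
  by have := size_tuple h; rewrite hE size_cat /= => ?; lia.
have coefE (h' : mgen P n.+1 l) : mcoeff tau (mc_bd P n l (fgen h')) =
    \sum_(i < n.+2) ((dele i h' == tau :> seq P)%:R : int) *~ (-1) ^+ i.
  rewrite mc_bd_gen (raddf_sum (mcoeff tau)); apply: eq_bigr => i _.
  by rewrite (raddfMz (mcoeff tau)) -mcoeff_mcs.
have bcE : mcoeff tau (mc_bd P n l c) =
    \sum_(h' <- msupp c) mcoeff tau (mc_bd P n l (fgen h')) *~ mcoeff h' c.
  rewrite {1}(free_expand c) (raddf_sum (mc_bd P n l)) (raddf_sum (mcoeff tau)).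
  by apply: eq_bigr => h' _; rewrite raddfMz (raddfMz (mcoeff tau)).
have : mcoeff tau (mc_bd P n l c) = 0 := bcd tau ct.
rewrite bcE (bigD1_seq h hs (fset_uniq _)) big1_seq; last first.
  move=> h' /andP[h'h h's]; rewrite coefE.
  rewrite big1 ?mul0rz // => i _.
  case: eqP => [fE|_]; last by rewrite mul0rz.
  have fm : mseq n l (dele i h') by rewrite fE mseq_gen.
  have fc : cls false (steps (dele i h')) = 1%N by rewrite fE ct.
  have [lt|[t1' [a' [b' [t2' [hE' iE fE' D' c0']]]]]] :=
      valid_face_cls (mseq_gen h') (ltn_ord i) fm (clsE h' h's) fc.
    by have := hmax h' h's; rewrite leqNgt -mt -fE lt.
  case/eqP: h'h; apply: mgen_inj; rewrite hE' hE.
  have tt : t1 ++ [:: a, b & t2] = t1' ++ [:: a', b' & t2'] by rewrite tauE -fE fE'.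
  have sz : size t1 = size t1'.
    have := cls_D_uniq c0 c0' (w2 := w2) (w2' := steps (b' :: t2')).
    rewrite -tw -D' -steps_cat2 -tt -tauE => /(_ erefl).
    by rewrite -s1 !size_steps !size_rcons /=.
  by move/eqP: tt; rewrite eqseq_cat // => /andP[/eqP <- /eqP[<- <- <-]].
rewrite coefE (bigD1 (Ordinal iN)) // big1 => [|i ii]; last first.
  case: eqP => [fE|_]; last by rewrite mul0rz.
  have fm : mseq n l (dele i h) by rewrite fE mseq_gen.
  have fc : cls false (steps (dele i h)) = 1%N by rewrite fE ct.
  have [lt|[t1' [a' [b' [t2' [hE' iE fE' D' c0']]]]]] :=
      valid_face_cls (mseq_gen h) (ltn_ord i) fm ch fc.
    by move: lt; rewrite fE mt ltnn.
  have [X' Y'] := step_corner D'.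
  case/eqP: ii; apply/val_inj => /=; rewrite iE; congr _.+1.
  have := cls_XY_uniq c0 c0' (w2 := w2) (w2' := steps (b' :: t2')).
  rewrite -wE -{1}X' -Y' -steps_cat3 -hE' => /(_ erefl).
  by rewrite -s1 !size_steps !size_rcons /= => ->.
have -> : dele (Ordinal iN) h = tau.
  rewrite [nat_of_ord _]/=.
  by rewrite -tauE hE -cat_rcons -(size_rcons t1 a) dele_cat cat_rcons.
rewrite eqxx => /eqP; rewrite -mcoeff_neq0 in hs.
move=> e; have {e} : (((1 : int) *~ (-1) ^+ (size t1).+1 + 0) *~ mcoeff h c + 0 == 0) := e.
rewrite !addr0 -mulrzA -mulrzr intz mul1r mulf_eq0 (negPf hs) orbF.
by rewrite expf_eq0 andbC.
Qed.

(** [reducible_all] removes the diagonal tuples by a boundary while all components stay 0;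
    [no_diag_eq0] kills the rest. *)
Lemma aw_null_boundary n l (c : mc_group P n l) : aw_null c ->
  bd_out (magnitude_complex P l) n c = 0 -> exists e : mc_group P n.+1 l, c = mc_bd P n l e.
Proof.
move=> cn bc; have [e [en ed]] := reducible_all c; exists e.
apply/eqP; rewrite -subr_eq0; apply/eqP; apply: no_diag_eq0 => //; last first.
  rewrite [bd_out _ _ _](_ : _ = 0); first exact: no_diag0.
  rewrite raddfB bc sub0r; case: (n) e {cn bc en ed c} => [|m] e; first by rewrite oppr0.
  by rewrite [X in - X](mc_bd_bd e) oppr0.
move=> p q l1 l2 pq ll; rewrite raddfB cn // sub0r awm_bd //.
by rewrite !en ?addSn ?addnS ?pq // !raddf0 mul0rz addr0 oppr0.
Qed.
End Morse.

(** * The exterior product as a chain map *)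

Section ShuffleFunctions.
Local Open Scope nat_scope.
Variables p q : nat.
Implicit Types s : shuffle p q.

Definition smu s m : nat := (val s).1 (inord m).
Definition snu s m : nat := (val s).2 (inord m).

Lemma smu0 s : smu s 0 = 0. Proof. exact: (shuffle_start s).1. Qed.
Lemma snu0 s : snu s 0 = 0. Proof. exact: (shuffle_start s).2. Qed.
Lemma smu_end s : smu s (p + q) = p. Proof. exact: (shuffle_end s).1. Qed.
Lemma smu_step s m : m < p + q ->
  (smu s m.+1 = smu s m /\ snu s m.+1 = (snu s m).+1) \/
  (smu s m.+1 = (smu s m).+1 /\ snu s m.+1 = snu s m).
Proof. exact: shuffle_step. Qed.

Lemma smu_snu s m : m <= p + q -> smu s m + snu s m = m.
Proof.
elim: m => [|m IH] mpq; first by rewrite smu0 snu0.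
have := IH (ltnW mpq); case: (smu_step s mpq) => -[-> ->]; lia.
Qed.

Lemma shuffle_eq s s' : (forall m, m <= p + q -> smu s m = smu s' m) -> s = s'.
Proof.
move=> ss; have nn m : m <= p + q -> snu s m = snu s' m.
  by move=> mpq; have := smu_snu s mpq; have := smu_snu s' mpq; rewrite ss //; lia.
apply/val_inj; move: ss nn; rewrite /smu /snu.
case: (val s) => mu nu; case: (val s') => mu' nu' /= ss nn; congr pair.
  by apply/ffunP => m; apply/val_inj; have := ss m; rewrite inord_val; apply; rewrite -ltnS.
by apply/ffunP => m; apply/val_inj; have := nn m; rewrite inord_val; apply; rewrite -ltnS.
Qed.

Section LatticePath.
Variable f : nat -> nat.
Hypothesis f0 : f 0 = 0.
Hypothesis f_end : f (p + q) = p.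
Hypothesis f_step : forall k, k < p + q -> f k.+1 = f k \/ f k.+1 = (f k).+1.

(** The two counters of a shuffle add up to the index, so [f] alone determines it. *)
Definition lattice_path : lattice_pair p q :=
  ([ffun m : 'I_(p + q).+1 => inord (f m) : 'I_p.+1],
   [ffun m : 'I_(p + q).+1 => inord (m - f m) : 'I_q.+1]).

Lemma lattice_path_bounds k : k <= p + q -> [/\ f k <= p, k - f k <= q & f k <= k].
Proof.
have up j : j <= p + q -> f j <= j.
  elim: j => [|j IH] jpq; first by rewrite f0.
  by have := IH (ltnW jpq); case: (f_step jpq) => ->; lia.
have down d : d <= p + q -> p - d <= f (p + q - d) <= p.
  elim: d => [|d IH] dpq; first by rewrite !subn0 f_end !leqnn.
  have := IH (ltnW dpq); have -> : p + q - d = (p + q - d.+1).+1 by lia.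
  by case: (f_step (k := p + q - d.+1)) => [|->|->]; lia.
move=> kpq; have := up k kpq.
have := down (p + q - k) (leq_subr _ _); rewrite subKn // => /andP[? ?] ?.
by split; lia.
Qed.

Let v1 k : k <= p + q -> (inord (f k) : 'I_p.+1) = f k :> nat.
Proof. by move=> /lattice_path_bounds[*]; rewrite inordK. Qed.
Let v2 k : k <= p + q -> (inord (k - f k) : 'I_q.+1) = k - f k :> nat.
Proof. by move=> /lattice_path_bounds[*]; rewrite inordK. Qed.

Lemma lattice_path_shuffle : is_shuffle lattice_path.
Proof.
apply/and3P; split.
- by rewrite !ffunE /= f0 !inordK.
- by rewrite !ffunE /= v1 // v2 // f_end addKn !eqxx.
apply/forallP => i; rewrite !ffunE /= -!val_eqE /= /bump leq0n add1n.
have ilt := ltn_ord i; have ile := ltnW ilt; rewrite !v1 ?v2 //.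
have [_ _] := lattice_path_bounds ile; case: (f_step ilt) => -> ?.
  by apply/orP; left; rewrite subSn // !eqxx.
by apply/orP; right; rewrite subSS !eqxx.
Qed.

Definition path_shuffle : shuffle p q := exist _ lattice_path lattice_path_shuffle.

Lemma path_shuffleE m : m <= p + q -> smu path_shuffle m = f m.
Proof.
move=> mpq; rewrite /smu /= ffunE v1; last by rewrite -ltnS ltn_ord.
by rewrite inordK.
Qed.
End LatticePath.

Lemma sorted_shuffle_ex : exists s, forall m, m <= p + q -> smu s m = m - q.
Proof.
have f0 : 0 - q = 0 by [].
have fe : p + q - q = p by rewrite addnK.
have fs k : k < p + q -> k.+1 - q = k - q \/ k.+1 - q = (k - q).+1 by lia.
by exists (path_shuffle (f := subn^~ q) f0 fe fs) => m mpq; rewrite path_shuffleE.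
Qed.

(** The inner sum telescopes: each Y step is weighted by the number of X steps before it, so the
    inversion number is an area. *)
Lemma shuffle_invE s :
  shuffle_inv s = \sum_(j < p + q) smu s j * (snu s j.+1 - snu s j).
Proof.
have e (i : 'I_(p + q)) : (osrc i = inord i) /\ (otgt i = inord i.+1).
  by split; apply/val_inj; rewrite /= inordK // ltnS // ltnW.
have -> : shuffle_inv s = \sum_(i < p + q) \sum_(j < p + q | i < j)
    (smu s i.+1 - smu s i) * (snu s j.+1 - snu s j).
  rewrite /shuffle_inv /smu /snu; case: (val s) => mu nu /=.
  by apply: eq_bigr => i _; apply: eq_bigr => j _; rewrite !(e i).1 !(e i).2 !(e j).1 !(e j).2.
rewrite (exchange_big_dep xpredT) //=; apply: eq_bigr => j _.
rewrite -big_distrl /=; congr muln.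
have jpq := ltnW (ltn_ord j).
rewrite -(big_ord_widen _ (fun i => smu s i.+1 - smu s i) jpq).
rewrite -(big_mkord xpredT (fun i => smu s i.+1 - smu s i)).
rewrite telescope_sumn_in ?smu0 ?subn0 // => i /andP[_ ij].
by case: (smu_step s (leq_trans ij jpq)) => -[->].
Qed.

(** Reflection of the path at time [i], exchanging the two steps that meet there. *)
Definition flip_path s i m :=
  if m == i then smu s i.-1 + smu s i.+1 - smu s i else smu s m.

(** The default [s] is never reached at a corner, where the reflected path is again a lattice
    path. *)
Definition flip s i : shuffle p q := insubd s (lattice_path (flip_path s i)).

Definition corner s i := (0 < i < p + q) && (smu s i.+1 == (smu s i.-1).+1).

Lemma flipE s i m : corner s i -> m <= p + q ->
  smu (flip s i) m = if m == i then smu s i.-1 + smu s i.+1 - smu s i else smu s m.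
Proof.
case/andP=> /andP[i0 ipq] /eqP c mpq.
have iE : i = i.-1.+1 by lia.
have s1 := smu_step s (m := i.-1) (leq_ltn_trans (leq_pred _) ipq).
have s2 := smu_step s ipq; rewrite -iE in s1.
suff [f0 fe fs] : [/\ flip_path s i 0 = 0, flip_path s i (p + q) = p &
    forall k, k < p + q -> flip_path s i k.+1 = flip_path s i k \/
      flip_path s i k.+1 = (flip_path s i k).+1].
  suff -> : flip s i = path_shuffle f0 fe fs by rewrite path_shuffleE.
  by apply/val_inj; rewrite insubdK //; apply: lattice_path_shuffle.
rewrite /flip_path; split=> [|| k kpq].
- by rewrite eq_sym -leqn0 leqNgt i0 smu0.
- by rewrite gtn_eqF ?smu_end.
have sk := smu_step s kpq.
case: (eqVneq k.+1 i) => [ki|_].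
  have -> : (k == i) = false by apply/negbTE; rewrite neq_ltn; lia.
  have -> : k = i.-1 by lia.
  by case: s1 => -[]; case: s2 => -[]; lia.
case: (eqVneq k i) => [ki|_]; last by case: sk => -[->]; [left|right].
by rewrite ki; case: s1 => -[]; case: s2 => -[]; lia.
Qed.

Lemma flip_corner s i : corner s i -> corner (flip s i) i.
Proof.
move=> c; have /andP[/andP[i0 ipq] e] := c.
rewrite /corner i0 ipq !flipE //; last by lia.
have -> : (i.+1 == i) = false by apply/negbTE; lia.
by have -> : (i.-1 == i) = false by apply/negbTE; lia.
Qed.

Lemma flipK s i : corner s i -> flip (flip s i) i = s.
Proof.
move=> c; have /andP[/andP[i0 ipq] /eqP e] := c.
apply: shuffle_eq => m mpq; rewrite flipE ?flip_corner // !flipE ?(ltnW ipq) //; try by lia.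
case: eqVneq => // ->; rewrite eqxx.
have -> : (i.+1 == i) = false by apply/negbTE; lia.
have -> : (i.-1 == i) = false by apply/negbTE; lia.
have iE : i = i.-1.+1 by lia.
have s1 := smu_step s (m := i.-1) (leq_ltn_trans (leq_pred _) ipq).
rewrite -iE in s1; have s2 := smu_step s ipq.
by case: s1 => -[]; case: s2 => -[]; lia.
Qed.

(** In the area formula only the terms at [i.-1] and [i] change, by one in total. *)
Lemma flip_inv s i : corner s i -> odd (shuffle_inv (flip s i)) = ~~ odd (shuffle_inv s).
Proof.
move=> c; have /andP[/andP[i0 ipq] /eqP e] := c.
have iE : i = i.-1.+1 by lia.
have ppq : i.-1 < p + q by lia.
have nE s' m : m <= p + q -> snu s' m = m - smu s' m.
  by move=> mpq; have := smu_snu s' mpq; lia.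
rewrite !shuffle_invE (bigD1 (Ordinal ipq)) //= (bigD1 (Ordinal ppq)) /=; last first.
  by rewrite -val_eqE /= neq_ltn; lia.
rewrite [in RHS](bigD1 (Ordinal ipq)) //= [in RHS](bigD1 (Ordinal ppq)) /=; last first.
  by rewrite -val_eqE /= neq_ltn; lia.
rewrite (eq_bigr (fun j : 'I_(p + q) => smu s j * (snu s j.+1 - snu s j))); last first.
  move=> j; rewrite -!val_eqE /= => /andP[ji ji'].
  have jpq := ltn_ord j; rewrite !nE ?(ltnW jpq) //.
  rewrite !flipE ?(ltnW jpq) //.
  by rewrite (negPf ji) (_ : (j.+1 == i) = false) //; apply/negbTE; lia.
set rest := \sum_(_ | _) _; clearbody rest.
rewrite -iE !nE //; try lia.
rewrite !flipE //; try lia.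
rewrite eqxx.
have -> : (i.+1 == i) = false by apply/negbTE; lia.
have -> : (i.-1 == i) = false by apply/negbTE; lia.
have s1 := smu_step s ppq; rewrite -iE in s1; have s2 := smu_step s ipq.
have u := smu_snu s (ltnW ipq); have u1 := smu_snu s ipq; have u2 := smu_snu s (ltnW ppq).
rewrite !oddD addbA [in RHS]addbA -addNb; congr addb.
rewrite -!oddD.
move: e s1 s2 u u1 u2.
move: (smu s i) (smu s i.-1) (smu s i.+1) (snu s i) (snu s i.-1) (snu s i.+1).
move=> x x1 x2 y y1 y2 e [[s1 s1']|[s1 s1']] [[s2 s2']|[s2 s2']] u u1 u2; try by lia.
have -> : x1 + x2 - x = x1 by lia.
have -> : i.+1 - x2 - (i - x1) = 0 by lia.
have -> : i - x1 - (i.-1 - x1) = 1 by lia.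
have -> : i.+1 - x2 - (i - x) = 1 by lia.
have -> : i - x - (i.-1 - x1) = 0 by lia.
by rewrite !muln1 !muln0 addn0 s1 /= negbK.
Qed.
End ShuffleFunctions.

Section ShuffleTuples.
Variables (R : realType) (G H : hypergraph).
Local Notation P := (cart_prod G H).

Section Fixed.
Variables (p q : nat) (v : p.+1.-tuple G) (w : q.+1.-tuple H).
Let x0 := thead v.
Let y0 := thead w.
Let z0 : P := (x0, y0).
Implicit Types s : shuffle p q.

Lemma stuple_nth s m : (m <= p + q)%N ->
  nth z0 (shuffle_tuple s v w) m = (nth x0 v (smu s m), nth y0 w (snu s m)).
Proof. by move=> mpq; apply: shuffle_tuple_nth. Qed.

Lemma stuple_fst s m : (m <= p + q)%N ->
  nth x0 (unzip1 (shuffle_tuple s v w)) m = nth x0 v (smu s m).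
Proof. by move=> mpq; rewrite (nth_map z0) ?size_tuple // stuple_nth. Qed.

Lemma stuple_snd s m : (m <= p + q)%N ->
  nth y0 (unzip2 (shuffle_tuple s v w)) m = nth y0 w (snu s m).
Proof. by move=> mpq; rewrite (nth_map z0) ?size_tuple // stuple_nth. Qed.

Lemma steps_nth (t : seq P) m : (m.+1 < size t)%N ->
  nth (false, false) (steps t) m = step (nth z0 t m) (nth z0 t m.+1).
Proof.
elim: t m => // a [|b t] IH [|m] // mt; rewrite steps_cons //.
by rewrite [LHS]/= IH.
Qed.

Lemma stuple_no_diag s : stepD \notin steps (shuffle_tuple s v w).
Proof.
apply/negP => /(nthP (false, false))[m]; rewrite size_steps size_tuple => mpq.
rewrite steps_nth ?size_tuple // !stuple_nth //; last exact: ltnW.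
by case: (smu_step s mpq) => -[-> ->]; rewrite /step /= !eqxx.
Qed.

(** The front piece of the second coordinate has no repetition, so the first [q'] steps are Y;
    likewise the back piece of the first coordinate forces the others to be X. *)
Lemma aw_stuple p' q' (l1 l2 : R) s : (p' + q')%N = (p + q)%N ->
  aw p' q' l1 l2 (shuffle_tuple s v w) != 0 ->
  [/\ p' = p, q' = q & forall m, (m <= p + q)%N -> smu s m = (m - q)%N].
Proof.
move=> pq /aw_len[/and3P[/eqP sz1 a1 _] /and3P[/eqP sz2 a2 _] _].
have lo m : (m <= q')%N -> smu s m = 0%N /\ snu s m = m.
  elim: m => [|m IH] mq; first by rewrite smu0 snu0.
  have [mu nu] := IH (ltnW mq).
  have mpq : (m < p + q)%N by lia.
  case: (smu_step s mpq) => -[e1 e2]; rewrite e1 e2 mu nu //.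
  have := a2; rewrite /adj_neq => /(sortedP y0)/(_ m); rewrite sz2 ltnS mq => /(_ isT).
  by rewrite !nth_take ?ltnS // ?stuple_snd // ?e2 ?eqxx // ltnW.
have hi k : (q' + k <= p + q)%N -> smu s (q' + k) = k.
  elim: k => [|k IH] kq; first by rewrite addn0 (lo _ (leqnn q')).1.
  rewrite addnS in kq *; case: (smu_step s kq) => -[e1 e2]; rewrite e1 IH ?(ltnW kq) //.
  have := a1; rewrite /adj_neq => /(sortedP x0)/(_ k); rewrite sz1.
  have -> : (k.+1 < p'.+1)%N by lia.
  move=> /(_ isT); rewrite !nth_drop addnS !stuple_fst ?e1 ?eqxx //.
  exact: ltnW.
have pp : p' = p.
  have := hi p'; rewrite [(q' + p')%N]addnC pq => /(_ (leqnn _)).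
  by rewrite smu_end.
have qq : q' = q by lia.
split=> // m mpq; have [mq|qm] := leqP m q.
  by rewrite (lo m _).1 ?qq //; lia.
have := hi (m - q)%N; have -> : (q' + (m - q))%N = m by lia.
by apply.
Qed.

Lemma aw_sorted_stuple (l1 l2 : R) s :
  (forall m, (m <= p + q)%N -> smu s m = (m - q)%N) ->
  aw p q l1 l2 (shuffle_tuple s v w) = tens (mcs p l1 v) (mcs q l2 w).
Proof.
move=> sE; have sN m : (m <= p + q)%N -> snu s m = minn m q.
  by move=> mpq; have := smu_snu s mpq; rewrite sE //; lia.
have e1 : drop q (unzip1 (shuffle_tuple s v w)) = v.
  apply: (@eq_from_nth _ x0) => [|i]; rewrite size_drop size_map !size_tuple; first by lia.
  move=> ip; rewrite nth_drop stuple_fst; last by lia.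
  by rewrite sE; [congr nth; lia | lia].
have sz : size (take q.+1 (unzip2 (shuffle_tuple s v w))) = q.+1.
  by rewrite size_take size_map size_tuple; case: ltnP; lia.
have e2 : take q.+1 (unzip2 (shuffle_tuple s v w)) = w.
  apply: (@eq_from_nth _ y0) => [|i]; rewrite sz ?size_tuple // => iq.
  rewrite nth_take // stuple_snd; last by lia.
  by rewrite sN; [congr nth; lia | lia].
by rewrite /aw e1 e2.
Qed.

Lemma sorted_shuffle_inv s :
  (forall m, (m <= p + q)%N -> smu s m = (m - q)%N) -> shuffle_inv s = 0%N.
Proof.
move=> sE; rewrite shuffle_invE big1 // => j _; have jpq := ltn_ord j.
have u1 := smu_snu s jpq; have u2 := smu_snu s (ltnW jpq).
rewrite !sE ?(ltnW jpq) // in u1 u2 *.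
have [jq|qj] := leqP q j; last by rewrite (_ : j - q = 0)%N; lia.
by rewrite (_ : snu s j.+1 - snu s j = 0)%N ?muln0; lia.
Qed.

Lemma flip_stuple s i : corner s i ->
  dele i (shuffle_tuple (flip s i) v w) = dele i (shuffle_tuple s v w) :> seq P.
Proof.
move=> c; have /andP[/andP[i0 ipq] _] := c.
have e m : (m <= p + q)%N -> m != i ->
    nth z0 (shuffle_tuple (flip s i) v w) m = nth z0 (shuffle_tuple s v w) m.
  move=> mpq mi; rewrite !stuple_nth // flipE // (negPf mi).
  have u := smu_snu (flip s i) mpq; have u' := smu_snu s mpq.
  rewrite flipE // (negPf mi) in u; congr (_, nth _ _ _); lia.
congr cat.
  apply: (@eq_from_nth _ z0) => [|m]; first by rewrite !size_take !size_tuple.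
  rewrite size_take size_tuple ltnS (ltnW ipq) => mi.
  by rewrite !nth_take // e ?(ltn_eqF mi) //; lia.
apply: (@eq_from_nth _ z0) => [|m]; first by rewrite !size_drop !size_tuple.
rewrite size_drop size_tuple => mi.
by rewrite !nth_drop e //; lia.
Qed.

(** Away from a corner a face of full length merges two steps in the same direction, and a shuffle
    has no diagonal step of its own. *)
Lemma not_corner_diag n (l : R) s i : mseq n.+1 l (shuffle_tuple s v w) ->
  (i < n.+2)%N -> mseq n l (dele i (shuffle_tuple s v w)) -> ~~ corner s i ->
  cls false (steps (dele i (shuffle_tuple s v w))) <> 1%N.
Proof.
move=> tm iN fm nc c1.
have [t1 [a [b [c [t2 [tE iE fE st]]]]]] := valid_face tm iN fm.
have sz : (p + q).+1 = n.+2.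
  by have /and3P[/eqP] := tm; rewrite size_tuple.
have ipq : (i < p + q)%N.
  have := size_tuple (shuffle_tuple s v w); rewrite tE size_cat /= iE => sz'.
  by move: (size t1) (size t2) sz' => m1 m2 ?; lia.
have iP : i = i.-1.+1 by rewrite iE.
have ip : (i.-1 < p + q)%N by lia.
have w1 := smu_step s ip; have w2 := smu_step s ipq; rewrite -iP in w1.
have na : a = nth z0 (shuffle_tuple s v w) i.-1.
  by rewrite tE iE /= nth_cat ltnn subnn.
have nb : b = nth z0 (shuffle_tuple s v w) i.
  by rewrite tE iE /= nth_cat ltnNge leqnSn /= subSnn.
have nc' : c = nth z0 (shuffle_tuple s v w) i.+1.
  by rewrite tE iE /= nth_cat ltnNge -addn2 leq_addr /= addKn.
have stD : step a c != stepD.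
  rewrite na nc' !stuple_nth ?(ltnW ip) //.
  have /eqP : smu s i.+1 != (smu s i.-1).+1.
    by move: nc; rewrite /corner ipq iE.
  rewrite /step; case: w1 => -[e1 e2]; case: w2 => -[e3 e4];
    by rewrite e3 e4 e1 e2 ?eqxx // => _; rewrite !xpair_eqE ?andbF.
have := stuple_no_diag s; rewrite tE steps_cat3 mem_cat !inE !negb_or => /and4P[h1 h2 h3 h4].
have [u1 [u2 [uE _]]] := cls1P c1.
have : stepD \in steps (dele i (shuffle_tuple s v w)) by rewrite uE mem_cat inE eqxx orbT.
by rewrite fE steps_cat2 mem_cat inE (negPf h1) (negPf h4) orbF /= eq_sym (negPf stD).
Qed.

(* [flip] is a sign-reversing involution on the faces at a corner; the other
   faces never contain a diagonal step. *)
Lemma stuple_diag_cancel n (l : R) (tau : mgen P n l) : (p + q)%N = n.+1 ->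
  (forall s, mseq n.+1 l (shuffle_tuple s v w)) -> cls false (steps tau) = 1%N ->
  \sum_(s : shuffle p q) \sum_(i < n.+2)
    ((dele i (shuffle_tuple s v w) == tau :> seq P)%:R : int) *~
       (-1) ^+ i *~ (-1) ^+ shuffle_inv s = 0.
Proof.
move=> pqn tm t1; rewrite pair_bigA /=.
pose F (u : shuffle p q * 'I_n.+2) : int :=
  (dele u.2 (shuffle_tuple u.1 v w) == tau :> seq P)%:R *~ (-1) ^+ u.2 *~
    (-1) ^+ shuffle_inv u.1.
(* Pairs away from a corner are fixed, but their terms vanish by [not_corner_diag]; so the sum is
   its own opposite. *)
pose h (u : shuffle p q * 'I_n.+2) := if corner u.1 u.2 then (flip u.1 u.2, u.2) else u.
have hK : involutive h.
  move=> [s i]; rewrite /h /=; case cE: (corner s i); last by rewrite /= cE.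
  by rewrite /= flip_corner // flipK.
have Fh u : F (h u) = - F u.
  case: u => s i; rewrite /h /F /=; case: ifP => [c|/negbT nc] /=.
    rewrite flip_stuple // -!mulrzA -mulrNz; congr (_ *~ _).
    by rewrite -mulrN -(signr_odd _ (shuffle_inv (flip s i))) flip_inv // signrN signr_odd.
  case: eqP => [e|_]; last by rewrite !mul0rz oppr0.
  by case: (@not_corner_diag n l s i (tm s) (ltn_ord i) _ nc); rewrite e ?mseq_gen.
have SN : \sum_u F u = - \sum_u F u.
  by rewrite {1}(reindex_inj (inv_inj hK)) -sumrN; apply: eq_bigr => u _; apply: Fh.
rewrite -/(\sum_u F u); move: SN; move: (\sum_u F u) => z; lia.
Qed.
End Fixed.
End ShuffleTuples.

Section Exterior.
Variables (R : realType) (G H : hypergraph).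
Local Notation P := (cart_prod G H).
Implicit Types (p q n : nat) (l : R).

Definition mc_cast (K : hypergraph) k l k' l' : {additive mc_group K k l -> mc_group K k' l'} :=
  free_lift (fun g : mgen K k l => mcs k' l' g).

Lemma mc_cast_mcs (K : hypergraph) k l k' l' (s : seq K) : k = k' -> l = l' ->
  mc_cast K k l k' l' (mcs k l s) = mcs k' l' s.
Proof.
move=> <- <-; have [/mseqP[g ->]|ns] := boolP (mseq k l s).
  by rewrite mcs_gen /mc_cast free_lift_gen mcs_gen.
by rewrite mcs0 // raddf0.
Qed.

Lemma mc_cast_id (K : hypergraph) k l (x : mc_group K k l) : mc_cast K k l k l x = x.
Proof.
apply: (free_ext (f := mc_cast K k l k l) (g := idfun)) => g.
by rewrite /mc_cast free_lift_gen mcs_gen.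
Qed.

(* The exterior product with its target degrees as free parameters, to be used
   when [p + q = n] and [l1 + l2 = l]; this avoids casts along equations. *)
Definition extn p q l1 l2 n l :
    {additive tensor (mc_group G p l1) (mc_group H q l2) -> mc_group P n l} :=
  mc_cast P (p + q) (l1 + l2) n l \o ext_prod G H p q l1 l2.

Lemma extn_ext_prod p q l1 l2 x :
  extn p q l1 l2 (p + q) (l1 + l2) x = ext_prod G H p q l1 l2 x.
Proof. exact: mc_cast_id. Qed.

Lemma extn_gen p q l1 l2 n l (v : mgen G p l1) (w : mgen H q l2) :
  (p + q)%N = n -> l1 + l2 = l ->
  extn p q l1 l2 n l (tens (fgen v) (fgen w)) =
  \sum_(s : shuffle p q) mcs n l (shuffle_tuple s v w) *~ (-1) ^+ shuffle_inv s.
Proof.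
move=> pq ll; rewrite -[LHS]/(mc_cast P _ _ n l (ext_prod G H p q l1 l2 (tens (fgen v) (fgen w)))).
rewrite /ext_prod tens_liftE /ext_fun !free_lift_gen /ext_gen raddf_sum.
apply: eq_bigr => s _; rewrite raddfMz; congr (_ *~ _).
rewrite -mcs_gen; exact: mc_cast_mcs.
Qed.

Lemma stuple_mseq p q l1 l2 n l (v : mgen G p l1) (w : mgen H q l2) (s : shuffle p q) :
  (p + q)%N = n -> l1 + l2 = l -> mseq n l (shuffle_tuple s v w).
Proof.
move=> <- <-; have /andP[an ln] := shuffle_is_mgen s v w.
by rewrite /mseq size_tuple eqxx an ln.
Qed.

Lemma tens_free_ext (X Y : choiceType) (M : zmodType)
    (f g : {additive tensor (free_ab X) (free_ab Y) -> M}) :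
  (forall a b, f (tens (fgen a) (fgen b)) = g (tens (fgen a) (fgen b))) -> f =1 g.
Proof.
move=> fg; apply: tens_ext => x y.
apply: (free_ext (f := f \o tensl (free_ab X) y) (g := g \o tensl (free_ab X) y)) => a.
exact: (free_ext (f := f \o tensr (free_ab Y) (fgen a))
  (g := g \o tensr (free_ab Y) (fgen a)) (fg a) y).
Qed.

(** By [aw_stuple] only the shuffle Y...YX...X is seen, and it has no inversion. *)
Lemma awm_extn p q l1 l2 n l (x : tensor (mc_group G p l1) (mc_group H q l2)) :
  (p + q)%N = n -> l1 + l2 = l ->
  awm G H p q l1 l2 n l (extn p q l1 l2 n l x) = x.
Proof.
move=> pq ll.
apply: (tens_free_ext (f := awm G H p q l1 l2 n l \o extn p q l1 l2 n l) (g := idfun)) => v w.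
rewrite -[LHS]/(awm G H p q l1 l2 n l (extn p q l1 l2 n l (tens (fgen v) (fgen w)))).
rewrite extn_gen // raddf_sum.
have awE s : awm G H p q l1 l2 n l (mcs n l (shuffle_tuple s v w)) =
    aw p q l1 l2 (shuffle_tuple s v w).
  have [g gE] := mseqP _ _ _ (stuple_mseq v w s pq ll).
  by rewrite gE mcs_gen /awm free_lift_gen.
have [s0 s0E] := sorted_shuffle_ex p q.
rewrite (bigD1 s0) // big1 ?addr0 => [|s ss]; last first.
  rewrite raddfMz awE; have [->|nz] := eqVneq (aw p q l1 l2 (shuffle_tuple s v w)) 0.
    by rewrite mul0rz.
  have [_ _ sE] := aw_stuple erefl nz.
  by case/eqP: ss; apply: shuffle_eq => m mpq; rewrite sE // s0E.
rewrite raddfMz awE aw_sorted_stuple // sorted_shuffle_inv // 2!mcs_gen expr0.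
exact: addr0.
Qed.

(** Other degrees are excluded by [aw_stuple], other lengths because [v] has length [l1]. *)
Lemma awm_extn0 p q l1 l2 p' q' l1' l2' n l
    (x : tensor (mc_group G p l1) (mc_group H q l2)) :
  (p + q)%N = n -> l1 + l2 = l -> (p' + q')%N = n -> l1' + l2' = l ->
  (p', l1') != (p, l1) -> awm G H p' q' l1' l2' n l (extn p q l1 l2 n l x) = 0.
Proof.
move=> pq ll pq' ll' ne.
apply: (tens_free_ext (f := awm G H p' q' l1' l2' n l \o extn p q l1 l2 n l)
  (g := zero_map _ _)) => v w.
rewrite -[LHS]/(awm G H p' q' l1' l2' n l (extn p q l1 l2 n l (tens (fgen v) (fgen w)))).
rewrite -[RHS]/0 extn_gen // raddf_sum big1 // => s _.
have [g gE] := mseqP _ _ _ (stuple_mseq v w s pq ll).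
rewrite raddfMz gE mcs_gen /awm free_lift_gen -gE.
have [->|nz] := eqVneq (aw p' q' l1' l2' (shuffle_tuple s v w)) 0; first by rewrite mul0rz.
have [pp qq sE] := aw_stuple (etrans pq' (esym pq)) nz.
subst p' q'; rewrite aw_sorted_stuple // in nz.
have /and3P[_ _ /eqP lv] := mseq_gen v.
have [/and3P[_ _ /eqP lv']|/mcs0 v0] := boolP (mseq p l1' v); last first.
  by rewrite v0 tens0l eqxx in nz.
have e : l1' = l1 by apply: EFin_inj; rewrite -lv -lv'.
by rewrite e eqxx in ne.
Qed.

Lemma stuple_mcs_no_diag p q n l (v : p.+1.-tuple G) (w : q.+1.-tuple H) (s : shuffle p q) :
  no_diag (mcs n l (shuffle_tuple s v w)).
Proof.
apply: no_diag_mcs => _ c1; have := stuple_no_diag v w s.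
by have [w1 [w2 [-> _]]] := cls1P c1; rewrite mem_cat inE eqxx orbT.
Qed.

Lemma no_diagMz n l (c : mc_group P n l) z : no_diag c -> no_diag (c *~ z).
Proof.
move=> hc g g1; have -> : mcoeff g (c *~ z) = mcoeff g c *~ z := raddfMz (mcoeff g) z c.
by rewrite hc // mul0rz.
Qed.

Lemma no_diagD n l (c d : mc_group P n l) : no_diag c -> no_diag d -> no_diag (c + d).
Proof. by move=> hc hd g g1; rewrite mcoeffD hc // hd // addr0. Qed.

Lemma no_diag_sum n l (I : Type) (r : seq I) (Q : pred I) (F : I -> mc_group P n l) :
  (forall i, no_diag (F i)) -> no_diag (\sum_(i <- r | Q i) F i).
Proof.
by move=> h; elim/big_ind: _ => //; [exact: no_diag0 | exact: no_diagD].
Qed.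

Lemma extn_no_diag p q l1 l2 n l x : no_diag (extn p q l1 l2 n l x).
Proof.
move: x; apply: tens_ind => [|x y|x y]; first by rewrite raddf0; apply: no_diag0.
  rewrite (free_expand x) (free_expand y) tens_suml raddf_sum; apply: no_diag_sum => v.
  rewrite tens_sumr raddf_sum; apply: no_diag_sum => w.
  rewrite tensMzl tensMzr !raddfMz; do 2 apply: no_diagMz.
  rewrite -[extn _ _ _ _ _ _ _]/(mc_cast P _ _ n l (ext_prod G H p q l1 l2 (tens (fgen v) (fgen w)))).
  rewrite /ext_prod tens_liftE /ext_fun !free_lift_gen /ext_gen raddf_sum.
  apply: no_diag_sum => s; rewrite raddfMz; apply: no_diagMz.
  rewrite /mc_cast free_lift_gen; exact: stuple_mcs_no_diag.
by rewrite raddfD; apply: no_diagD.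
Qed.

Lemma extn_bd_no_diag p q l1 l2 n l (v : mgen G p l1) (w : mgen H q l2) :
  (p + q)%N = n.+1 -> l1 + l2 = l ->
  no_diag (mc_bd P n l (extn p q l1 l2 n.+1 l (tens (fgen v) (fgen w)))).
Proof.
move=> pq ll tau t1; rewrite extn_gen // (raddf_sum (mc_bd P n l)) (raddf_sum (mcoeff tau)).
rewrite -[RHS](stuple_diag_cancel pq (fun s => stuple_mseq v w s pq ll) t1).
apply: eq_bigr => s _; rewrite raddfMz (raddfMz (mcoeff tau)).
have [g gE] := mseqP _ _ _ (stuple_mseq v w s pq ll).
rewrite gE mcs_gen mc_bd_gen (raddf_sum (mcoeff tau)) -mulrz_suml; congr (_ *~ _).
by apply: eq_bigr => i _; rewrite (raddfMz (mcoeff tau)) -mcoeff_mcs.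
Qed.
End Exterior.

Lemma bd_out_bd (C : chain_complex) n (z : C n.+1) : bd_out C n (bd C n z) = 0.
Proof. by case: n z => // n z; apply: bd_bd. Qed.

Lemma bd_out_out (C : chain_complex) n (z : C n) : bd_out C n.-1 (bd_out C n z) = 0.
Proof. by case: n z => [|n] z //; apply: bd_out_bd. Qed.

Section ExteriorBoundary.
Variables (R : realType) (G H : hypergraph).
Local Notation P := (cart_prod G H).
Implicit Types (p q n : nat) (l : R).
Local Notation bdl p l1 := (bd_out (magnitude_complex G l1) p).
Local Notation bdr q l2 := (bd_out (magnitude_complex H l2) q).

(** The truncated predecessors are harmless: [bd_out] is zero in degree 0. *)
Definition ext_bd_rhs p q l1 l2 n l
    (t : tensor (mc_group G p l1) (mc_group H q l2)) : mc_group P n.-1 l :=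
  extn G H p.-1 q l1 l2 n.-1 l (tens_map (bdl p l1) idfun t) *~ (-1) ^+ q +
  extn G H p q.-1 l1 l2 n.-1 l (tens_map idfun (bdr q l2) t).

Lemma ext_bd_rhs_zmod p q l1 l2 n l : zmod_morphism (@ext_bd_rhs p q l1 l2 n l).
Proof. by move=> x y; rewrite /ext_bd_rhs !raddfB mulrzBl opprD addrACA. Qed.

(* The two sides have the same Alexander-Whitney images, and by induction their
   difference is a cycle, so that [no_diag_eq0] applies. *)
Lemma extn_bd p q l1 l2 n l (t : tensor (mc_group G p l1) (mc_group H q l2)) :
  (p + q)%N = n -> l1 + l2 = l ->
  bd_out (magnitude_complex P l) n (extn G H p q l1 l2 n l t) = ext_bd_rhs n l t.
Proof.
move=> pq ll; elim: n p q pq t => [|m IH] p q pq t.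
  have [p0 q0] : p = 0%N /\ q = 0%N by lia.
  subst p q; rewrite /ext_bd_rhs [bd_out _ 0 _]/=.
  rewrite tens_map0l // tens_map0r // !raddf0 mul0rz addr0 //.
apply: (tens_free_ext (f := bd_out (magnitude_complex P l) m.+1 \o extn G H p q l1 l2 m.+1 l)
  (g := additive_of (@ext_bd_rhs_zmod p q l1 l2 m.+1 l))) => v w.
rewrite -[LHS]/(mc_bd P m l (extn G H p q l1 l2 m.+1 l (tens (fgen v) (fgen w)))).
rewrite -[RHS]/(ext_bd_rhs m.+1 l (tens (fgen v) (fgen w))).
set u : tensor (mc_group G p l1) (mc_group H q l2) := tens (fgen v) (fgen w).
pose A := tens_map (bdl p l1) idfun u.
pose B := tens_map (idfun : {additive mc_group G p l1 -> _}) (bdr q l2) u.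
pose C := tens_map (bdl p l1) (bdr q l2) u.
have A0 : p = 0%N -> A = 0 by move=> p0; rewrite /A tens_map0l //; subst p.
have B0 : q = 0%N -> B = 0 by move=> q0; rewrite /B tens_map0r //; subst q.
have C0 : q = 0%N -> C = 0 by move=> q0; rewrite /C tens_map0r //; subst q.
have C0' : p = 0%N -> C = 0 by move=> p0; rewrite /C tens_map0l //; subst p.
rewrite -[RHS]/(extn G H p.-1 q l1 l2 m l A *~ (-1) ^+ q + extn G H p q.-1 l1 l2 m l B).
apply/eqP; rewrite -subr_eq0; apply/eqP; apply: (@no_diag_eq0 R G H m l).
- move=> p' q' l1' l2' pq' ll'; rewrite raddfB awm_bd // raddfD raddfMz.
  apply/eqP; rewrite subr_eq0; apply/eqP; congr (_ + _).
    have [e|ne] := eqVneq (p'.+1, l1') (p, l1).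
      case: e => e1 e2; have e3 : q' = q by lia.
      have e4 : l2' = l2 by apply: (addrI l1); rewrite ll -{1}e2.
      subst p l1' q' l2'; rewrite awm_extn // ?addSn ?pq' //.
      by rewrite [X in _ = X *~ _]awm_extn.
    rewrite [awm _ _ p'.+1 _ _ _ _ _ _]awm_extn0 // ?addSn ?pq' // raddf0.
    case: (posnP p) => [/A0 ->|p0]; first by rewrite !raddf0 !mul0rz.
    rewrite awm_extn0 ?raddf0 ?mul0rz //; first by lia.
    by apply: contra_neq ne => -[-> ->]; rewrite prednK.
  have [e|ne] := eqVneq (p', l1') (p, l1).
    case: e => e1 e2; have e3 : q'.+1 = q by lia.
    have e4 : l2' = l2 by apply: (addrI l1); rewrite ll -{1}e2.
    subst p' l1' q l2'; rewrite awm_extn //.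
    by rewrite [RHS]awm_extn.
  rewrite [awm _ _ _ q'.+1 _ _ _ _ _]awm_extn0 // ?addnS ?pq' // raddf0.
  case: (posnP q) => [/B0 ->|q0]; first by rewrite !raddf0.
  by rewrite awm_extn0 ?raddf0 //; lia.
- apply: no_diagB; first exact: extn_bd_no_diag.
  by apply: no_diagD; [apply: no_diagMz|]; apply: extn_no_diag.
(* By induction both terms of the right-hand side have their boundary in [C], with signs that
   cancel. *)
have EA : bd_out (magnitude_complex P l) m (extn G H p.-1 q l1 l2 m l A) =
    extn G H p.-1 q.-1 l1 l2 m.-1 l C.
  case: (posnP p) => [p0|p0]; first by rewrite (A0 p0) (C0' p0) !raddf0.
  rewrite IH; last by lia.
  have AC : tens_map idfun (bdr q l2) A = C.
    by rewrite /A tens_map_comp; apply: tens_map_eq.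
  have AA : tens_map (bdl p.-1 l1) idfun A = 0.
    by rewrite /A tens_map_comp tens_map0l // => a; apply: bd_out_out.
  by rewrite /ext_bd_rhs AC AA raddf0 mul0rz add0r.
have EB : bd_out (magnitude_complex P l) m (extn G H p q.-1 l1 l2 m l B) =
    extn G H p.-1 q.-1 l1 l2 m.-1 l C *~ (-1) ^+ q.-1.
  case: (posnP q) => [q0|q0]; first by rewrite (B0 q0) (C0 q0) !raddf0 mul0rz.
  rewrite IH; last by lia.
  have BC : tens_map (bdl p l1) idfun B = C.
    by rewrite /B tens_map_comp; apply: tens_map_eq.
  have BB : tens_map idfun (bdr q.-1 l2) B = 0.
    by rewrite /B tens_map_comp tens_map0r // => a; apply: bd_out_out.
  by rewrite /ext_bd_rhs BC BB raddf0 addr0.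
suff h : bd_out (magnitude_complex P l) m
    (extn G H p.-1 q l1 l2 m l A *~ (-1) ^+ q + extn G H p q.-1 l1 l2 m l B) = 0.
  rewrite raddfB h subr0 [bd_out _ _ _]bd_out_bd; exact: no_diag0.
rewrite raddfD raddfMz EA EB; case: (posnP q) => [/C0 ->|q0].
  by rewrite raddf0 !mul0rz addr0.
have -> : (-1) ^+ q = - ((-1) ^+ q.-1) :> int by rewrite -{1}(prednK q0) exprS mulN1r.
by rewrite mulrNz addNr.
Qed.
End ExteriorBoundary.

(** * Naturality of the chain maps *)

(** For the lengths of two pieces: in the last two cases a piece is too short for its degree, so its
    tensor and the image of that tensor vanish. *)
Lemma ereal_sum_split (R : realType) (a b : \bar R) (x y : R) : (0 <= a)%E -> (0 <= b)%E ->
  (a + b <= (x + y)%:E)%E ->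
  [\/ (a <= x%:E)%E /\ (b <= y%:E)%E, (a < x%:E)%E | (b < y%:E)%E].
Proof.
case: a b => [a| |] // [b| |] // _ _; rewrite -EFinD !lee_fin !lte_fin => h.
have [ax|xa] := ltP a x; first by constructor 2.
have [b_y|yb] := ltP b y; first by constructor 3.
by constructor 1; split; lra.
Qed.

Lemma ereal_sum_eq (R : realType) (a b : \bar R) (x y : R) : (0 <= a)%E -> (0 <= b)%E ->
  (a <= x%:E)%E -> (b <= y%:E)%E -> (a + b = (x + y)%:E)%E -> a = x%:E /\ b = y%:E.
Proof.
case: a b => [a| |] // [b| |] // _ _; rewrite -EFinD !lee_fin => h1 h2 [h].
by split; congr _%:E; lra.
Qed.

Section MapSeq.
Variables (R : realType) (K K' : hypergraph) (f : hmorphism K K').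
Local Notation len := (tuple_len R).
Implicit Types (s : seq K) (l : R).

Lemma adj_neq_of_map s : adj_neq (map f s) -> adj_neq s.
Proof.
rewrite /adj_neq sorted_map; apply: sub_sorted => x y /=.
by apply: contra_neq => ->.
Qed.

Lemma mseq_of_map k l s : (len s <= l%:E)%E -> mseq k l (map f s) -> mseq k l s.
Proof.
move=> sl /and3P[sz an /eqP ln]; rewrite /mseq -(size_map f) sz adj_neq_of_map //=.
by rewrite eq_le sl -ln tuple_len_map.
Qed.

Lemma mseq_map k l s : mseq k l s -> (l%:E <= len (map f s))%E -> mseq k l (map f s).
Proof.
move=> /and3P[sz an /eqP ln] fl.
have e : len (map f s) = len s by apply/eqP; rewrite eq_le tuple_len_map ln fl.
by rewrite /mseq size_map sz e ln eqxx andbT (adj_neq_map an e) // ln.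
Qed.

Lemma mcs_len k l (s : seq K') : (len s < l%:E)%E -> mcs k l s = 0.
Proof. by move=> ls; rewrite mcs0 //; apply/negP => /and3P[_ _ /eqP e]; rewrite e ltxx in ls. Qed.

Lemma mc_map_mcs k l s : (len s <= l%:E)%E ->
  mc_map_fun f k l (mcs k l s) = mcs k l (map f s).
Proof.
move=> sl; have [/mseqP[g ->]|ns] := boolP (mseq k l s).
  by rewrite mcs_gen /mc_map_fun free_lift_gen -mcs_tuple.
rewrite mcs0 // raddf0 mcs0 //; apply: contra ns; exact: mseq_of_map.
Qed.
End MapSeq.

Section Naturality.
Variables (R : realType) (G G' H H' : hypergraph).
Variables (f : hmorphism G G') (g : hmorphism H H').
Local Notation P := (cart_prod G H).
Local Notation P' := (cart_prod G' H').
Local Notation len := (tuple_len R).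
Implicit Types (l : R).

Lemma tens_map_mcs p q l1 l2 (xs : seq G) (ys : seq H) :
  (len xs + len ys <= (l1 + l2)%:E)%E ->
  tens_map (mc_map_fun f p l1) (mc_map_fun g q l2) (tens (mcs p l1 xs) (mcs q l2 ys)) =
  tens (mcs p l1 (map f xs)) (mcs q l2 (map g ys)).
Proof.
move=> ln; rewrite tens_mapE.
have [[lx ly]|lx|ly] := ereal_sum_split (tuple_len_ge0 R xs) (tuple_len_ge0 R ys) ln.
- by rewrite !mc_map_mcs.
- have lx' := le_lt_trans (tuple_len_map R f xs) lx.
  by rewrite (mc_map_mcs f p (ltW lx)) (mcs_len p lx') !tens0l.
- have ly' := le_lt_trans (tuple_len_map R g ys) ly.
  by rewrite (mc_map_mcs g q (ltW ly)) (mcs_len q ly') !tens0r.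
Qed.

Lemma unzip1_cart_map (t : seq P) : unzip1 (map (cart_map f g) t) = map f (unzip1 t).
Proof. by rewrite /unzip1 -!map_comp. Qed.

Lemma unzip2_cart_map (t : seq P) : unzip2 (map (cart_map f g) t) = map g (unzip2 t).
Proof. by rewrite /unzip2 -!map_comp. Qed.

Lemma awm_natural p q l1 l2 n l (c : mc_group P n l) : l1 + l2 = l ->
  awm G' H' p q l1 l2 n l (mc_map_fun (cart_map f g) n l c) =
  tens_map (mc_map_fun f p l1) (mc_map_fun g q l2) (awm G H p q l1 l2 n l c).
Proof.
move=> ll.
apply: (free_ext (f := awm G' H' p q l1 l2 n l \o mc_map_fun (cart_map f g) n l)
  (g := tens_map (mc_map_fun f p l1) (mc_map_fun g q l2) \o awm G H p q l1 l2 n l)) => t.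
rewrite -[LHS]/(awm G' H' p q l1 l2 n l (mc_map_fun (cart_map f g) n l (fgen t))).
rewrite -[RHS]/(tens_map (mc_map_fun f p l1) (mc_map_fun g q l2) (awm G H p q l1 l2 n l (fgen t))).
have tm := mseq_gen t; have /and3P[_ _ /eqP lt] := tm.
rewrite -mcs_gen mc_map_mcs ?lt // mcs_gen /awm free_lift_gen /aw tens_map_mcs; last first.
  by rewrite ll -lt tuple_len_cart leeD ?tuple_len_drop ?tuple_len_take.
rewrite (map_drop _ f) (map_take _ g) -unzip1_cart_map -unzip2_cart_map -/(aw p q l1 l2 _).
have [/mseqP[t' ->]|nm] := boolP (mseq n l (map (cart_map f g) t)).
  by rewrite (mcs_gen t') free_lift_gen.
rewrite (mcs0 nm) raddf0; apply/eqP; rewrite eq_sym; apply: contraNT nm => /aw_len[_ _].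
by rewrite ll; apply: mseq_map.
Qed.

Lemma map_stuple p q (s : shuffle p q) (v : p.+1.-tuple G) (w : q.+1.-tuple H) :
  map (cart_map f g) (shuffle_tuple s v w) =
  shuffle_tuple s (map_tuple f v) (map_tuple g w) :> seq P'.
Proof.
rewrite /shuffle_tuple; case: (val s) => mu nu; rewrite -map_comp; apply: eq_map => i.
by rewrite !tnth_map.
Qed.

(** Maps do not increase lengths and the length of a shuffle is the sum of those of its factors; so
    its image keeps length [l] only if both factors keep theirs. *)
Lemma extn_natural p q l1 l2 n l (x : tensor (mc_group G p l1) (mc_group H q l2)) :
  (p + q)%N = n -> l1 + l2 = l ->
  mc_map_fun (cart_map f g) n l (extn G H p q l1 l2 n l x) =
  extn G' H' p q l1 l2 n l (tens_map (mc_map_fun f p l1) (mc_map_fun g q l2) x).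
Proof.
move=> pq ll.
apply: (tens_free_ext (f := mc_map_fun (cart_map f g) n l \o extn G H p q l1 l2 n l)
  (g := extn G' H' p q l1 l2 n l \o tens_map (mc_map_fun f p l1) (mc_map_fun g q l2))) => v w.
rewrite -[LHS]/(mc_map_fun (cart_map f g) n l (extn G H p q l1 l2 n l (tens (fgen v) (fgen w)))).
rewrite -[RHS]/(extn G' H' p q l1 l2 n l
  (tens_map (mc_map_fun f p l1) (mc_map_fun g q l2) (tens (fgen v) (fgen w)))).
have vm := mseq_gen v; have wm := mseq_gen w.
have /and3P[_ _ /eqP lv] := vm; have /and3P[_ _ /eqP lw] := wm.
rewrite extn_gen // raddf_sum tens_mapE -!mcs_gen !mc_map_mcs ?lv ?lw //.
have mE s : mc_map_fun (cart_map f g) n l (mcs n l (shuffle_tuple s v w)) =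
    mcs n l (shuffle_tuple s (map_tuple f v) (map_tuple g w)).
  rewrite mc_map_mcs ?map_stuple //.
  by have /and3P[_ _ /eqP ->] := stuple_mseq v w s pq ll.
have lS s : len (shuffle_tuple s (map_tuple f v) (map_tuple g w)) =
  (len (map f v) + len (map g w))%E by rewrite shuffle_tuple_len.
have fv := tuple_len_map R f v; have gw := tuple_len_map R g w.
have [/mseqP[v' vE]|nv] := boolP (mseq p l1 (map f v)); last first.
  rewrite mcs0 // tens0l raddf0 big1 // => s _; rewrite raddfMz mE mcs0 ?mul0rz //.
  apply: contra nv => /and3P[_ _ /eqP]; rewrite lS -ll => e; apply: mseq_map => //.
  rewrite lv in fv; rewrite lw in gw.
  by have [-> _] := ereal_sum_eq (tuple_len_ge0 R _) (tuple_len_ge0 R _) fv gw e.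
have [/mseqP[w' wE]|nw] := boolP (mseq q l2 (map g w)); last first.
  rewrite [mcs q _ _]mcs0 // tens0r raddf0 big1 // => s _; rewrite raddfMz mE mcs0 ?mul0rz //.
  apply: contra nw => /and3P[_ _ /eqP]; rewrite lS -ll => e; apply: mseq_map => //.
  rewrite lv in fv; rewrite lw in gw.
  by have [_ ->] := ereal_sum_eq (tuple_len_ge0 R _) (tuple_len_ge0 R _) fv gw e.
have ev : map_tuple f v = v' by apply/val_inj; rewrite /= vE.
have ew : map_tuple g w = w' by apply/val_inj; rewrite /= wE.
rewrite vE wE 2!mcs_gen extn_gen //; apply: eq_bigr => s _.
by rewrite raddfMz mE ev ew.
Qed.
End Naturality.

(** * The short exact sequence *)

Lemma hclass0 (C : chain_complex) n (z : cycles C n) :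
  hclass C n z = 0 -> exists e : C n.+1, bd C n e = kval z.
Proof. by move/quot_pi_eq0 => /asboolP. Qed.

Lemma hclass_bd (C : chain_complex) n (z : cycles C n) e :
  bd C n e = kval z -> hclass C n z = 0.
Proof. by move=> ez; apply/quot_pi_eq0/asboolP; exists e. Qed.

Lemma hclass_surj (C : chain_complex) n (h : homology C n) :
  exists z : cycles C n, hclass C n z = h.
Proof. by exists (repr h); apply: reprK. Qed.

Section ToKernel.
Variables (A B Z : zmodType) (f : {additive A -> B}) (m : {additive Z -> A}).
Hypothesis fm : forall z, f (m z) = 0.

Lemma to_kernel_subproof z : m z \in in_kernel f.
Proof. by rewrite unfold_in; apply/eqP. Qed.
Definition to_kernel_fun z : kernel f := Kernel (to_kernel_subproof z).
Lemma to_kernel_zmod : zmod_morphism to_kernel_fun.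
Proof. by move=> x y; apply/val_inj; rewrite /= raddfB. Qed.
Definition to_kernel : {additive Z -> kernel f} := additive_of to_kernel_zmod.
End ToKernel.

(** * Chains compared with the free resolution of homology *)

Section Resolution.
Variables (R : realType) (K : hypergraph) (l : R).
Local Notation C := (magnitude_complex K l).
Implicit Types p : nat.

(* Since the cycles are a direct summand of the chains, the class map extends to
   a map [psi] defined on all chains; [kappa] and [lambda] compare the chains
   with the two-term free resolution of the homology. *)
Definition ret p : {additive mc_group K p l -> mc_group K p l} :=
  sval (cid (kernel_retract (bd_out C p : {additive mc_group K p l -> mc_group K p.-1 l}))).

Lemma bd_ret p x : bd_out C p (ret p x) = 0.
Proof. exact: (svalP (cid (kernel_retract _))).1. Qed.

Lemma ret_cycle p x : bd_out C p x = 0 -> ret p x = x.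
Proof. exact: (svalP (cid (kernel_retract _))).2. Qed.

Lemma ret_bd p x : ret p (bd C p x) = bd C p x.
Proof. exact/ret_cycle/bd_out_bd. Qed.

Lemma ret_ret p x : ret p (ret p x) = ret p x.
Proof. exact/ret_cycle/bd_ret. Qed.

Lemma coret_zmod p : zmod_morphism (fun x => x - ret p x).
Proof. by move=> x y; rewrite raddfB !opprD !opprK addrACA. Qed.
Definition coret p : {additive mc_group K p l -> mc_group K p l} :=
  additive_of (@coret_zmod p).
Lemma coretE p x : coret p x = x - ret p x. Proof. by []. Qed.

Lemma coret_cycle p x : bd_out C p x = 0 -> coret p x = 0.
Proof. by move=> xc; rewrite coretE ret_cycle // subrr. Qed.

Lemma coret_bd p x : coret p (bd C p x) = 0.
Proof. exact/coret_cycle/bd_out_bd. Qed.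

Lemma ret_coret p x : ret p (coret p x) = 0.
Proof. by rewrite coretE raddfB ret_ret subrr. Qed.

Lemma bd_coret p x : bd_out C p (coret p x) = bd_out C p x.
Proof. by rewrite coretE raddfB bd_ret subr0. Qed.

Lemma coret_coret p x : coret p (coret p x) = coret p x.
Proof. by rewrite [LHS]coretE ret_coret subr0. Qed.

Lemma ret_coret_split p x : x = ret p x + coret p x.
Proof. by rewrite coretE addrC subrK. Qed.

Definition to_cycle p : {additive mc_group K p l -> cycles C p} := to_kernel (@bd_ret p).
Lemma to_cycleE p x : kval (to_cycle p x) = ret p x. Proof. by []. Qed.

Definition psi p : {additive mc_group K p l -> homology C p} := hclass C p \o to_cycle p.
Lemma psiE p x : psi p x = hclass C p (to_cycle p x). Proof. by []. Qed.

Lemma psi_cycle p (z : cycles C p) : psi p (kval z) = hclass C p z.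
Proof.
by rewrite psiE; congr (hclass C p _); apply/val_inj; rewrite /= ret_cycle // kernelP.
Qed.

Lemma psi_bd p x : psi p (bd C p x) = 0.
Proof. by rewrite psiE (hclass_bd (e := x)) // to_cycleE ret_bd. Qed.

Lemma psi0_bd p x : bd_out C p x = 0 -> psi p x = 0 ->
  exists e : mc_group K p.+1 l, bd C p e = x.
Proof.
by move=> xc; rewrite psiE => /hclass0[e eE]; exists e; rewrite eE to_cycleE ret_cycle.
Qed.

Definition kappa p : {additive mc_group K p l -> free_ab (homology C p)} :=
  free_lift (fun g : mgen K p l => fgen (psi p (fgen g))).

Lemma aug_kappa p x : free_aug _ (kappa p x) = psi p x.
Proof.
apply: (free_ext (f := free_aug _ \o kappa p) (g := psi p)) => g.
rewrite -[LHS]/(free_aug _ (kappa p (fgen g))).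
by rewrite /kappa free_lift_gen /free_aug free_lift_gen.
Qed.

Definition lambda p : {additive free_ab (homology C p) -> mc_group K p l} :=
  free_lift (fun h : homology C p => kval (repr h : cycles C p)).

Lemma bd_lambda p a : bd_out C p (lambda p a) = 0.
Proof.
apply: (free_ext (f := bd_out C p \o lambda p) (g := zero_map _ _)) => h.
by rewrite -[LHS]/(bd_out C p (lambda p (fgen h))) /lambda free_lift_gen kernelP.
Qed.

Lemma psi_lambda p a : psi p (lambda p a) = free_aug _ a.
Proof.
apply: (free_ext (f := psi p \o lambda p) (g := free_aug _)) => h.
rewrite -[LHS]/(psi p (lambda p (fgen h))) /lambda /free_aug !free_lift_gen psi_cycle.
exact: reprK.
Qed.

Lemma kappa_bd_subproof p x : free_aug _ ((kappa p \o bd C p) x) = 0.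
Proof. by rewrite [X in free_aug _ X]/= aug_kappa psi_bd. Qed.

(** The degree one part of a map of two-term complexes whose degree zero part is [kappa]; it lands
    in the kernel of the augmentation because [psi] kills boundaries. *)
Definition kappa_bd p : {additive mc_group K p.+1 l -> free_res (homology C p)} :=
  to_kernel (@kappa_bd_subproof p).

Lemma kappa_bd_ret p x : kappa_bd p (ret p.+1 x) = 0.
Proof. by apply/val_inj; rewrite /= [mc_bd _ _ _ _](bd_ret x) raddf0. Qed.

(** Two fillings of the same boundary differ by a cycle, which [coret] kills; taking [coret] of any
    filling is therefore additive. *)
Lemma lift_bd p (Z : zmodType) (m : {additive Z -> mc_group K p l}) :
  (forall z, exists x, bd C p x = m z) ->
  exists m' : {additive Z -> mc_group K p.+1 l},
    forall z x, bd C p x = m z -> m' z = coret p.+1 x.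
Proof.
move=> mE; pose m' z := coret p.+1 (sval (cid (mE z))).
have m'P z x : bd C p x = m z -> m' z = coret p.+1 x.
  move=> xz; apply/eqP; rewrite -subr_eq0 -raddfB; apply/eqP/coret_cycle.
  by rewrite [LHS](raddfB (bd C p)) xz (svalP (cid (mE z))) subrr.
have m'B : zmod_morphism m'.
  move=> x y; rewrite (@m'P _ (sval (cid (mE x)) - sval (cid (mE y)))) ?raddfB //.
  by rewrite (svalP (cid (mE x))) (svalP (cid (mE y))).
by exists (additive_of m'B).
Qed.
End Resolution.

(** * Relations between the components of a cycle *)

Section ChainLevel.
Variables (R : realType) (G H : hypergraph).
Local Notation P := (cart_prod G H).
Implicit Types (p q n : nat) (l : R).
Local Notation cycle n l c := (bd_out (magnitude_complex P l) n c = 0).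

Lemma awm_rel p q l1 l2 n l (c : mc_group P n l) : n = (p + q).+1 -> l1 + l2 = l ->
  cycle n l c ->
  tens_map (mc_bd G p l1) idfun (awm G H p.+1 q l1 l2 n l c) *~ (-1) ^+ q +
  tens_map idfun (mc_bd H q l2) (awm G H p q.+1 l1 l2 n l c) = 0.
Proof.
by move=> en ll; subst n => cc; rewrite -awm_bd // [X in awm _ _ _ _ _ _ _ _ X]cc raddf0.
Qed.

(** Apply $a\otimes b$ to [awm_rel]: the second term dies and the first is the claim up to sign. *)
Lemma awm_rel_l (M N : zmodType) p q l1 l2 n l (c : mc_group P n l)
    (a : {additive mc_group G p l1 -> M}) (a' : {additive mc_group G p.+1 l1 -> M})
    (b : {additive mc_group H q l2 -> N}) :
  (forall x, a' x = a (mc_bd G p l1 x)) -> (forall y, b (mc_bd H q l2 y) = 0) ->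
  n = (p + q).+1 -> l1 + l2 = l -> cycle n l c ->
  tens_map a' b (awm G H p.+1 q l1 l2 n l c) = 0.
Proof.
move=> aE bE en ll cc; have := congr1 (tens_map a b) (awm_rel en ll cc).
rewrite raddf0 raddfD raddfMz 2!tens_map_comp [X in _ + X]tens_map0r // addr0 => e.
have -> : tens_map a' b (awm G H p.+1 q l1 l2 n l c) =
    tens_map (a \o mc_bd G p l1) (b \o idfun) (awm G H p.+1 q l1 l2 n l c).
  by apply: tens_map_eq => // x; rewrite aE.
by move/(congr1 (fun z => z *~ (-1) ^+ q)): e; rewrite -mulrzA -expr2 sqrr_sign mulr1z mul0rz.
Qed.

(** A chain of the first factor is determined by its boundary and its [ret], and by flatness it
    suffices to test these two. The boundary test is [awm_rel_l], since [coret] kills boundaries. *)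
Lemma awm_coret p q l1 l2 n l (c : mc_group P n l) : n = (p + q)%N -> l1 + l2 = l ->
  cycle n l c -> tens_map (@coret R G l1 p) (@coret R H l2 q) (awm G H p q l1 l2 n l c) = 0.
Proof.
case: p => [|p] en ll cc; first by rewrite tens_map0l // => x; apply: coret_cycle.
apply: (free_flatl (f := mc_bd G p l1) (f' := @ret R G l1 p.+1)).
- by move=> x xc x0; rewrite -(ret_cycle (p := p.+1) xc).
- rewrite tens_map_comp; apply: (awm_rel_l (a := idfun)) => //.
    by move=> x; apply: (@bd_coret R G l1 p.+1).
  by move=> y; apply: coret_bd.
- by rewrite tens_map_comp tens_map0l // => x; apply: ret_coret.
Qed.

(** A map killing cycles only sees the [coret] part of the first factor, and by [awm_coret] only the
    cycle part of the second is then left. *)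
Lemma tens_map_ret_r (M N : zmodType) p q l1 l2 n l (c : mc_group P n l)
    (a : {additive mc_group G p l1 -> M}) (b : {additive mc_group H q l2 -> N}) :
  (forall x, a (@ret R G l1 p x) = 0) -> n = (p + q)%N -> l1 + l2 = l -> cycle n l c ->
  tens_map a b (awm G H p q l1 l2 n l c) =
  tens_map a (b \o @ret R H l2 q) (awm G H p q l1 l2 n l c).
Proof.
move=> a0 en ll cc; rewrite (tens_map_eq (f' := a \o @coret R G l1 p) (g' := b)) //; last first.
  by move=> x; rewrite {1}(ret_coret_split x) raddfD a0 add0r.
have -> : tens_map (a \o @coret R G l1 p) b (awm G H p q l1 l2 n l c) =
    tens_map (a \o @coret R G l1 p) (b \o @ret R H l2 q) (awm G H p q l1 l2 n l c) +
    tens_map (a \o @coret R G l1 p) (b \o @coret R H l2 q) (awm G H p q l1 l2 n l c).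
  apply: tens_mapDr => y; rewrite {1}(ret_coret_split y); exact: raddfD.
rewrite -(tens_map_comp (@coret R G l1 p) (@coret R H l2 q)) awm_coret // raddf0 addr0.
apply: tens_map_eq => // x.
by rewrite [in RHS](ret_coret_split x) raddfD a0 add0r.
Qed.

Lemma awm_neg p q l1 l2 n l (c : mc_group P n l) : ~~ ((0 <= l1) && (0 <= l2)) ->
  awm G H p q l1 l2 n l c = 0.
Proof.
move=> neg; apply: (free_ext (f := awm G H p q l1 l2 n l) (g := zero_map _ _)) => g.
rewrite /awm free_lift_gen -[RHS]/0; apply/eqP; apply: contraNT neg.
move=> /aw_len[/and3P[_ _ /eqP e1] /and3P[_ _ /eqP e2] _].
by rewrite -!lee_fin -e1 -e2 !tuple_len_ge0.
Qed.

(** [Q] ranges over all four indices so that equal bidegrees can be identified without transporting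
    tensors. *)
Lemma awm_extn_ind (Q : forall p q l1 l2, tensor (mc_group G p l1) (mc_group H q l2) -> Prop)
    p q l1 l2 n l (x : tensor (mc_group G p l1) (mc_group H q l2)) p' q' l1' l2' :
  (p + q)%N = n -> l1 + l2 = l -> (p' + q')%N = n -> l1' + l2' = l ->
  Q p q l1 l2 x -> Q p' q' l1' l2' 0 ->
  Q p' q' l1' l2' (awm G H p' q' l1' l2' n l (extn G H p q l1 l2 n l x)).
Proof.
move=> pq ll pq' ll' Qx Q0; have [e|ne] := eqVneq (p', l1') (p, l1); last first.
  by rewrite awm_extn0.
case: e => e1 e2; have e3 : q' = q by lia.
have e4 : l2' = l2 by apply: (addrI l1); rewrite ll -{1}e2.
by subst p' l1' q' l2'; rewrite awm_extn.
Qed.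
End ChainLevel.

Lemma tens_diff (A B : zmodType) (a a' : A) (b b' : B) :
  tens a b = tens a' b' + tens (a - a') b + tens a' (b - b').
Proof.
rewrite tensBl tensBr; move: (tens a b) (tens a' b) (tens a' b') => x y w.
by rewrite [w + _]addrC -addrA [w + _]addrC !subrK.
Qed.

(** * The exterior product on homology *)

Section ProductClass.
Variables (R : realType) (G H : hypergraph) (p q n : nat) (l1 l2 l : R).
Local Notation P := (cart_prod G H).
Hypothesis pq : (p + q)%N = n.
Hypothesis ll : l1 + l2 = l.
Local Notation C := (magnitude_complex G l1).
Local Notation D := (magnitude_complex H l2).
Local Notation A := (magnitude_complex P l).
Local Notation E := (extn G H p q l1 l2 n l).
Local Notation psiA := (@psi R P l n).

Lemma extn_cycle t :
  tens_map (bd_out C p) idfun t = 0 :> tensor (mc_group G p.-1 l1) (mc_group H q l2) ->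
  tens_map idfun (bd_out D q) t = 0 :> tensor (mc_group G p l1) (mc_group H q.-1 l2) ->
  bd_out A n (E t) = 0.
Proof.
by move=> h1 h2; rewrite (extn_bd _ pq ll) /ext_bd_rhs h1 h2 !raddf0 mul0rz addr0.
Qed.

Lemma psi_extn_bdl (y : mc_group G p.+1 l1) (w : mc_group H q l2) :
  bd_out D q w = 0 -> psiA (E (tens (mc_bd G p l1 y) w)) = 0.
Proof.
move=> wc; have pq1 : (p.+1 + q)%N = n.+1 by rewrite addSn pq.
have := extn_bd (tens y w) pq1 ll; rewrite /ext_bd_rhs 2!tens_mapE.
rewrite [X in _ + extn _ _ _ _ _ _ _ _ (tens _ X)]wc tens0r raddf0 addr0 => e.
have -> : E (tens (mc_bd G p l1 y) w) =
    mc_bd P n l (extn G H p.+1 q l1 l2 n.+1 l (tens y w) *~ (-1) ^+ q).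
  have e' : mc_bd P n l (extn G H p.+1 q l1 l2 n.+1 l (tens y w)) =
    E (tens (mc_bd G p l1 y) w) *~ (-1) ^+ q := e.
  rewrite raddfMz e' -mulrzA -expr2 sqrr_sign mulr1z //.
exact: psi_bd.
Qed.

Lemma psi_extn_bdr (z : mc_group G p l1) (y : mc_group H q.+1 l2) :
  bd_out C p z = 0 -> psiA (E (tens z (mc_bd H q l2 y))) = 0.
Proof.
move=> zc; have pq1 : (p + q.+1)%N = n.+1 by rewrite addnS pq.
have := extn_bd (tens z y) pq1 ll; rewrite /ext_bd_rhs 2!tens_mapE.
rewrite [X in extn _ _ _ _ _ _ _ _ (tens X _) *~ _]zc tens0l raddf0 mul0rz add0r => e.
have e' : mc_bd P n l (extn G H p q.+1 l1 l2 n.+1 l (tens z y)) =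
  E (tens z (mc_bd H q l2 y)) := e.
by rewrite -e'; apply: (@psi_bd R P l n).
Qed.

(** Using [psi] instead of [hclass] avoids carrying a proof that the product is a cycle. *)
Definition ext_class (z : cycles C p) (w : cycles D q) : magnitude_homology P n l :=
  psiA (E (tens (kval z) (kval w))).

Lemma ext_class_eq z z' w w' : hclass C p z = hclass C p z' -> hclass D q w = hclass D q w' ->
  ext_class z w = ext_class z' w'.
Proof.
move=> hz hw; rewrite /ext_class.
have [|y yE] := @hclass0 C p (z - z'); first by rewrite raddfB hz subrr.
have [|x xE] := @hclass0 D q (w - w'); first by rewrite raddfB hw subrr.
have -> : tens (kval z) (kval w) = tens (kval z') (kval w') +
    tens (bd C p y) (kval w) + tens (kval z') (bd D q x).
  by rewrite yE xE; apply: tens_diff.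
rewrite 2!(raddfD E) 2!(raddfD psiA) [X in _ + X + _](psi_extn_bdl y) ?kernelP //.
by rewrite [X in _ + X](psi_extn_bdr x) ?kernelP // !addr0.
Qed.

Definition ext_homology (h : homology C p) (k : homology D q) : magnitude_homology P n l :=
  ext_class (repr h) (repr k).

Lemma ext_homologyE z w : ext_homology (hclass C p z) (hclass D q w) = ext_class z w.
Proof. by apply: ext_class_eq; apply: reprK. Qed.

Lemma ext_homologyDl h h' k : ext_homology (h + h') k = ext_homology h k + ext_homology h' k.
Proof.
have [z <-] := hclass_surj h; have [z' <-] := hclass_surj h'; have [w <-] := hclass_surj k.
rewrite -raddfD !ext_homologyE /ext_class -[kval (z + z')]/(kval z + kval z').
by rewrite tensDl raddfD (raddfD psiA).
Qed.

Lemma ext_homologyDr h k k' : ext_homology h (k + k') = ext_homology h k + ext_homology h k'.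
Proof.
have [z <-] := hclass_surj h; have [w <-] := hclass_surj k; have [w' <-] := hclass_surj k'.
rewrite -raddfD !ext_homologyE /ext_class -[kval (w + w')]/(kval w + kval w').
by rewrite tensDr raddfD (raddfD psiA).
Qed.

Definition sq_pair : {additive tensor (homology C p) (homology D q) -> magnitude_homology P n l} :=
  tens_lift ext_homologyDl ext_homologyDr.

Lemma sq_pairE z w : sq_pair (tens (hclass C p z) (hclass D q w)) = ext_class z w.
Proof. by rewrite /sq_pair tens_liftE ext_homologyE. Qed.

Lemma sq_pair_psi (t : tensor (mc_group G p l1) (mc_group H q l2)) :
  sq_pair (tens_map (@psi R G l1 p) (@psi R H l2 q) t) =
  psiA (E (tens_map (@ret R G l1 p) (@ret R H l2 q) t)).
Proof.
apply: (tens_ext (f := sq_pair \o tens_map (@psi R G l1 p) (@psi R H l2 q))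
  (g := psiA \o (E \o tens_map (@ret R G l1 p) (@ret R H l2 q)))) => x y.
rewrite -[LHS]/(sq_pair (tens_map (@psi R G l1 p) (@psi R H l2 q) (tens x y))).
rewrite -[RHS]/(psiA (E (tens_map (@ret R G l1 p) (@ret R H l2 q) (tens x y)))).
by rewrite 2!tens_mapE 2!psiE sq_pairE.
Qed.

Lemma ext_class_cycle (z : cycles C p) (w : cycles D q) : bd_out A n (E (tens (kval z) (kval w))) = 0.
Proof. by apply: extn_cycle; rewrite tens_mapE kernelP ?tens0l ?tens0r. Qed.
End ProductClass.

Section Square.
Variables (R : realType) (G H : hypergraph) (n : nat) (l : R).
Local Notation P := (cart_prod G H).

Lemma bidegree_deg (i : bidegree n l) : (deg1 i + deg2 i)%N = n.
Proof. by have /andP[/eqP e _] := valP i. Qed.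
Lemma bidegree_len (i : bidegree n l) : len1 i + len2 i = l.
Proof. by have /andP[_ /eqP e] := valP i. Qed.

Definition sq : {additive kunneth_tensor G H n l -> magnitude_homology P n l} :=
  dsum_lift (fun i : bidegree n l => sq_pair G H (bidegree_deg i) (bidegree_len i)).

Lemma sqE i t : sq (dsum_in (tensor_term G H (l := l)) i t) =
  sq_pair G H (bidegree_deg i) (bidegree_len i) t.
Proof. exact: dsum_liftE. Qed.
End Square.

Lemma sq_induced (R : realType) (G H : hypergraph) p q (l1 l2 : {nonneg R}) :
  induced_by_ext_prod (sq G H (p + q) (l1%:num + l2%:num)).
Proof.
move=> z w.
have zw := ext_class_cycle (n := p + q) (l := l1%:num + l2%:num) erefl erefl z w.
rewrite extn_ext_prod in zw.
have zwk : ext_prod G H p q l1%:num l2%:num (tens (kval z) (kval w)) \in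
  in_kernel (bd_out (magnitude_complex (cart_prod G H) (l1%:num + l2%:num)) (p + q)).
  by rewrite unfold_in; apply/eqP.
exists (Kernel zwk); split=> //; rewrite /kunneth_in sqE.
rewrite (sq_pairE _ _ z w) /ext_class extn_ext_prod.
exact: (psi_cycle (Kernel zwk)).
Qed.

Lemma dsum_map_in (I : choiceType) (A B : I -> zmodType)
    (f : forall i, {additive A i -> B i}) i a :
  dsum_map f (dsum_in A i a) = dsum_in B i (f i a).
Proof.
apply: dsum_eq => j; rewrite -[LHS]/(f j (dsval (dsum_in A i a) j)); have [ij|/eqP ij] := pselect (i = j).
  by subst j; rewrite !dsum_in_eq.
by rewrite !dsum_in_neq // raddf0.
Qed.

Lemma sq_natural (R : realType) (G G' H H' : hypergraph) (f : hmorphism G G')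
    (g : hmorphism H H') n (l : R) (x : kunneth_tensor G H n l) :
  magnitude_cart_map f g n l (sq G H n l x) = sq G' H' n l (kunneth_tensor_map f g n l x).
Proof.
apply: (dsum_ext (f := magnitude_cart_map f g n l \o sq G H n l)
  (g := sq G' H' n l \o kunneth_tensor_map f g n l)) => i t.
rewrite -[LHS]/(magnitude_cart_map f g n l (sq G H n l (dsum_in (tensor_term G H (l := l)) i t))).
rewrite -[RHS]/(sq G' H' n l (kunneth_tensor_map f g n l (dsum_in (tensor_term G H (l := l)) i t))).
rewrite /kunneth_tensor_map dsum_map_in !sqE; move: t.
apply: tens_ind => [|h k|x1 y1 e1 e2]; last first.
- by rewrite !raddfD e1 e2.
- have [z <-] := hclass_surj h; have [w <-] := hclass_surj k.
  rewrite tens_mapE !homology_mapE !sq_pairE /ext_class.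
  have zw := ext_class_cycle (bidegree_deg i) (bidegree_len i) z w.
  set c := extn _ _ _ _ _ _ _ _ _ in zw *.
  have ck : c \in in_kernel (bd_out (magnitude_complex (cart_prod G H) l) n).
    by rewrite unfold_in; apply/eqP.
  rewrite -[c]/(kval (Kernel ck)) psi_cycle /magnitude_cart_map homology_mapE -psi_cycle.
  congr (psi _ _ _ _); rewrite -[LHS]/(mc_map_fun (cart_map f g) n l c).
  have e := extn_natural f g (tens (kval z) (kval w)) (bidegree_deg i) (bidegree_len i).
  rewrite tens_mapE in e.
  exact: e.
by rewrite !raddf0.
Qed.

Lemma finite_key (T : choiceType) (U : choiceType) (key : T -> U) (s : seq U) :
  injective key -> finite_set [set i | key i \in s]%classic.
Proof.
move=> kI; have fs : finite_set [set` s]%classic := finite_seq s.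
by apply: (finite_preimage (f := key) _ fs) => x y _ _; apply: kI.
Qed.

Section Support.
Variables (R : realType) (G H : hypergraph) (n : nat) (l : R).
Local Notation P := (cart_prod G H).

(** A nonzero component comes from a tuple of the support, and for that tuple [q] determines both
    lengths. *)
Lemma awm_support (c : mc_group P n l) : exists s : seq (nat * R * R),
  forall p q l1 l2, awm G H p q l1 l2 n l c != 0 -> (q, l1, l2) \in s.
Proof.
exists [seq (q, fine (tuple_len R (drop q (unzip1 (g : mgen P n l)))),
             fine (tuple_len R (take q.+1 (unzip2 g)))) | g <- msupp c, q <- iota 0 n.+1].
move=> p q l1 l2 cN; have [g gc gN] : exists2 g : mgen P n l, g \in msupp c & aw p q l1 l2 g != 0.
  apply: contrapT => h; case/eqP: cN; rewrite (free_expand c) raddf_sum big1_seq // => g /andP[_ gc].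
  rewrite raddfMz /awm free_lift_gen; have [->|gN] := eqVneq (aw p q l1 l2 g) 0.
    by rewrite mul0rz.
  by case: h; exists g.
have [/and3P[_ _ /eqP e1] /and3P[/eqP sz _ /eqP e2] _] := aw_len gN.
apply/allpairsP; exists (g, q); split=> //; last by rewrite /= e1 e2.
rewrite [(g, q).2]/= mem_iota add0n leq0n andTb ltnNge; apply/negP => nq.
by move: sz; rewrite take_oversize size_map size_tuple //; lia.
Qed.

Definition bidegree_key (i : bidegree n l) : nat * R * R := (deg2 i, len1 i, len2 i).

Lemma bidegree_key_inj : injective bidegree_key.
Proof.
move=> i j [e2 f1 f2]; have e1 : deg1 i = deg1 j.
  by have := bidegree_deg i; have := bidegree_deg j; lia.
apply/val_inj; move: e1 e2 f1 f2; rewrite /deg1 /deg2 /len1 /len2.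
case: (val i) => [[p l1] [q l2]]; case: (val j) => [[p' l1'] [q' l2']] /= -> ->.
by move=> /val_inj -> /val_inj ->.
Qed.
End Support.

(** * The map to Tor *)

Section Connecting.
Variables (R : realType) (G H : hypergraph) (n : nat) (l : R).
Local Notation P := (cart_prod G H).
Local Notation A := (magnitude_complex P l).

Definition del_pair p q (l1 l2 : R) : {additive mc_group P n l ->
    tensor (free_res (magnitude_homology G p l1)) (homology_pred (magnitude_complex H l2) q)} :=
  match q with
  | 0 => zero_map _ _
  | q'.+1 => tens_map (@kappa_bd R G l1 p) (@psi R H l2 q') \o awm G H p.+1 q' l1 l2 n l
  end.

(** The inclusion of [free_res] turns [kappa_bd] into [kappa] after the boundary, so [awm_rel_l]
    applies. *)
Lemma del_pair_tor p q l1 l2 : (p + q)%N = n -> l1 + l2 = l ->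
  forall c, bd_out A n c = 0 -> tor_map0 _ _ (del_pair p q l1 l2 c) = 0.
Proof.
move=> pq ll c cc; case: q pq => [|q] pq; first by rewrite raddf0.
rewrite -[del_pair _ _ _ _ _]/(tens_map (@kappa_bd R G l1 p) (@psi R H l2 q) (awm G H p.+1 q l1 l2 n l c)).
rewrite /tor_map0 tens_map_comp.
apply: (awm_rel_l (a := @kappa R G l1 p)) => //; last by rewrite -pq addnS.
by move=> y; apply: psi_bd.
Qed.

Lemma del_pair_bd p q l1 l2 : (p + q)%N = n -> l1 + l2 = l ->
  forall e, del_pair p q l1 l2 (mc_bd P n l e) = 0.
Proof.
move=> pq ll e; case: q pq => // q pq.
rewrite -[LHS]/(tens_map (@kappa_bd R G l1 p) (@psi R H l2 q) (awm G H p.+1 q l1 l2 n l (mc_bd P n l e))).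
rewrite awm_bd // ?addSnnS // raddfD raddfMz 2!tens_map_comp tens_map0l; last first.
  by move=> x; apply/val_inj; rewrite /= [mc_bd _ _ _ _]mc_bd_bd raddf0.
by rewrite mul0rz add0r tens_map0r // => y; apply: psi_bd.
Qed.

Definition del_term (i : bidegree n l) : {additive cycles A n -> tor_term G H i} :=
  kernel_map (del_pair_tor (bidegree_deg i) (bidegree_len i)).

Lemma del_termE i z : kval (del_term i z) = del_pair (deg1 i) (deg2 i) (len1 i) (len2 i) (kval z).
Proof. by []. Qed.

Lemma del_term_finite z : finite_set [set i | del_term i z != 0]%classic.
Proof.
have [s sP] := awm_support (kval z).
(* The Tor term of index [q] reads a component of second degree [q.-1], hence the shift of the
   key. *)
apply: (@sub_finite_set _ _ [set i | bidegree_key i \in [seq (u.1.1.+1, u.1.2, u.2) | u <- s]]%classic);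
  last exact/finite_key/bidegree_key_inj.
move=> i /= iN; rewrite /bidegree_key.
have : del_pair (deg1 i) (deg2 i) (len1 i) (len2 i) (kval z) != 0.
  by apply: contra_neq iN => e; apply/val_inj.
case: (deg2 i) => [|q]; first by rewrite eqxx.
move=> dN; apply/mapP; exists (q, len1 i, len2 i) => //; apply: (sP (deg1 i).+1).
by apply: contra_neq dN => e; rewrite /= e raddf0.
Qed.

Lemma del_subproof z : z \in boundary_sub A n ->
  dsum_family del_term_finite z = 0.
Proof.
move=> /asboolP[e ez]; apply: dsum_eq => i; rewrite dsum_familyE; apply/val_inj.
by rewrite /= -ez (del_pair_bd (bidegree_deg i) (bidegree_len i)).
Qed.

Definition del : {additive magnitude_homology P n l -> kunneth_tor G H n l} :=
  quot_lift del_subproof.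

Lemma delE z i : dsval (del (hclass A n z)) i = del_term i z.
Proof. by rewrite [del _](quot_lift_funE del_subproof). Qed.
End Connecting.

Lemma kval_eq0 (A B : zmodType) (f : {additive A -> B}) (x : kernel f) : kval x = 0 -> x = 0.
Proof. by move=> x0; apply/val_inj. Qed.

(** * Injectivity and vanishing of the composite *)

Section Exactness.
Variables (R : realType) (G H : hypergraph) (n : nat) (l : R).
Local Notation P := (cart_prod G H).
Local Notation A := (magnitude_complex P l).
Local Notation dinT i := (dsum_in (tensor_term G H (n := n) (l := l)) i).

Lemma bidegree_neq (i j : bidegree n l) : i != j -> (deg1 j, len1 j) != (deg1 i, len1 i).
Proof.
apply: contra_neq => -[e1 e2]; apply: bidegree_key_inj; rewrite /bidegree_key.
have e3 : len2 j = len2 i.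
  by apply: (addrI (len1 j)); rewrite bidegree_len e2 bidegree_len.
have e4 : deg2 j = deg2 i by have := bidegree_deg i; have := bidegree_deg j; lia.
by rewrite e2 e3 e4.
Qed.

Lemma sq_class i (z : cycles (magnitude_complex G (len1 i)) (deg1 i))
    (w : cycles (magnitude_complex H (len2 i)) (deg2 i)) :
  exists c : cycles A n,
    kval c = extn G H (deg1 i) (deg2 i) (len1 i) (len2 i) n l (tens (kval z) (kval w)) /\
    sq G H n l (dinT i (tens (hclass _ _ z) (hclass _ _ w))) = hclass A n c.
Proof.
have zw := ext_class_cycle (bidegree_deg i) (bidegree_len i) z w.
have ck : extn G H (deg1 i) (deg2 i) (len1 i) (len2 i) n l (tens (kval z) (kval w))
  \in in_kernel (bd_out A n) by rewrite unfold_in; apply/eqP.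
exists (Kernel ck); split=> //; rewrite sqE sq_pairE /ext_class.
exact: (psi_cycle (Kernel ck)).
Qed.

(** Chooses for each class [sq x] a representing cycle whose Alexander-Whitney components are
    known. *)
Lemma sq_ind (Q : kunneth_tensor G H n l -> cycles A n -> Prop) :
  Q 0 0 -> (forall x y c d, Q x c -> Q y d -> Q (x + y) (c + d)) ->
  (forall i (z : cycles (magnitude_complex G (len1 i)) (deg1 i))
     (w : cycles (magnitude_complex H (len2 i)) (deg2 i)) (c : cycles A n),
     kval c = extn G H (deg1 i) (deg2 i) (len1 i) (len2 i) n l (tens (kval z) (kval w)) ->
     Q (dinT i (tens (hclass _ _ z) (hclass _ _ w))) c) ->
  forall x, exists c, sq G H n l x = hclass A n c /\ Q x c.
Proof.
move=> Q0 QD Qi; apply: dsum_ind => [|i t|x y [c [cE cQ]] [d [dE dQ]]].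
- by exists 0; rewrite !raddf0.
- move: t; apply: tens_ind => [|h k|x y [c [cE cQ]] [d [dE dQ]]].
  + by exists 0; rewrite !raddf0.
  + have [z <-] := hclass_surj h; have [w <-] := hclass_surj k.
    have [c [ck cE]] := sq_class z w.
    by exists c; split=> //; apply: Qi.
  + exists (c + d); rewrite (raddfD (dinT i)) (raddfD (sq G H n l)) cE dE -(raddfD (hclass A n)).
    by split=> //; apply: QD.
- exists (c + d); rewrite (raddfD (sq G H n l)) cE dE -(raddfD (hclass A n)).
  by split=> //; apply: QD.
Qed.

(** $\psi\otimes\psi$ applied to the components recovers [x] from the representative, and it
    vanishes on boundaries by [awm_bd]. *)
Lemma sq_inj : injective (sq G H n l).
Proof.
suff ker0 x : sq G H n l x = 0 -> x = 0.
  move=> x y xy; apply/eqP; rewrite -subr_eq0; apply/eqP/ker0.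
  by rewrite raddfB xy subrr.
pose Th (c : mc_group P n l) (i : bidegree n l) :=
  tens_map (@psi R G (len1 i) (deg1 i)) (@psi R H (len2 i) (deg2 i))
    (awm G H (deg1 i) (deg2 i) (len1 i) (len2 i) n l c).
have [|||c [sx cQ]] := @sq_ind (fun x c => forall i, Th (kval c) i = dsval x i) _ _ _ x.
- by move=> i; rewrite /Th !raddf0.
- by move=> x' y c d hc hd i; rewrite /Th -[kval (c + d)]/(kval c + kval d) !raddfD -!/(Th _ _) hc hd.
- move=> i z w c cE j; rewrite /Th cE.
  have [ij|/eqP ij] := pselect (i = j).
    subst j; rewrite awm_extn ?bidegree_deg ?bidegree_len // tens_mapE !psi_cycle.
    by rewrite dsum_in_eq.
  rewrite awm_extn0 ?bidegree_deg ?bidegree_len ?bidegree_neq // raddf0.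
  by rewrite dsum_in_neq.
rewrite sx => /hclass0[e ce]; apply: dsum_eq => i; rewrite -cQ /Th -ce.
rewrite [bd _ _ _]/(mc_bd P n l e) awm_bd ?bidegree_deg ?bidegree_len // raddfD raddfMz.
rewrite 2!tens_map_comp tens_map0l ?tens_map0r ?mul0rz ?addr0 // => y; exact: psi_bd.
Qed.

Lemma del_sq x : del G H n l (sq G H n l x) = 0.
Proof.
have [|||c [-> cQ]] := @sq_ind (fun _ c => forall i, del_term G H i c = 0) _ _ _ x.
- by move=> i; rewrite raddf0.
- by move=> x' y c d hc hd i; rewrite raddfD hc hd addr0.
- move=> i z w c cE j; apply: kval_eq0; rewrite del_termE cE.
  have := bidegree_deg j; have := bidegree_len j.
  move: (len1 j) (len2 j) (deg1 j) (deg2 j) => l1' l2' p' [|q'] // ll' pq'.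
  rewrite -[LHS]/(tens_map (@kappa_bd R G l1' p') (@psi R H l2' q')
    (awm G H p'.+1 q' l1' l2' n l (extn G H _ _ _ _ n l _))).
  (* The match admits [deg1 i = 0], where there is no [kappa_bd] to apply; in positive degree
     [kappa_bd] kills the cycle [z]. *)
  pose Q p q l1 l2 (u : tensor (mc_group G p l1) (mc_group H q l2)) : Prop :=
    match p return tensor (mc_group G p l1) (mc_group H q l2) -> Prop with
    | 0 => fun=> True
    | p0.+1 => fun u => tens_map (@kappa_bd R G l1 p0) (@psi R H l2 q) u = 0
    end u.
  apply: (awm_extn_ind (Q := Q) (p' := p'.+1) (q' := q') (l1' := l1') (l2' := l2')
    (bidegree_deg i) (bidegree_len i)) => //.
  + by rewrite addSnnS.
  + move: z w {c cE}; case: (deg1 i) => // p0 z w; rewrite /Q tens_mapE.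
    have -> : @kappa_bd R G (len1 i) p0 (kval z) = 0 :> free_res (magnitude_homology G p0 (len1 i)).
      by apply/val_inj; rewrite /= [mc_bd _ _ _ _](kernelP z) raddf0.
    exact: tens0l.
  + exact: raddf0.
by apply: dsum_eq => i; rewrite delE cQ.
Qed.
End Exactness.

(** * Homotopies between chains and resolution *)

Section Comparison.
Variables (R : realType) (K : hypergraph) (l : R) (p : nat).
Local Notation C := (magnitude_complex K l).

(** The degree one part of the comparison back to the chains: on the kernel of the augmentation
    [lambda] gives boundaries, which [lift_bd] fills additively. *)
Lemma sigma_ex : exists sigma : {additive free_res (homology C p) -> mc_group K p.+1 l},
  (forall k, mc_bd K p l (sigma k) = lambda K l p (kval k)) /\
  (forall k x, mc_bd K p l x = lambda K l p (kval k) -> sigma k = coret K l p.+1 x).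
Proof.
have bE (k : free_res (homology C p)) : exists x, bd C p x = (lambda K l p \o kernel_incl _) k.
  have := @psi0_bd R K l p (lambda K l p (kval k)) (bd_lambda _).
  by rewrite psi_lambda kernelP => /(_ erefl).
have [sigma sE] := lift_bd bE; exists sigma; split=> [k|k x xk]; last exact: sE.
have [x xE] := bE k; rewrite (sE k x xE) -[RHS]xE.
exact: (@bd_coret R K l p.+1).
Qed.

(* A homotopy from the identity to [lambda \o kappa] on cycles. *)
Lemma cycle_homotopy_ex : exists h : {additive mc_group K p l -> mc_group K p.+1 l},
  forall y x, bd_out C p y = 0 -> mc_bd K p l x = lambda K l p (kappa K l p y) - y ->
    h y = coret K l p.+1 x.
Proof.
pose m y := lambda K l p (kappa K l p (ret K l p y)) - ret K l p y.
have mB : zmod_morphism m.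
  move=> x y; rewrite /m (raddfB (ret K l p)) (raddfB (kappa K l p)) (raddfB (lambda K l p)).
  by rewrite !opprD !opprK addrACA.
have mE y : exists x, bd C p x = additive_of mB y.
  apply: psi0_bd; rewrite additive_ofE /m.
    by rewrite raddfB [X in X - _]bd_lambda bd_ret subrr.
  by rewrite raddfB psi_lambda aug_kappa subrr.
have [h hE] := lift_bd mE; exists h => y x yc xE; apply: hE.
by rewrite additive_ofE /m ret_cycle.
Qed.

Lemma free_homotopy_ex : exists h : {additive free_ab (homology C p) -> free_res (homology C p)},
  forall a, kval (h a) = kappa K l p (lambda K l p a) - a.
Proof.
pose m a := kappa K l p (lambda K l p a) - a.
have mB : zmod_morphism m.
  move=> x y; rewrite /m (raddfB (lambda K l p)) (raddfB (kappa K l p)).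
  by rewrite !opprD !opprK addrACA.
have mE a : free_aug (homology C p) (additive_of mB a) = 0.
  by rewrite additive_ofE /m raddfB aug_kappa psi_lambda subrr.
by exists (to_kernel mE).
Qed.

Lemma bd_cycle_subproof x : bd_out C p (bd C p x) = 0.
Proof. exact: bd_out_bd. Qed.
Definition bd_cycle : {additive mc_group K p.+1 l -> cycles C p} := to_kernel bd_cycle_subproof.

Lemma hclass_bd_cycle (z : cycles C p) : hclass C p z = 0 -> exists x, bd_cycle x = z.
Proof. by move=> /hclass0[x xE]; exists x; apply/val_inj. Qed.

Lemma tens_hclass_exact (N : zmodType) (t : tensor N (cycles C p)) :
  tens_map idfun (hclass C p) t = 0 ->
  exists u : tensor N (mc_group K p.+1 l), tens_map idfun bd_cycle u = t.
Proof.
apply: tens_right_exact; first exact: hclass_surj.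
exact: hclass_bd_cycle.
Qed.
End Comparison.

Section Kernel.
Variables (R : realType) (G H : hypergraph) (n : nat) (l : R).
Local Notation P := (cart_prod G H).
Local Notation A := (magnitude_complex P l).
Local Notation aw p q l1 l2 c := (awm G H p q l1 l2 n l c).

Lemma bidegree_ex p q (l1 l2 : R) : (p + q)%N = n -> l1 + l2 = l -> 0 <= l1 -> 0 <= l2 ->
  exists i : bidegree n l, [/\ deg1 i = p, deg2 i = q, len1 i = l1 & len2 i = l2].
Proof.
move=> pq ll l10 l20.
have iP : (((p, NngNum l10), (q, NngNum l20)).1.1 + ((p, NngNum l10), (q, NngNum l20)).2.1 == n)%N &&
    (((p, NngNum l10), (q, NngNum l20)).1.2%:num + ((p, NngNum l10), (q, NngNum l20)).2.2%:num == l).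
  by rewrite /= pq ll !eqxx.
by exists (exist _ ((p, NngNum l10), (q, NngNum l20)) iP).
Qed.

Variable c : mc_group P n l.
Hypothesis cc : bd_out A n c = 0.
Hypothesis del0 : forall p q l1 l2, (p.+1 + q)%N = n -> l1 + l2 = l ->
  tens_map (@kappa_bd R G l1 p) (@psi R H l2 q) (aw p.+1 q l1 l2 c) = 0.

(** In positive degree, with [d] the boundary, [coret] is [sigma \o kappa_bd] minus [h \o d]. The
    first term vanishes by [del0], the second by [awm_rel_l]. *)
Lemma coret_psi_awm p q l1 l2 : (p + q)%N = n -> l1 + l2 = l ->
  tens_map (@coret R G l1 p) (@psi R H l2 q) (aw p q l1 l2 c) = 0.
Proof.
case: p => [|p] pq ll; first by rewrite tens_map0l // => x; apply: coret_cycle.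
have [sigma [s1 s2]] := sigma_ex G l1 p; have [h hE] := cycle_homotopy_ex G l1 p.
pose a := sigma \o @kappa_bd R G l1 p; pose b := h \o mc_bd G p l1.
rewrite (tens_mapDl (f := a) (f' := \- b)); last first.
  move=> x; rewrite -[RHS]/(sigma (kappa_bd G l1 p x) - h (mc_bd G p l1 x)).
  (* One filling [e] evaluates both maps, as [coret] of [e] and of [e - x]. *)
  have [e eE] := @psi0_bd R G l1 p (lambda G l1 p (kappa G l1 p (mc_bd G p l1 x)))
    (bd_lambda _) (etrans (psi_lambda _) (etrans (aug_kappa _) (psi_bd _))).
  rewrite (s2 _ e) // (hE _ (e - x)); last 2 first.
  - exact: bd_out_bd.
  - by rewrite raddfB [mc_bd G p l1 e]eE.
  by rewrite -raddfB subKr.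
rewrite /a -(tens_map_comp (@kappa_bd R G l1 p) (@psi R H l2 q) sigma idfun) del0 // raddf0 add0r.
apply: (awm_rel_l (a := \- h) _ _ _ ll cc) => // y.
exact: psi_bd.
Qed.

(** By [coret_psi_awm] the second factor is trivial in homology, and right exactness provides [u];
    [tens_map_ret_r] then removes the retraction. The clause on [u = 0] keeps the support finite in
    [assemble]. *)
Lemma coret_awm_bd p q l1 l2 : (p + q)%N = n -> l1 + l2 = l ->
  exists u : tensor (mc_group G p l1) (mc_group H q.+1 l2),
    (aw p q l1 l2 c = 0 -> u = 0) /\
    tens_map (@coret R G l1 p) (mc_bd H q l2) u =
    tens_map (@coret R G l1 p) idfun (aw p q l1 l2 c).
Proof.
move=> pq ll; have [X0|XN] := eqVneq (aw p q l1 l2 c) 0.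
  by exists 0; rewrite X0 !raddf0.
have [|u uE] := tens_hclass_exact
  (t := tens_map (@coret R G l1 p) (@to_cycle R H l2 q) (aw p q l1 l2 c)).
  by rewrite tens_map_comp -(coret_psi_awm pq ll); apply: tens_map_eq.
exists u; split=> [X0|]; first by rewrite X0 eqxx in XN.
have := congr1 (tens_map (@coret R G l1 p) (kernel_incl (bd_out (magnitude_complex H l2) q))) uE.
rewrite 2!tens_map_comp => e.
transitivity (tens_map (@coret R G l1 p \o idfun)
  (kernel_incl (bd_out (magnitude_complex H l2) q) \o bd_cycle H l2 q) u).
  exact: tens_map_eq.
have cr x : coret G l1 p (ret G l1 p x) = 0 by rewrite coretE ret_ret subrr.
have r := tens_map_ret_r (idfun : {additive mc_group H q l2 -> _}) cr (esym pq) ll cc.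
apply: etrans e _; apply: etrans (esym r).
apply: tens_map_eq => [x|y].
  exact: coret_coret.
by [].
Qed.
End Kernel.

Section Assemble.
Variables (R : realType) (G H : hypergraph) (n m : nat) (l : R) (sh : nat -> nat).
Local Notation P := (cart_prod G H).
Hypothesis sh_deg : forall i : bidegree n l, (deg1 i + sh (deg2 i))%N = m.
Variable U : forall i : bidegree n l,
  tensor (mc_group G (deg1 i) (len1 i)) (mc_group H (sh (deg2 i)) (len2 i)).
Variable S : {fset bidegree n l}.
Hypothesis US : forall i, i \notin S -> U i = 0.

(** A chain with the prescribed components [U i]; [sh] allows the second degree to be raised by one,
    to fill boundaries. *)
Definition assemble : mc_group P m l :=
  \sum_(i <- S) extn G H (deg1 i) (sh (deg2 i)) (len1 i) (len2 i) m l (U i).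

Lemma awm_assemble j :
  awm G H (deg1 j) (sh (deg2 j)) (len1 j) (len2 j) m l assemble = U j.
Proof.
have ne i : i != j ->
    awm G H (deg1 j) (sh (deg2 j)) (len1 j) (len2 j) m l
      (extn G H (deg1 i) (sh (deg2 i)) (len1 i) (len2 i) m l (U i)) = 0.
  by move=> ij; rewrite awm_extn0 ?sh_deg ?bidegree_len ?bidegree_neq.
rewrite /assemble raddf_sum; have [jS|jS] := boolP (j \in S); last first.
  rewrite (US jS) big1_seq // => i /andP[_ iS]; apply: ne.
  by apply: contraNneq jS => <-.
rewrite (bigD1_seq j) ?fset_uniq // big1 => [|i]; last exact: ne.
rewrite awm_extn ?sh_deg ?bidegree_len //; exact: addr0.
Qed.
End Assemble.

Section KernelOfDel.
Variables (R : realType) (G H : hypergraph) (n : nat) (l : R).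
Local Notation P := (cart_prod G H).
Local Notation A := (magnitude_complex P l).

Lemma bidegree_all (Q : nat -> nat -> R -> R -> Prop) :
  (forall i : bidegree n l, Q (deg1 i) (deg2 i) (len1 i) (len2 i)) ->
  forall p q l1 l2, (p + q)%N = n -> l1 + l2 = l -> 0 <= l1 -> 0 <= l2 -> Q p q l1 l2.
Proof.
move=> Qi p q l1 l2 pq ll l10 l20.
by have [i [<- <- <- <-]] := bidegree_ex pq ll l10 l20.
Qed.

Lemma awm_fset (c : mc_group P n l) : exists S : {fset bidegree n l}, forall i, i \notin S ->
  awm G H (deg1 i) (deg2 i) (len1 i) (len2 i) n l c = 0.
Proof.
have [s sP] := awm_support c.
have fin := @finite_key _ _ (@bidegree_key R n l) s (@bidegree_key_inj R n l).
exists (fset_set [set i | bidegree_key i \in s]%classic) => i.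
rewrite in_fset_set // => iS; apply/eqP; apply: contraNT iS => /sP iN.
exact/mem_set.
Qed.

Lemma del_ker (c : cycles A n) : (forall i, del_term G H i c = 0) ->
  exists x, sq G H n l x = hclass A n c.
Proof.
move=> dc; have cc : bd_out A n (kval c) = 0 := kernelP c.
(* Indices in [bidegree] have nonnegative lengths; components of negative length are zero. *)
have pos (Q : forall p q l1 l2, tensor (mc_group G p l1) (mc_group H q l2) -> Prop) d :
    (forall p q l1 l2, Q p q l1 l2 0) ->
    (forall i : bidegree n l, Q _ _ _ _ (awm G H (deg1 i) (deg2 i) (len1 i) (len2 i) n l d)) ->
    forall p q l1 l2, (p + q)%N = n -> l1 + l2 = l -> Q _ _ _ _ (awm G H p q l1 l2 n l d).
  move=> Q0 Qi p q l1 l2 pq ll; have [/andP[l10 l20]|neg] := boolP ((0 <= l1) && (0 <= l2)).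
    exact: (bidegree_all (Q := fun p q l1 l2 => Q p q l1 l2 (awm G H p q l1 l2 n l d))).
  by rewrite awm_neg.
have del0 p q l1 l2 : (p.+1 + q)%N = n -> l1 + l2 = l ->
    tens_map (@kappa_bd R G l1 p) (@psi R H l2 q) (awm G H p.+1 q l1 l2 n l (kval c)) = 0.
  move=> pq ll; have [/andP[l10 l20]|neg] := boolP ((0 <= l1) && (0 <= l2)); last first.
    by rewrite awm_neg // raddf0.
  have pq' : (p + q.+1)%N = n by rewrite addnS -addSn.
  apply: (bidegree_all (Q := fun p q l1 l2 => del_pair G H n l p q l1 l2 (kval c) = 0) _ pq' ll l10 l20).
  by move=> i; rewrite -del_termE dc.
pose U i := sval (cid (coret_awm_bd cc del0 (bidegree_deg i) (bidegree_len i))).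
have U1 i : awm G H (deg1 i) (deg2 i) (len1 i) (len2 i) n l (kval c) = 0 -> U i = 0.
  exact: (svalP (cid (coret_awm_bd cc del0 (bidegree_deg i) (bidegree_len i)))).1.
have U2 i : tens_map (@coret R G (len1 i) (deg1 i)) (mc_bd H (deg2 i) (len2 i)) (U i) =
    tens_map (@coret R G (len1 i) (deg1 i)) idfun
      (awm G H (deg1 i) (deg2 i) (len1 i) (len2 i) n l (kval c)).
  exact: (svalP (cid (coret_awm_bd cc del0 (bidegree_deg i) (bidegree_len i)))).2.
have [S SP] := awm_fset (kval c).
have shS (i : bidegree n l) : (deg1 i + (deg2 i).+1)%N = n.+1 :> nat by rewrite addnS bidegree_deg.
pose e := assemble n.+1 (sh := succn) U S.
have eE := awm_assemble (sh := succn) shS (fun i iS => U1 i (SP i iS)).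
(* This boundary cancels the [coret] part of the first factor in every component. *)
pose c1 := kval c - mc_bd P n l e.
have cc1 : bd_out A n c1 = 0 by rewrite /c1 raddfB cc [X in - X](@bd_out_bd A n e) subrr.
have coret1 p q l1 l2 : (p + q)%N = n -> l1 + l2 = l ->
    tens_map (@coret R G l1 p) idfun (awm G H p q l1 l2 n l c1) = 0.
  apply: (pos (fun p q l1 l2 u => tens_map (@coret R G l1 p) idfun u = 0)) => [|i].
    by move=> *; rewrite raddf0.
  rewrite /c1 raddfB awm_bd ?bidegree_deg ?bidegree_len // raddfB raddfD raddfMz.
  rewrite 2!tens_map_comp [X in X *~ _]tens_map0l ?mul0rz ?add0r => [|x]; last exact: coret_bd.
  rewrite eE -U2; apply/eqP; rewrite subr_eq0; apply/eqP; exact: tens_map_eq.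
have bd1 p q l1 l2 : (p + q)%N = n -> l1 + l2 = l ->
    tens_map (bd_out (magnitude_complex G l1) p) idfun (awm G H p q l1 l2 n l c1) = 0.
  move=> pq ll; rewrite -(raddf0 (tens_map (bd_out (magnitude_complex G l1) p)
    (idfun : {additive mc_group H q l2 -> _}))) -(coret1 p q l1 l2 pq ll) tens_map_comp.
  by apply: tens_map_eq => // x; apply/esym/bd_coret.
(* [awm_rel] carries the vanishing over to the second factor; with flatness, the components of [c1]
   lie in cycles tensor cycles. *)
have bd2 p q l1 l2 : (p + q)%N = n -> l1 + l2 = l ->
    tens_map idfun (bd_out (magnitude_complex H l2) q) (awm G H p q l1 l2 n l c1) = 0.
  case: q => [|q] pq ll; first by rewrite tens_map0r.
  have nE : n = (p + q).+1 by rewrite -pq addnS.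
  have pq' : (p.+1 + q)%N = n by rewrite addSn nE.
  have := awm_rel nE ll cc1.
  by rewrite [X in X *~ _](bd1 p.+1 q l1 l2 pq' ll) mul0rz add0r.
have coret2 p q l1 l2 : (p + q)%N = n -> l1 + l2 = l ->
    tens_map idfun (@coret R H l2 q) (awm G H p q l1 l2 n l c1) = 0.
  move=> pq ll; apply: (free_flatr
    (f := bd_out (magnitude_complex H l2) q : {additive mc_group H q l2 -> mc_group H q.-1 l2})
    (f' := @ret R H l2 q)).
  - by move=> x xc x0; rewrite -(ret_cycle xc).
  - rewrite tens_map_comp -(bd2 p q l1 l2 pq ll).
    by apply: tens_map_eq => // x; apply: bd_coret.
  - by rewrite tens_map_comp tens_map0r // => x; apply: ret_coret.
have retE p q l1 l2 : (p + q)%N = n -> l1 + l2 = l ->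
    tens_map (@ret R G l1 p) (@ret R H l2 q) (awm G H p q l1 l2 n l c1) =
    awm G H p q l1 l2 n l c1.
  move=> pq ll; rewrite -[RHS]tens_map_id.
  rewrite [RHS](tens_mapDl (f := @ret R G l1 p) (f' := @coret R G l1 p)); last first.
    exact: ret_coret_split.
  rewrite coret1 // addr0.
  rewrite [RHS](@tens_mapDr _ _ _ _ _ (@ret R H l2 q) (@coret R H l2 q)); last first.
    exact: ret_coret_split.
  rewrite [X in _ + X](_ : _ = 0) ?addr0 //.
  rewrite -(raddf0 (tens_map (@ret R G l1 p) (idfun : {additive mc_group H q l2 -> _}))).
  rewrite -(coret2 p q l1 l2 pq ll) tens_map_comp; exact: tens_map_eq.
have [S1 S1P] := awm_fset c1.
pose X (i : bidegree n l) := awm G H (deg1 i) (deg2 i) (len1 i) (len2 i) n l c1.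
(* The exterior product of its own components: a cycle that differs from [c1] by an [aw_null] cycle,
   hence by a boundary. *)
pose c2 := assemble n (sh := id) X S1.
have c2E := awm_assemble (sh := id) (@bidegree_deg R n l) S1P.
have cc2 : bd_out A n c2 = 0.
  rewrite /c2 /assemble raddf_sum big1 // => i _.
  apply: extn_cycle (bidegree_deg i) (bidegree_len i) _ _ _.
    by rewrite /X bd1 ?bidegree_deg ?bidegree_len.
  by rewrite /X bd2 ?bidegree_deg ?bidegree_len.
have an : aw_null (c1 - c2).
  apply: (pos (fun p q l1 l2 u => u = 0)) => // i.
  by rewrite raddfB c2E subrr.
have bc : bd_out A n (c1 - c2) = 0 by rewrite raddfB cc1 cc2 subrr.
have [e2 e2E] := aw_null_boundary an bc.
exists (\sum_(i <- S1) dsum_in (tensor_term G H (l := l)) i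
  (tens_map (@psi R G (len1 i) (deg1 i)) (@psi R H (len2 i) (deg2 i)) (X i))).
rewrite raddf_sum -psi_cycle.
have -> : kval c = c2 + mc_bd P n l (e2 + e).
  by rewrite raddfD -e2E /c1 addrA [c2 + _]addrC subrK subrK.
rewrite raddfD psi_bd addr0 /c2 /assemble raddf_sum; apply: eq_bigr => i _.
by rewrite sqE sq_pair_psi /X retE ?bidegree_deg ?bidegree_len.
Qed.
End KernelOfDel.

(** * Surjectivity of the map to Tor *)

Section Surjectivity.
Variables (R : realType) (G H : hypergraph) (n : nat) (l : R).
Local Notation P := (cart_prod G H).
Local Notation A := (magnitude_complex P l).

Definition kappa_psi_null p q (l1 l2 : R) (u : tensor (mc_group G p l1) (mc_group H q l2)) : Prop :=
  match p return tensor (mc_group G p l1) (mc_group H q l2) -> Prop with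
  | 0 => fun=> True
  | p0.+1 => fun u => tens_map (@kappa_bd R G l1 p0) (@psi R H l2 q) u = 0
  end u.

Lemma kappa_psi_null0 p q (l1 l2 : R) : @kappa_psi_null p q l1 l2 0.
Proof. by case: p => //= p; rewrite raddf0. Qed.

Lemma kappa_psi_null_lambda p q (l1 l2 : R) u :
  @kappa_psi_null p q l1 l2 (tens_map (lambda G l1 p) idfun u).
Proof.
case: p u => // p u; rewrite /kappa_psi_null tens_map_comp tens_map0l // => a.
apply: kval_eq0; rewrite -[LHS]/(kappa G l1 p (bd_out (magnitude_complex G l1) p.+1 (lambda G l1 p.+1 a))).
by rewrite bd_lambda raddf0.
Qed.

Lemma tensor_I1_eq0 (B : zmodType) (x : tensor B 'I_1) : x = 0.
Proof.
move: x; apply: tens_ind => // [a b|x y -> ->]; last by rewrite addr0.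
by rewrite (ord1 b) tens0r.
Qed.

Lemma del_pair_surj p q l1 l2
    (y : tensor (free_res (magnitude_homology G p l1)) (homology_pred (magnitude_complex H l2) q)) :
  (p + q)%N = n -> l1 + l2 = l -> tor_map0 _ _ y = 0 ->
  exists c : mc_group P n l, [/\ bd_out A n c = 0, del_pair G H n l p q l1 l2 c = y &
    forall p' q' l1' l2', (p' + q')%N = n -> l1' + l2' = l -> (p', l1') != (p, l1) ->
      del_pair G H n l p' q' l1' l2' c = 0].
Proof.
case: q y => [|q] y pq ll y0.
  exists 0; split; first by rewrite raddf0.
    by rewrite raddf0 (tensor_I1_eq0 y).
  by move=> *; rewrite raddf0.
pose D := magnitude_complex H l2; pose C := magnitude_complex G l1.
have [t tE] := @tens_map_surj _ _ _ _ (idfun : {additive free_res (homology C p) -> _})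
  (hclass D q) (fun a => ex_intro _ a erefl) (@hclass_surj D q) y.
have [sigma [s1 _]] := sigma_ex G l1 p; have [hF hFE] := free_homotopy_ex G l1 p.
(* Here [y] lies in Tor: its lift [t] dies in the free group tensor homology, so it bounds there in
   the second factor. *)
have [|u uE] := @tens_hclass_exact R H l2 q _ (tens_map (kernel_incl (free_aug (homology C p))) idfun t).
  by rewrite -y0 /tor_map0 -tE 2!tens_map_comp; apply: tens_map_eq.
pose x0 := tens_map sigma (kernel_incl (bd_out D q)) t.
pose x1 := tens_map (lambda G l1 p) idfun u.
have pq' : (p.+1 + q)%N = n by rewrite addSnnS.
(* The sign matches the one that [extn_bd] puts on the boundary of the first factor of [x0]. *)
pose c := extn G H p.+1 q l1 l2 n l x0 - extn G H p q.+1 l1 l2 n l x1 *~ (-1) ^+ q.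
have kincl : tens_map (lambda G l1 p) (kernel_incl (bd_out D q))
    (tens_map (kernel_incl (free_aug (homology C p))) idfun t) =
    tens_map idfun (mc_bd H q l2) x1.
  by rewrite -uE /x1 2!tens_map_comp; apply: tens_map_eq.
have bx0 : tens_map (mc_bd G p l1) idfun x0 = tens_map idfun (mc_bd H q l2) x1.
  by rewrite -kincl /x0 2!tens_map_comp; apply: tens_map_eq => // k; apply: s1.
exists c; split.
- rewrite /c raddfB raddfMz (extn_bd _ pq' ll) (extn_bd _ pq ll) /ext_bd_rhs.
  rewrite [tens_map idfun _ x0](_ : _ = 0); last first.
    by rewrite /x0 tens_map_comp tens_map0r // => w; apply: kernelP.
  rewrite [tens_map _ idfun x1](_ : _ = 0); last first.
    by rewrite /x1 tens_map_comp tens_map0l // => a; apply: bd_lambda.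
  rewrite 2!raddf0 mul0rz add0r addr0 [tens_map _ idfun x0]bx0.
  exact: subrr.
- rewrite -[LHS]/(tens_map (@kappa_bd R G l1 p) (@psi R H l2 q) (awm G H p.+1 q l1 l2 n l c)).
  rewrite /c (raddfB (awm _ _ _ _ _ _ _ _)) raddfMz awm_extn // awm_extn0 //; last first.
    by apply/eqP => -[] /eqP; rewrite eqn_leq ltnn.
  rewrite mul0rz subr0 /x0 tens_map_comp.
  (* [kappa_bd \o sigma] is the identity up to a map through the inclusion of [free_res], which
     vanishes on [y]. *)
  rewrite (tens_mapDl (f := idfun) (f' := hF \o kernel_incl (free_aug (homology C p)))); last first.
    move=> k; apply/val_inj; rewrite -[LHS]/(kappa G l1 p (mc_bd G p l1 (sigma k))) s1.
    by rewrite -[RHS]/(kval k + kval (hF (kval k))) hFE addrC subrK.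
  have -> : tens_map idfun (@psi R H l2 q \o kernel_incl (bd_out D q)) t = y.
    by rewrite -tE; apply: tens_map_eq => // w; apply: psi_cycle.
  rewrite [X in _ + X](_ : _ = 0) ?addr0 //.
  rewrite -(raddf0 (tens_map hF (idfun : {additive homology D q -> _}))) -y0 /tor_map0 -tE 2!tens_map_comp.
  by apply: tens_map_eq => // w; apply: psi_cycle.
- move=> p' [|q'] l1' l2' pq2 ll2 ne //.
  rewrite -[LHS]/(tens_map (@kappa_bd R G l1' p') (@psi R H l2' q') (awm G H p'.+1 q' l1' l2' n l c)).
  have pq3 : (p'.+1 + q')%N = n by rewrite addSnnS.
  have ne' : (p'.+1, l1') != (p.+1, l1) by apply: contra_neq ne => -[-> ->].
  rewrite /c (raddfB (awm _ _ _ _ _ _ _ _)) raddfMz (awm_extn0 x0 pq' ll pq3 ll2 ne').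
  rewrite sub0r raddfN raddfMz.
  have := awm_extn_ind (Q := kappa_psi_null) pq ll pq3 ll2
    (kappa_psi_null_lambda u) (@kappa_psi_null0 p'.+1 q' l1' l2').
  by rewrite /kappa_psi_null => ->; rewrite mul0rz oppr0.
Qed.

Lemma del_surj y : exists h, del G H n l h = y.
Proof.
move: y; apply: dsum_ind => [|i y|x y [h hE] [k kE]].
- by exists 0; rewrite raddf0.
- have [c [cc cE cN]] := del_pair_surj (bidegree_deg i) (bidegree_len i) (kernelP y).
  have ck : c \in in_kernel (bd_out A n) by rewrite unfold_in; apply/eqP.
  exists (hclass A n (Kernel ck)); apply: dsum_eq => j; rewrite delE.
  have [ij|/eqP ij] := pselect (i = j).
    by subst j; rewrite dsum_in_eq; apply/val_inj.
  rewrite dsum_in_neq //; apply: kval_eq0; rewrite del_termE.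
  by rewrite cN ?bidegree_deg ?bidegree_len ?bidegree_neq.
- by exists (h + k); rewrite raddfD hE kE.
Qed.
End Surjectivity.

(** * Naturality of the map to Tor *)

Section DelNatural.
Variables (R : realType) (G G' H H' : hypergraph).
Variables (f : hmorphism G G') (g : hmorphism H H') (n : nat) (l : R).
Local Notation P := (cart_prod G H).
Local Notation A := (magnitude_complex P l).
Local Notation hf p l1 := (homology_map (magnitude_map f l1) p).
Local Notation hg q l2 := (homology_map (magnitude_map g l2) q).

Lemma homology_map_psi (K K' : hypergraph) (h : hmorphism K K') k (l0 : R) x :
  homology_map (magnitude_map h l0) k (psi K l0 k x) =
  psi K' l0 k (mc_map_fun h k l0 (ret K l0 k x)).
Proof.
rewrite psiE homology_mapE -psi_cycle; congr (psi _ _ _ _).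
Qed.

Lemma mc_map_cycle (K K' : hypergraph) (h : hmorphism K K') k (l0 : R) x :
  bd_out (magnitude_complex K l0) k x = 0 ->
  bd_out (magnitude_complex K' l0) k (mc_map_fun h k l0 x) = 0.
Proof. exact: (@cycles_map_subproof _ _ (magnitude_map h l0)). Qed.

(** Both maps on the first factor kill cycles, so the second factor may be restricted to cycles,
    where the two class maps agree. The maps on the first factor then differ by [h] after the
    boundary, a term killed by [awm_rel_l]. *)
Lemma del_pair_natural p q l1 l2 (c : mc_group P n l) :
  (p + q)%N = n -> l1 + l2 = l -> bd_out A n c = 0 ->
  tens_map (free_res_map (hf p l1)) (homology_pred_map (magnitude_map g l2) q)
    (del_pair G H n l p q l1 l2 c) =
  del_pair G' H' n l p q l1 l2 (mc_map_fun (cart_map f g) n l c).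
Proof.
case: q => [|q] pq ll cc; first by rewrite [LHS]tensor_I1_eq0 [RHS]tensor_I1_eq0.
have pq' : n = (p.+1 + q)%N by rewrite -pq addSnnS.
rewrite -[LHS]/(tens_map (free_res_map (hf p l1)) (hg q l2)
  (tens_map (@kappa_bd R G l1 p) (@psi R H l2 q) (awm G H p.+1 q l1 l2 n l c))).
rewrite -[RHS]/(tens_map (@kappa_bd R G' l1 p) (@psi R H' l2 q)
  (awm G' H' p.+1 q l1 l2 n l (mc_map_fun (cart_map f g) n l c))).
rewrite awm_natural // 2!tens_map_comp.
set X := awm _ _ _ _ _ _ _ _ _.
pose a1 : {additive mc_group G p.+1 l1 -> _} := free_res_map (hf p l1) \o @kappa_bd R G l1 p.
pose a2 : {additive mc_group G p.+1 l1 -> _} := @kappa_bd R G' l1 p \o mc_map_fun f p.+1 l1.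
pose b1 : {additive mc_group H q l2 -> _} := hg q l2 \o @psi R H l2 q.
pose b2 : {additive mc_group H q l2 -> _} := @psi R H' l2 q \o mc_map_fun g q l2.
have a1r x : a1 (@ret R G l1 p.+1 x) = 0.
  by rewrite -[LHS]/(free_res_map (hf p l1) (kappa_bd G l1 p (ret G l1 p.+1 x))) kappa_bd_ret raddf0.
have a2r x : a2 (@ret R G l1 p.+1 x) = 0.
  apply: kval_eq0.
  rewrite -[LHS]/(kappa G' l1 p (mc_bd G' p l1 (mc_map_fun f p.+1 l1 (ret G l1 p.+1 x)))).
  by rewrite [mc_bd _ _ _ _](mc_map_cycle f (bd_ret x)) raddf0.
have e1 := tens_map_ret_r b1 a1r pq' ll cc.
have e2 := tens_map_ret_r b2 a2r pq' ll cc.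
apply: etrans e1 _; apply: etrans (esym e2).
have bE : b2 \o @ret R H l2 q =1 b1 \o @ret R H l2 q.
  move=> y; rewrite -[RHS]/(hg q l2 (psi H l2 q (ret H l2 q y))).
  by rewrite homology_map_psi ret_ret.
have e3 : tens_map a2 (b2 \o @ret R H l2 q) X = tens_map a2 (b1 \o @ret R H l2 q) X.
  by apply: tens_map_eq.
apply: etrans (esym e3).
(* The failure of [kappa] to be natural; the augmentation kills it because classes of cycles are
   natural. *)
pose m y := free_ab_map (hf p l1) (kappa G l1 p (ret G l1 p y)) -
  kappa G' l1 p (mc_map_fun f p l1 (ret G l1 p y)).
have mB : zmod_morphism m.
  move=> x y; rewrite /m (raddfB (ret G l1 p)) (raddfB (kappa G l1 p)) (raddfB (mc_map_fun f p l1)).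
  rewrite (raddfB (kappa G' l1 p)) (raddfB (free_ab_map (hf p l1))).
  by rewrite !opprD !opprK addrACA.
have mE y : free_aug (homology (magnitude_complex G' l1) p) (additive_of mB y) = 0.
  rewrite additive_ofE /m raddfB free_aug_natural 2!aug_kappa homology_map_psi ret_ret.
  exact: subrr.
pose h : {additive _ -> free_res (homology (magnitude_complex G' l1) p)} := to_kernel mE.
rewrite (tens_mapDl (f := a2) (f' := h \o mc_bd G p l1)); last first.
  move=> x; apply/val_inj.
  rewrite -[LHS]/(free_ab_map (hf p l1) (kappa G l1 p (mc_bd G p l1 x))).
  rewrite -[RHS]/(kappa G' l1 p (mc_bd G' p l1 (mc_map_fun f p.+1 l1 x)) + m (mc_bd G p l1 x)).
  rewrite /m [ret G l1 p _]ret_bd mc_map_bd addrC subrK //.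
have e4 : tens_map (h \o mc_bd G p l1) (b1 \o @ret R H l2 q) X = 0.
  have en : n = (p + q).+1 by rewrite pq'.
  have b0 y : (b1 \o @ret R H l2 q) (mc_bd H q l2 y) = 0.
    rewrite -[LHS]/(hg q l2 (psi H l2 q (ret H l2 q (mc_bd H q l2 y)))).
    by rewrite [ret _ _ _ _]ret_bd [psi _ _ _ _]psi_bd raddf0.
  pose a' : {additive mc_group G p.+1 l1 -> _} := h \o mc_bd G p l1.
  have aE x : a' x = h (mc_bd G p l1 x) by [].
  exact: (awm_rel_l aE b0 en ll cc).
exact: etrans (congr1 (fun z => _ + z) e4) (addr0 _).
Qed.

Lemma del_natural (y : magnitude_homology P n l) :
  kunneth_tor_map f g n l (del G H n l y) = del G' H' n l (magnitude_cart_map f g n l y).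
Proof.
have [c <-] := hclass_surj y.
rewrite /magnitude_cart_map homology_mapE; apply: dsum_eq => i.
rewrite delE -[LHS]/(tor_map (hf (deg1 i) (len1 i))
  (homology_pred_map (magnitude_map g (len2 i)) (deg2 i)) (dsval (del G H n l (hclass A n c)) i)).
rewrite delE; apply/val_inj.
exact: del_pair_natural (bidegree_deg i) (bidegree_len i) (kernelP c).
Qed.
End DelNatural.

Theorem theorem1p2 (R : realType) :
  exists (sq : forall (G H : hypergraph) (n : nat) (l : R),
            {additive kunneth_tensor G H n l ->
                      magnitude_homology (cart_prod G H) n l})
         (del : forall (G H : hypergraph) (n : nat) (l : R),
            {additive magnitude_homology (cart_prod G H) n l ->
                      kunneth_tor G H n l}),
  [/\ forall (G H : hypergraph) (p q : nat) (l1 l2 : {nonneg R}),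
        induced_by_ext_prod (sq G H (p + q)%N (l1%:num + l2%:num)),
      forall (G H : hypergraph) (n : nat) (l : R),
        short_exact (sq G H n l) (del G H n l),
      forall (G G' H H' : hypergraph) (f : hmorphism G G') (g : hmorphism H H')
             (n : nat) (l : R) (x : kunneth_tensor G H n l),
        magnitude_cart_map f g n l (sq G H n l x) =
        sq G' H' n l (kunneth_tensor_map f g n l x) &
      forall (G G' H H' : hypergraph) (f : hmorphism G G') (g : hmorphism H H')
             (n : nat) (l : R) (y : magnitude_homology (cart_prod G H) n l),
        kunneth_tor_map f g n l (del G H n l y) =
        del G' H' n l (magnitude_cart_map f g n l y)].
Proof.
exists (@sq R), (@del R); split.
- by move=> *; apply: sq_induced.
- move=> G H n l; split; [exact: sq_inj | | exact: del_surj].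
  move=> y; split=> [|[x <-]]; last exact: del_sq.
  have [c <-] := hclass_surj y => dc; apply: del_ker => i.
  by rewrite -delE dc.
- by move=> *; apply: sq_natural.
- by move=> *; apply: del_natural.
Qed.
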